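(* Let $\Omega\subset\mathbb C^2$ be a polydisc (product of two discs in the coordinates $(x,y)$) and let $\Pi$ be the projective structure on $\Omega$ given by $$y''=A+B\,y'+C\,(y')^2+D\,(y')^3$$ with $A=D=0$ and $B,C$ holomorphic on $\Omega$. Let $f,g$ be germs of functions holomorphic at a point $p\in\Omega$ and satisfying $$\left\{\begin{array}{rcl} f_x&=&f^2-Bf+Ag+B_x-A_y\\ g_x-f_y&=&2\left(fg-Bg-Cf+BC-AD\right)\\ g_y&=&-g^2+Cg-Df+C_y-D_x\end{array}\right.$$ (with $A=D=0$). Then $f$ and $g$ extend meromorphically to the whole of $\Omega$.
   Context: Subscripts denote partial derivatives. All objects are complex analytic. The system expresses that the Riccati equation $dz=\alpha z^2+\beta z+\gamma$ with $\alpha=(C-g)dx+D\,dy$, $\beta=f\,dx+g\,dy$, $\gamma=A\,dx+(B-f)dy$ is Frobenius integrable. *)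

(* Defs.v *)
From Stdlib Require Import Reals.
From Coquelicot Require Import Coquelicot.

Open Scope C_scope.

(* Points of C^2 are pairs (x, y).  Functions on a subset of C^2 are total
   functions whose values outside the subset are irrelevant. *)

(* Complex (C-linear) Frechet differentiability at every point; meant for
   open U. *)
Definition holomorphic_on (U : C * C -> Prop) (h : C * C -> C) : Prop :=
  forall z, U z -> ex_filterdiff (K := C_AbsRing) h (locally z).

Definition holomorphic_germ (p : C * C) (h : C * C -> C) : Prop :=
  exists U, open U /\ U p /\ holomorphic_on U h.

Definition partial_x (h : C * C -> C) (z : C * C) : C :=
  C_derive (fun x => h (x, snd z)) (fst z).

Definition partial_y (h : C * C -> C) (z : C * C) : C :=
  C_derive (fun y => h (fst z, y)) (snd z).

Definition polydisc (a b : C) (r s : R) (z : C * C) : Prop :=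
  Rlt (Cmod (fst z - a)) r /\ Rlt (Cmod (snd z - b)) s.

(* The projective structure of y'' = A + B y' + C (y')^2 + D (y')^3, given by
   its coefficients. *)
Record projective_structure (Omega : C * C -> Prop) := {
  coefA : C * C -> C;
  coefB : C * C -> C;
  coefC : C * C -> C;
  coefD : C * C -> C;
  coefA_holo : holomorphic_on Omega coefA;
  coefB_holo : holomorphic_on Omega coefB;
  coefC_holo : holomorphic_on Omega coefC;
  coefD_holo : holomorphic_on Omega coefD
}.
Arguments coefA {Omega} _ _.
Arguments coefB {Omega} _ _.
Arguments coefC {Omega} _ _.
Arguments coefD {Omega} _ _.

(* Integrability of dz = ((C - g) dx + D dy) z^2 + (f dx + g dy) z
   + (A dx + (B - f) dy), at the point z. *)
Definition riccati_system_at {Omega : C * C -> Prop}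
    (Pi : projective_structure Omega) (f g : C * C -> C) (z : C * C) : Prop :=
  let A := coefA Pi in
  let B := coefB Pi in
  let C := coefC Pi in
  let D := coefD Pi in
  partial_x f z = f z * f z - B z * f z + A z * g z + partial_x B z - partial_y A z /\
  partial_x g z - partial_y f z
    = RtoC 2 * (f z * g z - B z * g z - C z * f z + B z * C z - A z * D z) /\
  partial_y g z = - (g z * g z) + C z * g z - D z * f z + partial_y C z - partial_x D z.

(* A meromorphic function is locally a quotient h / k of holomorphic functions,
   where k vanishes identically on no nonempty open set.  It is represented by
   a total function whose values at the zeros of k are not constrained. *)
Definition meromorphic_on (Omega : C * C -> Prop) (F : C * C -> C) : Prop :=
  forall a, Omega a ->
  exists (U : C * C -> Prop) (h k : C * C -> C),
    open U /\ U a /\ (forall z, U z -> Omega z) /\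
    holomorphic_on U h /\ holomorphic_on U k /\
    (forall z, U z -> ~ locally z (fun w => k w = RtoC 0)) /\
    (forall z, U z -> k z <> RtoC 0 -> F z = h z / k z).

Definition extends_meromorphically (p : C * C) (Omega : C * C -> Prop)
    (f : C * C -> C) : Prop :=
  exists F, meromorphic_on Omega F /\ locally p (fun z => F z = f z).

(* Main.v *)
Require Import Defs.
From Stdlib Require Import Reals Lra Classical ClassicalEpsilon.
From Coquelicot Require Import Coquelicot.

(** With u = f - B and v = g - C the system reads u_x = u^2 + B u,
    v_y = - v^2 - C v and v_x - u_y = 2 u v + B_y - C_x.  Let p = (x0, y0),
    let E and F be given by E_x = B E, E(x0, y) = 1 and F_x = E, F(x0, y) = 0,
    and similarly G_y = - C G, G(x, y0) = 1 and H_y = G, H(x, y0) = 0; all of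
    them are holomorphic on the polydisc.  The two Bernoulli equations give
    u (1 - u(x0, y) F) = u(x0, y) E and v (1 + v(x, y0) H) = v(x, y0) G near p.
    The second identity and its x-derivative express v and v_x on the line
    x = x0 as meromorphic functions of y on the whole disc, so the third
    equation is there a linear equation for u(x0, y), with integrating factor
    M = (1 + v(p) H(x0, y))^2: M u(x0, y) extends to a holomorphic function m.
    Hence f = B + m E / (M - m F) near p.  Exchanging x and y yields g.

    The denominator vanishes on no open set: there m E = - (M - m F)_x = 0,
    so m = M = 0, so v(p) G(x0, y) = 0, so v(p) = 0 and M = 1.

    Holomorphy is mere complex differentiability, so regularity rests on
    Goursat's theorem: a primitive of (phi - phi(z)) / (. - z), integrated along
    rays from z, gives Cauchy's formula, and the resulting second-order Taylor
    bound, uniform in a parameter, allows differentiation under the integral. *)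

Local Open Scope R_scope.

(** With A = D = 0 the first equation differentiates f along x alone and the third g along y alone,
    without coupling, so each is a one-variable Bernoulli equation and its solution is a global
    quotient in that variable. The difficulty is how the initial value u(x0, y) depends on y: it
    satisfies a linear equation whose coefficients are only meromorphic, and such an equation may
    have multivalued or essentially singular solutions. Its shape prevents this. Since H_y = G, on
    the line x = x0 the function v is the logarithmic derivative in y of 1 + v(p) H. The coefficient
    2 of u v in the mixed equation therefore gives an integrating factor with an integral exponent,
    namely the square of that function, and the same square clears the at most double poles of v_x.
    Only a primitive of a holomorphic function is left to take. All identities are kept free of
    denominators, so that no case distinction on zeros of u, v or 1 + v(p) H arises. *)

Lemma Cmod_triangle3 (x y z : C) : Cmod (x + y + z) <= Cmod x + Cmod y + Cmod z.
Proof.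
  apply Rle_trans with (1 := Cmod_triangle _ _).
  apply Rplus_le_compat_r, Cmod_triangle.
Qed.

Lemma Cmod_minus_sym (x y : C) : Cmod (x - y) = Cmod (y - x).
Proof. rewrite <- Cmod_opp. f_equal. ring. Qed.

Lemma Cmod_diag (x : C) : Cmod (x - x) = 0.
Proof. replace (x - x)%C with (RtoC 0) by ring. apply Cmod_0. Qed.

Lemma Cmod_minus_triangle (x y z : C) : Cmod (x - z) <= Cmod (x - y) + Cmod (y - z).
Proof. replace (x - z)%C with ((x - y) + (y - z))%C by ring. apply Cmod_triangle. Qed.

Lemma Cmod_RtoC (x : R) : 0 <= x -> Cmod (RtoC x) = x.
Proof. intros H. rewrite Cmod_R. now apply Rabs_pos_eq. Qed.

Lemma Cmod_le_0_eq (x y : C) : Cmod (x - y) <= 0 -> x = y.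
Proof.
  intros H. assert (E : (x - y)%C = RtoC 0).
  { apply Cmod_eq_0. generalize (Cmod_ge_0 (x - y)); lra. }
  replace x with ((x - y) + y)%C by ring. rewrite E. ring.
Qed.

Lemma Cmod_arbitrarily_small (x y : C) (K : R) :
  (forall e, 0 < e < 1 -> Cmod (x - y) <= K * e) -> x = y.
Proof.
  intros H. apply Cmod_le_0_eq, Rnot_lt_le. intros Hp.
  assert (HK : 0 < K).
  { apply Rmult_lt_reg_r with (/ 2); [lra|]. rewrite Rmult_0_l.
    eapply Rlt_le_trans; [exact Hp|]. apply H. lra. }
  pose (d := Cmod (x - y)). fold d in H, Hp.
  (* This value of [e] is below 1 and makes [K * e] smaller than [d / 2], against the hypothesis. *)
  assert (He : 0 < d / (2 * K + 2 * d) < 1).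
  { split.
    - apply Rdiv_lt_0_compat; lra.
    - apply Rmult_lt_reg_r with (2 * K + 2 * d); [lra|].
      unfold Rdiv. rewrite Rmult_assoc, Rinv_l, Rmult_1_r; lra. }
  specialize (H _ He).
  assert (E : K * (d / (2 * K + 2 * d)) * (2 * K + 2 * d) = K * d) by (field; lra).
  apply Rmult_le_compat_r with (r := 2 * K + 2 * d) in H; [|lra].
  rewrite E in H. nra.
Qed.

(** * Complex differentiability *)

(* [d] is the size of an increment and [L] the linear part of the increment of
   [h] at [z]; the same calculus then serves functions on C and on C^2. *)
Definition isD {T : Type} (d : T -> T -> R) (h : T -> C) (z : T) (L : T -> C) : Prop :=
  (exists M, 0 < M /\ forall w, Cmod (L w) <= M * d z w) /\
  forall eps, 0 < eps -> exists delta, 0 < delta /\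
    forall w, d z w < delta -> Cmod (h w - h z - L w) <= eps * d z w.

Definition dist1 (z w : C) : R := Cmod (w - z).
(** The sum norm is chosen because it behaves exactly under rescaled lines, translations and the
    exchange of coordinates; it is equivalent to the norm of the product space. *)
Definition dist2 (z w : C * C) : R := Cmod (fst w - fst z) + Cmod (snd w - snd z).

Definition D1 (phi : C -> C) (z l : C) : Prop :=
  isD dist1 phi z (fun w => l * (w - z))%C.

Definition D2 (h : C * C -> C) (z : C * C) (lx ly : C) : Prop :=
  isD dist2 h z (fun w => lx * (fst w - fst z) + ly * (snd w - snd z))%C.

Lemma dist1_ge_0 z w : 0 <= dist1 z w.
Proof. apply Cmod_ge_0. Qed.

Lemma dist2_ge_0 z w : 0 <= dist2 z w.
Proof. apply Rplus_le_le_0_compat; apply Cmod_ge_0. Qed.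

Lemma dist1_diag z : dist1 z z = 0.
Proof. apply Cmod_diag. Qed.

Lemma dist2_diag z : dist2 z z = 0.
Proof. unfold dist2. rewrite !Cmod_diag. ring. Qed.

Lemma isD_eqL {T} d (h : T -> C) z L L' :
  (forall w, L w = L' w) -> isD d h z L -> isD d h z L'.
Proof.
  intros E [[M [HM H1]] H2]. split.
  - exists M; split; [exact HM|]. intros w. rewrite <- E. apply H1.
  - intros e He. destruct (H2 e He) as [dl [Hd H]]. exists dl; split; [exact Hd|].
    intros w. rewrite <- E. apply H.
Qed.

Lemma isD_ext {T} d (h k : T -> C) z L r : 0 < r -> d z z < r ->
  (forall w, d z w < r -> h w = k w) -> isD d h z L -> isD d k z L.
Proof.
  intros Hr Hz E [HM H2]. split; [exact HM|].
  intros e He. destruct (H2 e He) as [dl [Hd H]].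
  exists (Rmin dl r); split; [now apply Rmin_glb_lt|].
  intros w Hw. rewrite <- !E; [|exact Hz|].
  - apply H. apply Rlt_le_trans with (1 := Hw), Rmin_l.
  - apply Rlt_le_trans with (1 := Hw), Rmin_r.
Qed.

(** The bound on [L] built into [isD] stands in for linearity, which has no meaning on the abstract
    type [T]. *)
Lemma isD_lipschitz {T} d (hd : forall z w : T, 0 <= d z w) h z L :
  isD d h z L -> exists M delta, 0 < M /\ 0 < delta /\
    forall w, d z w < delta -> Cmod (h w - h z) <= M * d z w.
Proof.
  intros [[M [HM H1]] H2]. destruct (H2 1 Rlt_0_1) as [dl [Hd H]].
  exists (M + 1), dl. repeat split; try lra.
  intros w Hw.
  replace (h w - h z)%C with ((h w - h z - L w) + L w)%C by ring.
  apply Rle_trans with (1 := Cmod_triangle _ _).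
  specialize (H w Hw). specialize (H1 w). lra.
Qed.

Lemma isD_continuous {T} d (hd : forall z w : T, 0 <= d z w) h z L :
  isD d h z L -> forall eps, 0 < eps -> exists delta, 0 < delta /\
    forall w, d z w < delta -> Cmod (h w - h z) < eps.
Proof.
  intros HD eps He. destruct (isD_lipschitz d hd _ _ _ HD) as [M [dl [HM [Hd H]]]].
  exists (Rmin dl (eps / M)). split.
  - apply Rmin_glb_lt; [exact Hd|]. now apply Rdiv_lt_0_compat.
  - intros w Hw. apply Rle_lt_trans with (M * d z w).
    + apply H. apply Rlt_le_trans with (1 := Hw), Rmin_l.
    + replace eps with (M * (eps / M)) by (field; lra).
      apply Rmult_lt_compat_l; [exact HM|]. apply Rlt_le_trans with (1 := Hw), Rmin_r.
Qed.

Lemma isD_const {T} d (hd : forall z w : T, 0 <= d z w) c z :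
  isD d (fun _ => c) z (fun _ => RtoC 0).
Proof.
  split.
  - exists 1; split; [lra|]. intros w. rewrite Cmod_0. generalize (hd z w); lra.
  - intros e He. exists 1; split; [lra|]. intros w _.
    replace (c - c - 0)%C with (RtoC 0) by ring. rewrite Cmod_0.
    apply Rmult_le_pos; [lra|apply hd].
Qed.

Lemma isD_plus {T} d (hd : forall z w : T, 0 <= d z w) h k z Lh Lk :
  isD d h z Lh -> isD d k z Lk ->
  isD d (fun w => h w + k w)%C z (fun w => Lh w + Lk w)%C.
Proof.
  intros [[M [HM H1]] H2] [[N [HN K1]] K2]. split.
  - exists (M + N); split; [lra|]. intros w.
    apply Rle_trans with (1 := Cmod_triangle _ _).
    specialize (H1 w). specialize (K1 w). lra.
  - intros e He. destruct (H2 (e / 2)) as [d1 [Hd1 H]]; [lra|].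
    destruct (K2 (e / 2)) as [d2 [Hd2 K]]; [lra|].
    exists (Rmin d1 d2); split; [now apply Rmin_glb_lt|]. intros w Hw.
    replace (h w + k w - (h z + k z) - (Lh w + Lk w))%C
      with ((h w - h z - Lh w) + (k w - k z - Lk w))%C by ring.
    apply Rle_trans with (1 := Cmod_triangle _ _).
    assert (A1 := H w (Rlt_le_trans _ _ _ Hw (Rmin_l _ _))).
    assert (A2 := K w (Rlt_le_trans _ _ _ Hw (Rmin_r _ _))). lra.
Qed.

Lemma isD_mult {T} d (hd : forall z w : T, 0 <= d z w) h k z Lh Lk :
  isD d h z Lh -> isD d k z Lk ->
  isD d (fun w => h w * k w)%C z (fun w => h z * Lk w + k z * Lh w)%C.
Proof.
  intros Dh Dk.
  destruct (isD_lipschitz d hd _ _ _ Dh) as [Mh [dh [HMh [Hdh Bh]]]].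
  destruct Dh as [[M [HM H1]] H2]. destruct (Dk) as [[N [HN K1]] K2].
  set (a := Cmod (h z)). set (b := Cmod (k z)).
  assert (Ha : 0 <= a) by apply Cmod_ge_0. assert (Hb : 0 <= b) by apply Cmod_ge_0.
  split.
  - exists (a * N + b * M + 1); split; [nra|]. intros w.
    apply Rle_trans with (1 := Cmod_triangle _ _). rewrite !Cmod_mult. fold a b.
    specialize (H1 w). specialize (K1 w). generalize (hd z w); intros Hz.
    assert (a * Cmod (Lk w) <= a * (N * d z w)) by now apply Rmult_le_compat_l.
    assert (b * Cmod (Lh w) <= b * (M * d z w)) by now apply Rmult_le_compat_l.
    lra.
  - intros e He.
    (* The increment of the product splits into three terms, each allotted a third of [e]; [a + 1]
       and [b + 1] are used because [a] and [b] may vanish. *)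
    assert (He1 : 0 < e / (3 * (a + 1))) by (apply Rdiv_lt_0_compat; lra).
    assert (He2 : 0 < e / (3 * (b + 1))) by (apply Rdiv_lt_0_compat; lra).
    assert (He3 : 0 < e / (3 * Mh)) by (apply Rdiv_lt_0_compat; lra).
    destruct (K2 _ He1) as [d1 [Hd1 K]]. destruct (H2 _ He2) as [d2 [Hd2 H]].
    destruct (isD_continuous d hd _ _ _ Dk) with (eps := e / (3 * Mh)) as [d3 [Hd3 C3]]; [lra|].
    exists (Rmin (Rmin d1 d2) (Rmin d3 dh)); split; [repeat apply Rmin_glb_lt; lra|].
    intros w Hw.
    assert (W1 : d z w < d1 /\ d z w < d2 /\ d z w < d3 /\ d z w < dh).
    { generalize (Rmin_l (Rmin d1 d2) (Rmin d3 dh)) (Rmin_r (Rmin d1 d2) (Rmin d3 dh))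
        (Rmin_l d1 d2) (Rmin_r d1 d2) (Rmin_l d3 dh) (Rmin_r d3 dh). lra. }
    destruct W1 as [W1 [W2 [W3 W4]]].
    replace (h w * k w - h z * k z - (h z * Lk w + k z * Lh w))%C
      with (h z * (k w - k z - Lk w) + k z * (h w - h z - Lh w)
            + (h w - h z) * (k w - k z))%C by ring.
    apply Rle_trans with (1 := Cmod_triangle3 _ _ _). rewrite !Cmod_mult. fold a b.
    specialize (K w W1). specialize (H w W2). specialize (C3 w W3). specialize (Bh w W4).
    generalize (hd z w); intros Hz.
    assert (a * Cmod (k w - k z - Lk w) <= e / 3 * d z w).
    { apply Rle_trans with (a * (e / (3 * (a + 1)) * d z w)).
      - now apply Rmult_le_compat_l.
      - apply Rle_trans with ((a + 1) * (e / (3 * (a + 1)) * d z w)).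
        + apply Rmult_le_compat_r; [|lra]. apply Rmult_le_pos; lra.
        + right. field. lra. }
    assert (b * Cmod (h w - h z - Lh w) <= e / 3 * d z w).
    { apply Rle_trans with (b * (e / (3 * (b + 1)) * d z w)).
      - now apply Rmult_le_compat_l.
      - apply Rle_trans with ((b + 1) * (e / (3 * (b + 1)) * d z w)).
        + apply Rmult_le_compat_r; [|lra]. apply Rmult_le_pos; lra.
        + right. field. lra. }
    assert (Cmod (h w - h z) * Cmod (k w - k z) <= e / 3 * d z w).
    { apply Rle_trans with ((Mh * d z w) * (e / (3 * Mh))).
      - apply Rmult_le_compat; try apply Cmod_ge_0; lra.
      - right. field. lra. }
    lra.
Qed.

Lemma isD_comp {T} d (hd : forall z w : T, 0 <= d z w) h z L phi l :
  D1 phi (h z) l -> isD d h z L -> isD d (fun w => phi (h w)) z (fun w => l * L w)%C.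
Proof.
  intros [_ P] Dh.
  destruct (isD_lipschitz d hd _ _ _ Dh) as [Mh [dh [HMh [Hdh Bh]]]].
  destruct Dh as [[M [HM H1]] H2].
  set (a := Cmod l). assert (Ha : 0 <= a) by apply Cmod_ge_0.
  split.
  - exists (a * M + 1); split; [nra|]. intros w. rewrite Cmod_mult. fold a.
    specialize (H1 w). generalize (hd z w); intros Hz.
    assert (a * Cmod (L w) <= a * (M * d z w)) by now apply Rmult_le_compat_l. lra.
  - intros e He.
    assert (He1 : 0 < e / (2 * Mh)) by (apply Rdiv_lt_0_compat; lra).
    assert (He2 : 0 < e / (2 * (a + 1))) by (apply Rdiv_lt_0_compat; lra).
    destruct (P _ He1) as [d1 [Hd1 P1]]. destruct (H2 _ He2) as [d2 [Hd2 H]].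
    assert (Hd3 : 0 < d1 / Mh) by now apply Rdiv_lt_0_compat.
    exists (Rmin (d1 / Mh) (Rmin d2 dh)); split; [repeat apply Rmin_glb_lt; lra|].
    intros w Hw.
    assert (W1 : d z w < d1 / Mh /\ d z w < d2 /\ d z w < dh).
    { generalize (Rmin_l (d1 / Mh) (Rmin d2 dh)) (Rmin_r (d1 / Mh) (Rmin d2 dh))
        (Rmin_l d2 dh) (Rmin_r d2 dh). lra. }
    destruct W1 as [W1 [W2 W4]]. generalize (hd z w); intros Hz.
    specialize (Bh w W4). specialize (H w W2).
    assert (Q : Mh * d z w < d1).
    { replace d1 with (Mh * (d1 / Mh)) by (field; lra). now apply Rmult_lt_compat_l. }
    assert (P2 : Cmod (phi (h w) - phi (h z) - l * (h w - h z)) <= e / 2 * d z w).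
    { apply Rle_trans with (e / (2 * Mh) * (Mh * d z w)).
      - apply Rle_trans with (e / (2 * Mh) * Cmod (h w - h z)).
        + apply P1. unfold dist1. lra.
        + apply Rmult_le_compat_l; lra.
      - right. field. lra. }
    replace (phi (h w) - phi (h z) - l * L w)%C
      with ((phi (h w) - phi (h z) - l * (h w - h z)) + l * (h w - h z - L w))%C by ring.
    apply Rle_trans with (1 := Cmod_triangle _ _). rewrite Cmod_mult. fold a.
    assert (a * Cmod (h w - h z - L w) <= e / 2 * d z w).
    { apply Rle_trans with (a * (e / (2 * (a + 1)) * d z w)).
      - now apply Rmult_le_compat_l.
      - apply Rle_trans with ((a + 1) * (e / (2 * (a + 1)) * d z w)).
        + apply Rmult_le_compat_r; [|lra]. apply Rmult_le_pos; lra.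
        + right. field. lra. }
    lra.
Qed.

(** A Lipschitz bound on [gamma] suffices because the new linear part is [L] evaluated along [gamma]
    itself. For the affine maps used later (lines, translations, exchange or freezing of
    coordinates) it is again linear in the increment. *)
Lemma isD_precomp {S T} dS dT (hd : forall z w : S, 0 <= dS z w) (gamma : S -> T) K h z L :
  0 < K -> (forall w, dT (gamma z) (gamma w) <= K * dS z w) ->
  isD dT h (gamma z) L -> isD dS (fun w => h (gamma w)) z (fun w => L (gamma w)).
Proof.
  intros HK Hg [[M [HM H1]] H2]. split.
  - exists (M * K); split; [nra|]. intros w.
    apply Rle_trans with (1 := H1 _). rewrite Rmult_assoc.
    apply Rmult_le_compat_l; [lra|apply Hg].
  - intros e He. destruct (H2 (e / K)) as [dl [Hd H]]; [now apply Rdiv_lt_0_compat|].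
    exists (dl / K); split; [now apply Rdiv_lt_0_compat|]. intros w Hw.
    specialize (Hg w).
    assert (Q : K * dS z w < dl).
    { replace dl with (K * (dl / K)) by (field; lra). now apply Rmult_lt_compat_l. }
    apply Rle_trans with (e / K * dT (gamma z) (gamma w)).
    + apply H. lra.
    + apply Rle_trans with (e / K * (K * dS z w)).
      * apply Rmult_le_compat_l; [|exact Hg]. left. now apply Rdiv_lt_0_compat.
      * right. field. lra.
Qed.

(** * Derivatives in one complex variable *)

Lemma D1_eq phi z l l' : l = l' -> D1 phi z l -> D1 phi z l'.
Proof. now intros ->. Qed.

Lemma D1_ext phi psi z l r : 0 < r ->
  (forall w, Cmod (w - z) < r -> phi w = psi w) -> D1 phi z l -> D1 psi z l.
Proof.
  intros Hr. apply (isD_ext dist1 phi psi z _ r Hr). now rewrite dist1_diag.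
Qed.

Lemma D1_const c z : D1 (fun _ => c) z 0.
Proof.
  eapply isD_eqL; [|apply isD_const, dist1_ge_0]. intros w; simpl; ring.
Qed.

Lemma D1_id z : D1 (fun w => w) z 1.
Proof.
  split.
  - exists 1; split; [lra|]. intros w. unfold dist1.
    replace (1 * (w - z))%C with (w - z)%C by ring. lra.
  - intros e He. exists 1; split; [lra|]. intros w _.
    replace (w - z - 1 * (w - z))%C with (RtoC 0) by ring. rewrite Cmod_0.
    apply Rmult_le_pos; [lra|apply dist1_ge_0].
Qed.

Lemma D1_plus phi psi z l m :
  D1 phi z l -> D1 psi z m -> D1 (fun w => phi w + psi w)%C z (l + m)%C.
Proof.
  intros H K. eapply isD_eqL; [|exact (isD_plus _ dist1_ge_0 _ _ _ _ _ H K)].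
  intros w; simpl; ring.
Qed.

Lemma D1_mult phi psi z l m :
  D1 phi z l -> D1 psi z m ->
  D1 (fun w => phi w * psi w)%C z (phi z * m + psi z * l)%C.
Proof.
  intros H K. eapply isD_eqL; [|exact (isD_mult _ dist1_ge_0 _ _ _ _ _ H K)].
  intros w; simpl; ring.
Qed.

Lemma D1_scal c phi z l : D1 phi z l -> D1 (fun w => c * phi w)%C z (c * l)%C.
Proof.
  intros H. apply D1_eq with (2 := D1_mult _ _ _ _ _ (D1_const c z) H). ring.
Qed.

Lemma D1_minus phi psi z l m :
  D1 phi z l -> D1 psi z m -> D1 (fun w => phi w - psi w)%C z (l - m)%C.
Proof.
  intros H K. apply (D1_scal (- (1))%C) in K.
  apply D1_ext with (fun w => phi w + - (1) * psi w)%C 1; [lra| |].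
  - intros w _. ring.
  - apply D1_eq with (2 := D1_plus _ _ _ _ _ H K). ring.
Qed.

Lemma D1_comp phi psi z l m :
  D1 phi (psi z) l -> D1 psi z m -> D1 (fun w => phi (psi w)) z (l * m)%C.
Proof.
  intros H K. eapply isD_eqL; [|exact (isD_comp _ dist1_ge_0 _ _ _ _ _ H K)].
  intros w; simpl; ring.
Qed.

Lemma D1_affine a b z : D1 (fun w => a + b * w)%C z b.
Proof.
  eapply D1_eq; [|apply D1_plus; [apply D1_const|apply D1_scal, D1_id]]. ring.
Qed.

Lemma D1_inv z : z <> RtoC 0 -> D1 (fun w => / w)%C z (- / (z * z))%C.
Proof.
  intros Hz. assert (Hm : 0 < Cmod z) by now apply Cmod_gt_0.
  set (a := Cmod z) in *.
  split.
  - exists (/ (a * a)); split; [apply Rinv_0_lt_compat; nra|]. intros w.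
    rewrite Cmod_mult, Cmod_opp, Cmod_inv, Cmod_mult.
    + right; reflexivity.
    + now apply Cmult_neq_0.
  - intros e He.
    assert (Hd : 0 < e * (a * a * a) / 2).
    { apply Rmult_lt_0_compat; [|lra]. apply Rmult_lt_0_compat; [lra|].
      apply Rmult_lt_0_compat; nra. }
    exists (Rmin (a / 2) (e * (a * a * a) / 2)); split; [apply Rmin_glb_lt; lra|].
    intros w Hw. unfold dist1 in *.
    assert (W1 := Rlt_le_trans _ _ _ Hw (Rmin_l _ _)).
    assert (W2 := Rlt_le_trans _ _ _ Hw (Rmin_r _ _)).
    assert (Hw2 : a / 2 < Cmod w).
    { assert (T := Cmod_triangle w (z - w)).
      replace (w + (z - w))%C with z in T by ring. fold a in T.
      rewrite Cmod_minus_sym in T. lra. }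
    assert (Hw0 : w <> RtoC 0) by (apply Cmod_gt_0; lra).
    replace (/ w - / z - - / (z * z) * (w - z))%C
      with ((w - z) * (w - z) * / (w * (z * z)))%C by (field; tauto).
    assert (Hzz : (w * (z * z))%C <> RtoC 0).
    { now repeat apply Cmult_neq_0. }
    rewrite !Cmod_mult, Cmod_inv, !Cmod_mult by exact Hzz. fold a.
    assert (Hp : 0 < Cmod w * (a * a)) by (repeat apply Rmult_lt_0_compat; lra).
    apply Rmult_le_reg_r with (Cmod w * (a * a)); [exact Hp|].
    rewrite Rmult_assoc, Rinv_l by lra.
    set (x := Cmod (w - z)) in *. assert (Hx : 0 <= x) by apply Cmod_ge_0.
    assert (A1 : a / 2 * (a * a) <= Cmod w * (a * a)) by (apply Rmult_le_compat_r; nra).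
    assert (A2 : x <= e * (Cmod w * (a * a))).
    { apply Rmult_le_compat_l with (r := e) in A1; [|lra]. lra. }
    apply Rmult_le_compat_l with (r := x) in A2; [|exact Hx]. lra.
Qed.

Lemma D1_continuous phi z l : D1 phi z l -> forall eps, 0 < eps -> exists delta,
  0 < delta /\ forall w, Cmod (w - z) < delta -> Cmod (phi w - phi z) < eps.
Proof. intros H. apply (isD_continuous _ dist1_ge_0 _ _ _ H). Qed.

Lemma D1_is_derive phi z l : D1 phi z l -> is_derive (K := C_AbsRing) (V := C_NormedModule) phi z l.
Proof.
  intros [_ H]. split.
  - apply (is_linear_scal_l (K := C_AbsRing) (V := C_NormedModule)).
  - intros x Hx.
    apply (is_filter_lim_locally_unique (V := AbsRing_NormedModule C_AbsRing)) in Hx. subst x.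
    intros [e He]. destruct (H e He) as [d [Hd P]]. exists (mkposreal d Hd).
    intros w Hw. specialize (P w). simpl.
    change (Cmod (phi w - phi z - (w - z) * l) <= e * Cmod (w - z)).
    rewrite (Cmult_comm (w - z)). apply P. exact Hw.
Qed.

Lemma D1_C_derive phi z l : D1 phi z l -> C_derive phi z = l.
Proof. intros H. apply is_C_derive_unique. now apply D1_is_derive. Qed.

Lemma D1_unique phi z l m : D1 phi z l -> D1 phi z m -> l = m.
Proof. intros H K. now rewrite <- (D1_C_derive _ _ _ H), <- (D1_C_derive _ _ _ K). Qed.

(** * Derivatives in two complex variables *)

Lemma D2_eq h z lx ly lx' ly' : lx = lx' -> ly = ly' -> D2 h z lx ly -> D2 h z lx' ly'.
Proof. now intros -> ->. Qed.

Lemma D2_const c z : D2 (fun _ => c) z 0 0.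
Proof. eapply isD_eqL; [|apply isD_const, dist2_ge_0]. intros w; simpl; ring. Qed.

Lemma D2_plus h k z lx ly mx my : D2 h z lx ly -> D2 k z mx my ->
  D2 (fun w => h w + k w)%C z (lx + mx)%C (ly + my)%C.
Proof.
  intros H K. eapply isD_eqL; [|exact (isD_plus _ dist2_ge_0 _ _ _ _ _ H K)].
  intros w; simpl; ring.
Qed.

Lemma D2_mult h k z lx ly mx my : D2 h z lx ly -> D2 k z mx my ->
  D2 (fun w => h w * k w)%C z (h z * mx + k z * lx)%C (h z * my + k z * ly)%C.
Proof.
  intros H K. eapply isD_eqL; [|exact (isD_mult _ dist2_ge_0 _ _ _ _ _ H K)].
  intros w; simpl; ring.
Qed.

Lemma D2_comp phi h z l lx ly : D1 phi (h z) l -> D2 h z lx ly ->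
  D2 (fun w => phi (h w)) z (l * lx)%C (l * ly)%C.
Proof.
  intros H K. eapply isD_eqL; [|exact (isD_comp _ dist2_ge_0 _ _ _ _ _ H K)].
  intros w; simpl; ring.
Qed.

Lemma D2_ext h k z lx ly r : 0 < r ->
  (forall w, dist2 z w < r -> h w = k w) -> D2 h z lx ly -> D2 k z lx ly.
Proof.
  intros Hr. apply (isD_ext dist2 h k z _ r Hr). now rewrite dist2_diag.
Qed.

(** Restriction to a complex line in any direction: the coordinate directions give the partial
    derivatives, and general ones reduce the Taylor bound in two variables to one variable. *)
Lemma D2_line h (o v : C * C) t lx ly :
  D2 h (fst o + t * fst v, snd o + t * snd v)%C lx ly ->
  D1 (fun t => h (fst o + t * fst v, snd o + t * snd v)%C) t (lx * fst v + ly * snd v)%C.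
Proof.
  intros H.
  eapply isD_eqL; [|refine (isD_precomp dist1 dist2 dist1_ge_0
    (fun t => (fst o + t * fst v, snd o + t * snd v)%C) (Cmod (fst v) + Cmod (snd v) + 1)
    h t _ _ _ H)].
  - intros w. simpl. ring.
  - generalize (Cmod_ge_0 (fst v)) (Cmod_ge_0 (snd v)); lra.
  - intros w. unfold dist1, dist2. simpl.
    replace (fst o + w * fst v - (fst o + t * fst v))%C with ((w - t) * fst v)%C by ring.
    replace (snd o + w * snd v - (snd o + t * snd v))%C with ((w - t) * snd v)%C by ring.
    rewrite !Cmod_mult. generalize (Cmod_ge_0 (w - t)). nra.
Qed.

Lemma D2_D1_x h x y lx ly : D2 h (x, y) lx ly -> D1 (fun t => h (t, y)) x lx.
Proof.
  intros H.
  apply D1_ext with (fun t => h (0 + t * 1, y + t * 0)%C) 1; [lra| |].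
  - intros w _. f_equal. f_equal; ring.
  - assert (E : (x, y) = (0 + x * 1, y + x * 0)%C) by (f_equal; ring).
    rewrite E in H. apply (D2_line h (RtoC 0, y) (RtoC 1, RtoC 0) x) in H.
    revert H. apply D1_eq. simpl. ring.
Qed.

Lemma D2_D1_y h x y lx ly : D2 h (x, y) lx ly -> D1 (fun t => h (x, t)) y ly.
Proof.
  intros H.
  apply D1_ext with (fun t => h (x + t * 0, 0 + t * 1)%C) 1; [lra| |].
  - intros w _. f_equal. f_equal; ring.
  - assert (E : (x, y) = (x + y * 0, 0 + y * 1)%C) by (f_equal; ring).
    rewrite E in H. apply (D2_line h (x, RtoC 0) (RtoC 0, RtoC 1) y) in H.
    revert H. apply D1_eq. simpl. ring.
Qed.

Lemma D2_partial_x h z lx ly : D2 h z lx ly -> partial_x h z = lx.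
Proof. destruct z as [x y]. intros H. apply D1_C_derive. exact (D2_D1_x _ _ _ _ _ H). Qed.

Lemma D2_partial_y h z lx ly : D2 h z lx ly -> partial_y h z = ly.
Proof. destruct z as [x y]. intros H. apply D1_C_derive. exact (D2_D1_y _ _ _ _ _ H). Qed.

Lemma D2_continuous h z lx ly : D2 h z lx ly -> forall eps, 0 < eps -> exists delta,
  0 < delta /\ forall w, dist2 z w < delta -> Cmod (h w - h z) < eps.
Proof. intros H. apply (isD_continuous _ dist2_ge_0 _ _ _ H). Qed.

Lemma D2_precomp h (gamma : C * C -> C * C) K z lx ly mx my : 0 < K ->
  (forall w, dist2 (gamma z) (gamma w) <= K * dist2 z w) ->
  (forall w, lx * (fst (gamma w) - fst (gamma z)) + ly * (snd (gamma w) - snd (gamma z))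
    = mx * (fst w - fst z) + my * (snd w - snd z))%C ->
  D2 h (gamma z) lx ly -> D2 (fun w => h (gamma w)) z mx my.
Proof.
  intros HK Hg E H.
  eapply isD_eqL; [|exact (isD_precomp dist2 dist2 dist2_ge_0 gamma K h z _ HK Hg H)].
  exact E.
Qed.

(** Statements about y are deduced from their counterparts about x through this exchange. *)
Definition swap (z : C * C) : C * C := (snd z, fst z).

Lemma dist2_swap z w : dist2 (swap z) (swap w) = dist2 z w.
Proof. unfold dist2, swap; simpl. ring. Qed.

Lemma D2_swap h z lx ly : D2 h (swap z) lx ly -> D2 (fun w => h (swap w)) z ly lx.
Proof.
  apply D2_precomp with 1; [lra| |].
  - intros w. rewrite dist2_swap. lra.
  - intros w. simpl. ring.
Qed.

Lemma D2_freeze_x h x0 z lx ly : D2 h (x0, snd z) lx ly -> D2 (fun w => h (x0, snd w)) z 0 ly.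
Proof.
  apply (D2_precomp h (fun w => (x0, snd w)) 1); [lra| |].
  - intros w. unfold dist2; simpl. rewrite Cmod_diag.
    generalize (Cmod_ge_0 (fst w - fst z)); lra.
  - intros w. simpl. ring.
Qed.

(** * Comparison with the topology and the differential of Coquelicot on C^2 *)

Lemma norm_prod_le_dist2 (z w : C * C) :
  norm (K := C_AbsRing) (V := prod_NormedModule C_AbsRing C_NormedModule C_NormedModule)
    (minus w z) <= dist2 z w.
Proof.
  change (sqrt (Cmod (fst w - fst z) ^ 2 + Cmod (snd w - snd z) ^ 2) <= dist2 z w).
  unfold dist2. generalize (Cmod_ge_0 (fst w - fst z)) (Cmod_ge_0 (snd w - snd z)).
  generalize (Cmod (fst w - fst z)) (Cmod (snd w - snd z)). intros a b Ha Hb.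
  apply Rsqr_incr_0_var; [|lra]. rewrite Rsqr_sqrt; unfold Rsqr; nra.
Qed.

Lemma dist2_le_norm_prod (z w : C * C) :
  dist2 z w <= 2 * norm (K := C_AbsRing)
    (V := prod_NormedModule C_AbsRing C_NormedModule C_NormedModule) (minus w z).
Proof.
  change (dist2 z w <= 2 * sqrt (Cmod (fst w - fst z) ^ 2 + Cmod (snd w - snd z) ^ 2)).
  unfold dist2. generalize (Cmod_ge_0 (fst w - fst z)) (Cmod_ge_0 (snd w - snd z)).
  generalize (Cmod (fst w - fst z)) (Cmod (snd w - snd z)). intros a b Ha Hb.
  apply Rsqr_incr_0_var.
  - rewrite Rsqr_mult, Rsqr_sqrt by nra. unfold Rsqr.
    generalize (pow2_ge_0 (a - b)) (pow2_ge_0 a) (pow2_ge_0 b). simpl. intros. nra.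
  - apply Rmult_le_pos; [lra|apply sqrt_pos].
Qed.

Lemma locally_C2 (z : C * C) (P : C * C -> Prop) :
  locally z P <-> exists delta, 0 < delta /\ forall w, dist2 z w < delta -> P w.
Proof.
  split.
  - intros [e H]. exists e; split; [apply cond_pos|]. intros w Hw. apply H.
    unfold dist2 in Hw.
    assert (A1 := Cmod_ge_0 (fst w - fst z)). assert (A2 := Cmod_ge_0 (snd w - snd z)).
    split; apply C_NormedModule_mixin_compat1.
    + apply Rle_lt_trans with (2 := Hw). change (Cmod (fst w - fst z) <= Cmod (fst w - fst z) + Cmod (snd w - snd z)). lra.
    + apply Rle_lt_trans with (2 := Hw). change (Cmod (snd w - snd z) <= Cmod (fst w - fst z) + Cmod (snd w - snd z)). lra.
  - intros [d [Hd H]].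
    (* Balls of C are squares in the real and imaginary parts, hence the factor [sqrt 2]; the other
       factor 2 comes from summing over the two coordinates. *)
    assert (Hs : 0 < sqrt 2) by (apply sqrt_lt_R0; lra).
    assert (He : 0 < d / (2 * sqrt 2)) by (apply Rdiv_lt_0_compat; lra).
    exists (mkposreal _ He). intros [w1 w2] [H1 H2]. apply H. unfold dist2.
    apply C_NormedModule_mixin_compat2 in H1. apply C_NormedModule_mixin_compat2 in H2.
    simpl in H1, H2.
    change (Cmod (w1 - fst z) < sqrt 2 * (d / (2 * sqrt 2))) in H1.
    change (Cmod (w2 - snd z) < sqrt 2 * (d / (2 * sqrt 2))) in H2.
    replace (sqrt 2 * (d / (2 * sqrt 2))) with (d / 2) in H1, H2 by (field; lra).
    simpl. lra.
Qed.

Lemma D2_ex_filterdiff h z lx ly : D2 h z lx ly ->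
  ex_filterdiff (K := C_AbsRing) (h : C * C -> C) (locally z).
Proof.
  intros [[M [HM B]] H].
  exists (fun w : C * C => lx * fst w + ly * snd w)%C. split.
  - constructor.
    + intros [x1 y1] [x2 y2]. change (@eq C (lx * (x1 + x2) + ly * (y1 + y2))%C
        ((lx * x1 + ly * y1) + (lx * x2 + ly * y2))%C). ring.
    + intros k [x1 y1]. change (@eq C (lx * (k * x1) + ly * (k * y1))%C
        (k * (lx * x1 + ly * y1))%C). ring.
    + exists (2 * M). split; [lra|].
      assert (B' : forall w : C * C, Cmod (lx * fst w + ly * snd w)
        <= 2 * M * norm (K := C_AbsRing)
             (V := prod_NormedModule C_AbsRing C_NormedModule C_NormedModule) w).
      { intros [w1 w2]. specialize (B (fst z + w1, snd z + w2)%C). simpl in B |- *.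
        replace (fst z + w1 - fst z)%C with w1 in B by ring.
        replace (snd z + w2 - snd z)%C with w2 in B by ring.
        apply Rle_trans with (1 := B).
        assert (Q := dist2_le_norm_prod z (fst z + w1, snd z + w2)%C).
        assert (E : minus (G := prod_AbelianGroup C_AbelianGroup C_AbelianGroup)
          (fst z + w1, snd z + w2)%C z = (w1, w2)).
        { destruct z as [z1 z2].
          change ((z1 + w1 - z1, z2 + w2 - z2)%C = (w1, w2)). f_equal; ring. }
        apply (f_equal (norm (K := C_AbsRing)
          (V := prod_NormedModule C_AbsRing C_NormedModule C_NormedModule))) in E.
        set (n := norm (w1, w2)) in *.
        assert (Q' : dist2 z (fst z + w1, snd z + w2)%C <= 2 * n) by (rewrite <- E; exact Q).
        nra. }
      exact B'.
  - intros x Hx.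
    apply (is_filter_lim_locally_unique
      (V := prod_NormedModule C_AbsRing C_NormedModule C_NormedModule)) in Hx. subst x.
    intros [e He]. apply locally_C2. destruct (H (e / 2)) as [d [Hd P]]; [lra|].
    exists d; split; [exact Hd|]. intros w Hw. specialize (P w Hw). simpl.
    change (Cmod (h w - h z - (lx * (fst w - fst z) + ly * (snd w - snd z)))
      <= e * norm (K := C_AbsRing)
        (V := prod_NormedModule C_AbsRing C_NormedModule C_NormedModule) (minus w z)).
    generalize (dist2_le_norm_prod z w). intros Q.
    apply Rle_trans with (1 := P).
    set (n := norm _) in *. nra.
Qed.

Lemma ex_filterdiff_D2 (h : C * C -> C) (z : C * C) :
  ex_filterdiff (K := C_AbsRing) h (locally z) ->
  exists lx ly, D2 h z lx ly.
Proof.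
  intros [L [[Lp Ls [M [HM Ln]]] H]].
  assert (Hlim : is_filter_lim (locally z) z) by (intros P HP; exact HP).
  specialize (H z Hlim).
  assert (E : forall w : C * C, L (minus w z) =
    (L (RtoC 1, RtoC 0) * (fst w - fst z) + L (RtoC 0, RtoC 1) * (snd w - snd z))%C).
  { intros w.
    assert (E1 : minus w z = plus (scal (fst w - fst z)%C ((RtoC 1, RtoC 0) : C * C))
                                  (scal (snd w - snd z)%C ((RtoC 0, RtoC 1) : C * C))).
    { destruct w as [w1 w2], z as [z1 z2].
      change ((w1 - z1, w2 - z2) = ((w1 - z1) * 1 + (w2 - z2) * 0,
         (w1 - z1) * 0 + (w2 - z2) * 1))%C. f_equal; ring. }
    rewrite E1, Lp, !Ls.
    change (@eq C ((fst w - fst z) * L (RtoC 1, RtoC 0) + (snd w - snd z) * L (RtoC 0, RtoC 1))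
     (L (RtoC 1, RtoC 0) * (fst w - fst z) + L (RtoC 0, RtoC 1) * (snd w - snd z)))%C.
    ring. }
  exists (L (RtoC 1, RtoC 0)), (L (RtoC 0, RtoC 1)). split.
  - exists M; split; [exact HM|]. intros w. rewrite <- E.
    apply Rle_trans with (1 := Ln _). apply Rmult_le_compat_l; [lra|].
    apply norm_prod_le_dist2.
  - intros e He. destruct (proj1 (locally_C2 _ _) (H (mkposreal e He))) as [d [Hd P]].
    exists d; split; [exact Hd|]. intros w Hw. rewrite <- E.
    apply Rle_trans with (1 := P w Hw). apply Rmult_le_compat_l; [lra|].
    apply norm_prod_le_dist2.
Qed.

(** * Integrals of complex functions over [0, 1] *)

Definition contC (phi : C -> C) (z : C) : Prop :=
  forall eps, 0 < eps -> exists delta, 0 < delta /\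
    forall w, Cmod (w - z) < delta -> Cmod (phi w - phi z) < eps.

Definition contR (f : R -> C) (t : R) : Prop :=
  forall eps, 0 < eps -> exists delta, 0 < delta /\
    forall s, Rabs (s - t) < delta -> Cmod (f s - f t) < eps.

(** Continuity is relative to the interval, because an integrand such as [h] along a segment is
    controlled only for parameters in it. *)
Definition cont01 (f : R -> C) : Prop :=
  forall t, 0 <= t <= 1 -> forall eps, 0 < eps -> exists delta, 0 < delta /\
    forall s, 0 <= s <= 1 -> Rabs (s - t) < delta -> Cmod (f s - f t) < eps.

Lemma contR_cont01 f : (forall t, 0 <= t <= 1 -> contR f t) -> cont01 f.
Proof.
  intros H t Ht e He. destruct (H t Ht e He) as [d [Hd P]]. exists d; split; auto.
Qed.

Lemma cont01_const c : cont01 (fun _ => c).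
Proof.
  intros t _ e He. exists 1; split; [lra|]. intros s _ _. now rewrite Cmod_diag.
Qed.

Lemma cont01_RtoC : cont01 RtoC.
Proof.
  intros t _ e He. exists e; split; [lra|]. intros s _ Hs.
  now rewrite <- RtoC_minus, Cmod_R.
Qed.

Lemma cont01_plus f g : cont01 f -> cont01 g -> cont01 (fun t => f t + g t)%C.
Proof.
  intros Hf Hg t Ht e He.
  destruct (Hf t Ht (e / 2)) as [d1 [Hd1 P1]]; [lra|].
  destruct (Hg t Ht (e / 2)) as [d2 [Hd2 P2]]; [lra|].
  exists (Rmin d1 d2); split; [now apply Rmin_glb_lt|]. intros s Hs Hst.
  replace (f s + g s - (f t + g t))%C with ((f s - f t) + (g s - g t))%C by ring.
  apply Rle_lt_trans with (1 := Cmod_triangle _ _).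
  assert (A1 := P1 s Hs (Rlt_le_trans _ _ _ Hst (Rmin_l _ _))).
  assert (A2 := P2 s Hs (Rlt_le_trans _ _ _ Hst (Rmin_r _ _))). lra.
Qed.

Lemma cont01_mult f g : cont01 f -> cont01 g -> cont01 (fun t => f t * g t)%C.
Proof.
  intros Hf Hg t Ht e He.
  set (a := Cmod (f t)). set (b := Cmod (g t)).
  assert (Ha : 0 <= a) by apply Cmod_ge_0. assert (Hb : 0 <= b) by apply Cmod_ge_0.
  assert (He1 : 0 < e / (2 * (b + 1))) by (apply Rdiv_lt_0_compat; lra).
  assert (He2 : 0 < e / (2 * (a + 1))) by (apply Rdiv_lt_0_compat; lra).
  destruct (Hf t Ht 1) as [d0 [Hd0 P0]]; [lra|].
  destruct (Hf t Ht _ He1) as [d1 [Hd1 P1]]. destruct (Hg t Ht _ He2) as [d2 [Hd2 P2]].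
  exists (Rmin d0 (Rmin d1 d2)); split; [repeat apply Rmin_glb_lt; lra|].
  intros s Hs Hst.
  assert (W : Rabs (s - t) < d0 /\ Rabs (s - t) < d1 /\ Rabs (s - t) < d2).
  { generalize (Rmin_l d0 (Rmin d1 d2)) (Rmin_r d0 (Rmin d1 d2)) (Rmin_l d1 d2) (Rmin_r d1 d2).
    lra. }
  destruct W as [W0 [W1 W2]].
  specialize (P0 s Hs W0). specialize (P1 s Hs W1). specialize (P2 s Hs W2).
  replace (f s * g s - f t * g t)%C
    with (((f s - f t) + f t) * (g s - g t) + (f s - f t) * g t)%C by ring.
  apply Rle_lt_trans with (1 := Cmod_triangle _ _). rewrite !Cmod_mult. fold b.
  assert (A1 : Cmod (f s - f t + f t) <= a + 1).
  { apply Rle_trans with (1 := Cmod_triangle _ _). fold a. lra. }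
  assert (A2 : Cmod (f s - f t + f t) * Cmod (g s - g t) <= e / 2).
  { apply Rle_trans with ((a + 1) * (e / (2 * (a + 1)))).
    - apply Rmult_le_compat; try apply Cmod_ge_0; lra.
    - right; field; lra. }
  assert (A3 : Cmod (f s - f t) * b < e / 2).
  { apply Rle_lt_trans with (e / (2 * (b + 1)) * b).
    - apply Rmult_le_compat_r; lra.
    - apply Rlt_le_trans with (e / (2 * (b + 1)) * (b + 1)).
      + apply Rmult_lt_compat_l; lra.
      + right; field; lra. }
  lra.
Qed.

Lemma cont01_minus f g : cont01 f -> cont01 g -> cont01 (fun t => f t - g t)%C.
Proof.
  intros Hf Hg t Ht e He.
  destruct (cont01_plus f (fun t => - (1) * g t)%C Hf (cont01_mult _ _ (cont01_const _) Hg) t Ht e He)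
    as [d [Hd P]].
  exists d; split; [exact Hd|]. intros s Hs Hst. specialize (P s Hs Hst).
  now replace (f s - g s - (f t - g t))%C
    with (f s + - (1) * g s - (f t + - (1) * g t))%C by ring.
Qed.

Lemma cont01_comp phi f : (forall t, 0 <= t <= 1 -> contC phi (f t)) -> cont01 f ->
  cont01 (fun t => phi (f t)).
Proof.
  intros Hp Hf t Ht e He. destruct (Hp t Ht e He) as [d1 [Hd1 P1]].
  destruct (Hf t Ht d1 Hd1) as [d [Hd P]]. exists d; split; auto.
Qed.

Lemma cont01_comp2 h f g :
  (forall t, 0 <= t <= 1 -> exists lx ly, D2 h (f t, g t) lx ly) -> cont01 f -> cont01 g ->
  cont01 (fun t => h (f t, g t)).
Proof.
  intros Hp Hf Hg t Ht e He. destruct (Hp t Ht) as [lx [ly HD]].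
  destruct (D2_continuous _ _ _ _ HD e He) as [d1 [Hd1 P1]].
  destruct (Hf t Ht (d1 / 2)) as [d2 [Hd2 P2]]; [lra|].
  destruct (Hg t Ht (d1 / 2)) as [d3 [Hd3 P3]]; [lra|].
  exists (Rmin d2 d3); split; [now apply Rmin_glb_lt|]. intros s Hs Hst.
  apply P1. unfold dist2; simpl.
  assert (A1 := P2 s Hs (Rlt_le_trans _ _ _ Hst (Rmin_l _ _))).
  assert (A2 := P3 s Hs (Rlt_le_trans _ _ _ Hst (Rmin_r _ _))). lra.
Qed.

(** Taking components reduces everything to real integrals. Since [RInt] is total, the algebraic
    lemmas below carry continuity hypotheses. *)
Definition J (f : R -> C) : C :=
  (RInt (fun t => Re (f t)) 0 1, RInt (fun t => Im (f t)) 0 1).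

Lemma Re_le_Cmod_minus (x y : C) : Rabs (Re x - Re y) <= Cmod (x - y).
Proof. apply (re_le_Cmod (x - y)%C). Qed.

Lemma Im_le_Cmod_minus (x y : C) : Rabs (Im x - Im y) <= Cmod (x - y).
Proof.
  apply Rle_trans with (2 := Rmax_Cmod (x - y)%C). apply Rmax_r.
Qed.

Lemma Im_le_Cmod (x : C) : Rabs (Im x) <= Cmod x.
Proof. apply Rle_trans with (2 := Rmax_Cmod x). apply Rmax_r. Qed.

(** Extending [g] by its end values, through the 1-Lipschitz map [clamp], yields a function
    continuous in the two-sided sense that the integrability theorem asks for. *)
Lemma ex_RInt_cont01 (g : R -> R) :
  (forall t, 0 <= t <= 1 -> forall eps, 0 < eps -> exists delta, 0 < delta /\
    forall s, 0 <= s <= 1 -> Rabs (s - t) < delta -> Rabs (g s - g t) < eps) ->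
  ex_RInt g 0 1.
Proof.
  intros H. pose (clamp t := Rmax 0 (Rmin 1 t)).
  assert (Hc : forall t, 0 <= clamp t <= 1).
  { intros t. unfold clamp. split; [apply Rmax_l|].
    apply Rmax_lub; [lra|apply Rmin_l]. }
  assert (Hl : forall s t, Rabs (clamp s - clamp t) <= Rabs (s - t)).
  { intros s t. unfold clamp, Rmax, Rmin, Rabs.
    repeat (destruct (Rle_dec _ _) || destruct (Rcase_abs _)); lra. }
  assert (Hid : forall t, 0 <= t <= 1 -> clamp t = t).
  { intros t Ht. unfold clamp. rewrite Rmin_right, Rmax_right; lra. }
  apply (ex_RInt_ext (fun t => g (clamp t))).
  - rewrite Rmin_left, Rmax_right by lra. intros x Hx. rewrite Hid; [reflexivity|lra].
  - apply (ex_RInt_continuous (V := R_CompleteNormedModule)).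
    intros t _. apply filterlim_locally. intros [e He].
    destruct (H (clamp t) (Hc t) e He) as [d [Hd P]].
    exists (mkposreal d Hd). intros s Hs. apply P; [apply Hc|].
    apply Rle_lt_trans with (1 := Hl s t). exact Hs.
Qed.

Lemma cont01_ex_Re f : cont01 f -> ex_RInt (fun t => Re (f t)) 0 1.
Proof.
  intros H. apply ex_RInt_cont01. intros t Ht e He. destruct (H t Ht e He) as [d [Hd P]].
  exists d; split; [exact Hd|]. intros s Hs Hst.
  apply Rle_lt_trans with (1 := Re_le_Cmod_minus _ _). auto.
Qed.

Lemma cont01_ex_Im f : cont01 f -> ex_RInt (fun t => Im (f t)) 0 1.
Proof.
  intros H. apply ex_RInt_cont01. intros t Ht e He. destruct (H t Ht e He) as [d [Hd P]].
  exists d; split; [exact Hd|]. intros s Hs Hst.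
  apply Rle_lt_trans with (1 := Im_le_Cmod_minus _ _). auto.
Qed.

Lemma J_ext f g : (forall t, 0 <= t <= 1 -> f t = g t) -> J f = J g.
Proof.
  intros H. unfold J. f_equal; apply RInt_ext; rewrite Rmin_left, Rmax_right by lra;
    intros x Hx; rewrite H; lra.
Qed.

Lemma J_plus f g : cont01 f -> cont01 g -> J (fun t => f t + g t)%C = (J f + J g)%C.
Proof.
  intros Hf Hg. unfold J. apply injective_projections; simpl.
  - apply (RInt_plus (V := R_CompleteNormedModule) (fun t => Re (f t)) (fun t => Re (g t)));
      now apply cont01_ex_Re.
  - apply (RInt_plus (V := R_CompleteNormedModule) (fun t => Im (f t)) (fun t => Im (g t)));
      now apply cont01_ex_Im.
Qed.

Lemma J_scal c f : cont01 f -> J (fun t => c * f t)%C = (c * J f)%C.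
Proof.
  intros Hf. destruct c as [a b].
  assert (Er := cont01_ex_Re _ Hf). assert (Ei := cont01_ex_Im _ Hf).
  assert (L : forall u v, RInt (fun t => u * Re (f t) + v * Im (f t)) 0 1
    = u * RInt (fun t => Re (f t)) 0 1 + v * RInt (fun t => Im (f t)) 0 1).
  { intros u v.
    rewrite <- (RInt_scal (V := R_CompleteNormedModule) (fun t => Re (f t)) 0 1 u Er : _ = u * _).
    rewrite <- (RInt_scal (V := R_CompleteNormedModule) (fun t => Im (f t)) 0 1 v Ei : _ = v * _).
    apply (RInt_plus (V := R_CompleteNormedModule) (fun t => u * Re (f t)) (fun t => v * Im (f t))).
    - now apply (ex_RInt_scal (V := R_CompleteNormedModule) (fun t => Re (f t))).
    - now apply (ex_RInt_scal (V := R_CompleteNormedModule) (fun t => Im (f t))). }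
  unfold J. apply injective_projections; simpl.
  - transitivity (RInt (fun t => a * Re (f t) + - b * Im (f t)) 0 1).
    + apply RInt_ext. intros x _. simpl. unfold Re, Im. ring.
    + rewrite L. ring.
  - transitivity (RInt (fun t => b * Re (f t) + a * Im (f t)) 0 1).
    + apply RInt_ext. intros x _. simpl. unfold Re, Im. ring.
    + rewrite L. ring.
Qed.

Lemma J_minus f g : cont01 f -> cont01 g -> J (fun t => f t - g t)%C = (J f - J g)%C.
Proof.
  intros Hf Hg.
  rewrite (J_ext _ (fun t => f t + - (1) * g t)%C) by (intros; ring).
  rewrite J_plus, J_scal; auto using cont01_mult, cont01_const. ring.
Qed.

Lemma J_const c : J (fun _ => c) = c.
Proof.
  unfold J. apply injective_projections; simpl; rewrite RInt_const;
    unfold scal; simpl; unfold mult; simpl; unfold Re, Im; ring.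
Qed.

(** The factor 2 comes from bounding the real and imaginary parts separately; a sharper constant
    would bring nothing to the estimates below. *)
Lemma J_bound f K : cont01 f -> (forall t, 0 <= t <= 1 -> Cmod (f t) <= K) ->
  Cmod (J f) <= 2 * K.
Proof.
  intros Hf HK.
  assert (A : Rabs (Re (J f)) <= (1 - 0) * K).
  { apply (abs_RInt_le_const (fun t => Re (f t)) 0 1 K); [lra|now apply cont01_ex_Re|].
    intros t Ht. apply Rle_trans with (1 := re_le_Cmod _). auto. }
  assert (B : Rabs (Im (J f)) <= (1 - 0) * K).
  { apply (abs_RInt_le_const (fun t => Im (f t)) 0 1 K); [lra|now apply cont01_ex_Im|].
    intros t Ht. apply Rle_trans with (1 := Im_le_Cmod _). auto. }
  replace (J f) with (RtoC (Re (J f)) + Ci * RtoC (Im (J f)))%C.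
  - apply Rle_trans with (1 := Cmod_triangle _ _).
    rewrite Cmod_mult, Cmod_Ci, !Cmod_R. lra.
  - apply injective_projections; simpl; ring.
Qed.

Lemma RInt_split (g : R -> R) s : 0 <= s <= 1 -> ex_RInt g 0 1 ->
  RInt g 0 1 = s * RInt (fun t => g (s * t)) 0 1
    + (1 - s) * RInt (fun t => g (s + (1 - s) * t)) 0 1.
Proof.
  intros Hs Hg.
  assert (H0 : ex_RInt g 0 s) by (apply (ex_RInt_Chasles_1 (V := R_CompleteNormedModule) g 0 s 1); auto).
  assert (H1 : ex_RInt g s 1) by (apply (ex_RInt_Chasles_2 (V := R_CompleteNormedModule) g 0 s 1); auto).
  rewrite <- (RInt_Chasles (V := R_CompleteNormedModule) g 0 s 1 H0 H1).
  assert (C : forall u v, ex_RInt g v (u + v) ->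
    RInt g v (u + v) = u * RInt (fun t => g (v + u * t)) 0 1).
  { intros u v Hx.
    assert (X : ex_RInt g (u * 0 + v) (u * 1 + v)).
    { now replace (u * 0 + v) with v by ring; replace (u * 1 + v) with (u + v) by ring. }
    assert (E := RInt_comp_lin (V := R_CompleteNormedModule) g u v 0 1 X).
    replace (u * 0 + v) with v in E by ring. replace (u * 1 + v) with (u + v) in E by ring.
    rewrite <- E.
    (* For [u = 0] integrability of the rescaled function cannot be recovered by dividing by [u],
       but both sides vanish. *)
    destruct (Req_dec u 0) as [->|Hu].
    - rewrite Rmult_0_l. rewrite (RInt_ext _ (fun _ => 0)).
      + rewrite RInt_const. apply Rmult_0_r.
      + intros x _. apply Rmult_0_l.
    - rewrite (RInt_scal (V := R_CompleteNormedModule) (fun t => g (u * t + v)) 0 1 u).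
      + apply (f_equal (Rmult u)). apply RInt_ext. intros x _. f_equal. ring.
      + apply (ex_RInt_ext (fun t => scal (/ u) (scal u (g (u * t + v))))).
        * intros x _. unfold scal; simpl; unfold mult; simpl. field. exact Hu.
        * apply (ex_RInt_scal (V := R_CompleteNormedModule)).
          now apply (ex_RInt_comp_lin (V := R_CompleteNormedModule)). }
  apply f_equal2.
  - assert (E := C s 0). rewrite Rplus_0_r in E. rewrite (E H0).
    apply f_equal. apply RInt_ext. intros x _. f_equal. ring.
  - assert (E := C (1 - s) s). replace (1 - s + s) with 1 in E by ring. exact (E H1).
Qed.

Lemma J_split f s : 0 <= s <= 1 -> cont01 f ->
  J f = (RtoC s * J (fun t => f (s * t)%R) + RtoC (1 - s) * J (fun t => f (s + (1 - s) * t)%R))%C.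
Proof.
  intros Hs Hf. unfold J. apply injective_projections; simpl.
  - rewrite (RInt_split _ s Hs (cont01_ex_Re _ Hf)). ring.
  - rewrite (RInt_split _ s Hs (cont01_ex_Im _ Hf)). ring.
Qed.

(** * Derivatives of paths and the fundamental theorem of calculus *)

Definition distR (t s : R) : R := Rabs (s - t).

Definition DR (f : R -> C) (t : R) (v : C) : Prop :=
  isD distR f t (fun s => v * RtoC (s - t))%C.

Lemma distR_ge_0 t s : 0 <= distR t s.
Proof. apply Rabs_pos. Qed.

Lemma DR_comp phi f t l v : D1 phi (f t) l -> DR f t v -> DR (fun s => phi (f s)) t (l * v)%C.
Proof.
  intros H K. eapply isD_eqL; [|exact (isD_comp _ distR_ge_0 _ _ _ _ _ H K)].
  intros w; simpl; ring.
Qed.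

Lemma DR_continuous f t v : DR f t v -> contR f t.
Proof. exact (isD_continuous _ distR_ge_0 _ _ _). Qed.

Lemma DR_affine a b t : DR (fun s => a + RtoC s * b)%C t b.
Proof.
  split.
  - exists (Cmod b + 1); split; [generalize (Cmod_ge_0 b); lra|]. intros s.
    rewrite Cmod_mult, Cmod_R. unfold distR. generalize (Rabs_pos (s - t)). nra.
  - intros e He. exists 1; split; [lra|]. intros s _.
    replace (a + s * b - (a + t * b) - b * RtoC (s - t))%C with (RtoC 0).
    + rewrite Cmod_0. apply Rmult_le_pos; [lra|apply distR_ge_0].
    + rewrite RtoC_minus. ring.
Qed.

Lemma DR_Re f t v : DR f t v -> is_derive (fun s => Re (f s)) t (Re v).
Proof.
  intros [_ H]. split; [apply (is_linear_scal_l (K := R_AbsRing) (V := R_NormedModule))|].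
  intros x Hx. apply (is_filter_lim_locally_unique (V := R_NormedModule)) in Hx. subst x.
  intros [e He]. destruct (H e He) as [d [Hd P]]. exists (mkposreal d Hd).
  intros s Hs. specialize (P s Hs). simpl.
  apply Rle_trans with (2 := P). apply Rle_trans with (2 := re_le_Cmod _). right.
  change (Rabs (Re (f s) - Re (f t) - (s - t) * Re v)
    = Rabs (Re (f s - f t - v * RtoC (s - t)))).
  f_equal. unfold Re; simpl. ring.
Qed.

Lemma DR_Im f t v : DR f t v -> is_derive (fun s => Im (f s)) t (Im v).
Proof.
  intros [_ H]. split; [apply (is_linear_scal_l (K := R_AbsRing) (V := R_NormedModule))|].
  intros x Hx. apply (is_filter_lim_locally_unique (V := R_NormedModule)) in Hx. subst x.
  intros [e He]. destruct (H e He) as [d [Hd P]]. exists (mkposreal d Hd).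
  intros s Hs. specialize (P s Hs). simpl.
  apply Rle_trans with (2 := P). apply Rle_trans with (2 := Im_le_Cmod _). right.
  change (Rabs (Im (f s) - Im (f t) - (s - t) * Im v)
    = Rabs (Im (f s - f t - v * RtoC (s - t)))).
  f_equal. unfold Im; simpl. ring.
Qed.

Lemma J_derive f g :
  (forall t, 0 <= t <= 1 -> DR f t (g t)) -> (forall t, 0 <= t <= 1 -> contR g t) ->
  J g = (f 1 - f 0)%C.
Proof.
  intros HD Hc. unfold J. apply injective_projections; simpl.
  - apply is_RInt_unique.
    apply (is_RInt_derive (V := R_CompleteNormedModule) (fun t => Re (f t)));
      rewrite Rmin_left, Rmax_right by lra.
    + intros t Ht. apply DR_Re. auto.
    + intros t Ht. apply filterlim_locally. intros [e He].
      destruct (Hc t Ht e He) as [d [Hd P]]. exists (mkposreal d Hd). intros s Hs.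
      apply Rle_lt_trans with (1 := Re_le_Cmod_minus _ _). apply P. exact Hs.
  - apply is_RInt_unique.
    apply (is_RInt_derive (V := R_CompleteNormedModule) (fun t => Im (f t)));
      rewrite Rmin_left, Rmax_right by lra.
    + intros t Ht. apply DR_Im. auto.
    + intros t Ht. apply filterlim_locally. intros [e He].
      destruct (Hc t Ht e He) as [d [Hd P]]. exists (mkposreal d Hd). intros s Hs.
      apply Rle_lt_trans with (1 := Im_le_Cmod_minus _ _). apply P. exact Hs.
Qed.

(** The substitution of slope -1 exchanges the ends of the interval, and the two resulting signs
    cancel. *)
Lemma J_rev f : cont01 f -> J (fun t => f (1 - t)%R) = J f.
Proof.
  assert (E : forall g : R -> R, ex_RInt g 0 1 -> RInt (fun t => g (1 - t)) 0 1 = RInt g 0 1).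
  { intros g Hg.
    assert (X : ex_RInt g (-1 * 0 + 1) (-1 * 1 + 1)).
    { apply ex_RInt_swap. replace (-1 * 0 + 1) with 1 by ring.
      now replace (-1 * 1 + 1) with 0 by ring. }
    assert (Y := RInt_comp_lin (V := R_CompleteNormedModule) g (-1) 1 0 1 X).
    replace (-1 * 0 + 1) with 1 in Y by ring. replace (-1 * 1 + 1) with 0 in Y by ring.
    rewrite <- (opp_RInt_swap g 0 1 Hg) in Y.
    assert (Z : ex_RInt (fun t => g (1 - t)) 0 1).
    { apply (ex_RInt_ext (fun t => scal (-1) (scal (-1) (g (-1 * t + 1))))).
      - intros t _. unfold scal; simpl; unfold mult; simpl.
        replace (1 - t) with (-1 * t + 1) by ring. ring.
      - apply (ex_RInt_scal (V := R_CompleteNormedModule)).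
        now apply (ex_RInt_comp_lin (V := R_CompleteNormedModule)). }
    assert (Y1 : RInt (fun t => -1 * g (1 - t)) 0 1 = - RInt g 0 1).
    { transitivity (RInt (fun t => scal (-1) (g (-1 * t + 1))) 0 1); [|exact Y].
      apply RInt_ext. intros t _. unfold scal; simpl; unfold mult; simpl.
      do 2 f_equal. ring. }
    assert (Y2 := RInt_scal (V := R_CompleteNormedModule) (fun t => g (1 - t)) 0 1 (-1) Z
      : RInt (fun t => -1 * g (1 - t)) 0 1 = -1 * RInt (fun t => g (1 - t)) 0 1).
    lra. }
  intros Hf. unfold J. apply injective_projections; simpl.
  - apply (E (fun t => Re (f t))). now apply cont01_ex_Re.
  - apply (E (fun t => Im (f t))). now apply cont01_ex_Im.
Qed.

(** * Goursat's theorem and primitives *)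

(** The contour integral of [h] along the oriented straight segment from [a] to [b]. *)
Definition seg (h : C -> C) (a b : C) : C :=
  ((b - a) * J (fun t => h (a + RtoC t * (b - a))))%C.

Definition triangle (h : C -> C) (a b c : C) : C := (seg h a b + seg h b c + seg h c a)%C.

Definition convexC (U : C -> Prop) : Prop :=
  forall a b t, U a -> U b -> 0 <= t <= 1 -> U (a + RtoC t * (b - a))%C.

(** Needed in Goursat's theorem to keep the limit point of the nested triangles in the set where [h]
    is differentiable. *)
Definition closedC (U : C -> Prop) : Prop :=
  forall z, (forall eps, 0 < eps -> exists w, U w /\ Cmod (w - z) < eps) -> U z.

Lemma cont01_line a b : cont01 (fun t => a + RtoC t * b)%C.
Proof. auto using cont01_plus, cont01_mult, cont01_const, cont01_RtoC. Qed.

Lemma seg_cont01 (U : C -> Prop) h a b : convexC U -> (forall z, U z -> contC h z) ->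
  U a -> U b -> cont01 (fun t => h (a + RtoC t * (b - a))%C).
Proof.
  intros HU Hh Ha Hb. apply (cont01_comp h); [|apply cont01_line].
  intros t Ht. apply Hh. now apply HU.
Qed.

Lemma seg_rev (U : C -> Prop) h a b : convexC U -> (forall z, U z -> contC h z) ->
  U a -> U b -> seg h b a = (- seg h a b)%C.
Proof.
  intros HU Hh Ha Hb. unfold seg.
  rewrite <- (J_rev (fun t => h (a + RtoC t * (b - a))%C)) by eauto using seg_cont01.
  rewrite (J_ext _ (fun t => h (a + RtoC (1 - t) * (b - a))%C)).
  - ring.
  - intros t _. f_equal. rewrite RtoC_minus. ring.
Qed.

Lemma seg_split (U : C -> Prop) h a b s : convexC U -> (forall z, U z -> contC h z) ->
  U a -> U b -> 0 <= s <= 1 ->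
  seg h a b = (seg h a (a + RtoC s * (b - a)) + seg h (a + RtoC s * (b - a)) b)%C.
Proof.
  intros HU Hh Ha Hb Hs. unfold seg.
  rewrite (J_split _ s Hs) by eauto using seg_cont01.
  rewrite (J_ext (fun t => h (a + RtoC (s * t) * (b - a))%C)
    (fun t => h (a + RtoC t * (a + RtoC s * (b - a) - a))%C)).
  - rewrite (J_ext (fun t => h (a + RtoC (s + (1 - s) * t) * (b - a))%C)
      (fun t => h (a + RtoC s * (b - a) + RtoC t * (b - (a + RtoC s * (b - a))))%C)).
    + rewrite RtoC_minus. ring.
    + intros t _. f_equal. rewrite RtoC_plus, RtoC_mult, RtoC_minus. ring.
  - intros t _. f_equal. rewrite RtoC_mult. ring.
Qed.

Lemma seg_bound h a b K : cont01 (fun t => h (a + RtoC t * (b - a))%C) ->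
  (forall t, 0 <= t <= 1 -> Cmod (h (a + RtoC t * (b - a))%C) <= K) ->
  Cmod (seg h a b) <= 2 * K * Cmod (b - a).
Proof.
  intros Hc HK. unfold seg. rewrite Cmod_mult, Rmult_comm.
  apply Rmult_le_compat_r; [apply Cmod_ge_0|]. now apply J_bound.
Qed.

Lemma D1_contC h z l : D1 h z l -> contC h z.
Proof. exact (D1_continuous h z l). Qed.

(** Meant for the affine approximations in Goursat's theorem, whose primitives are entire. *)
Lemma seg_derive P p a b : (forall z, D1 P z (p z)) -> (forall z, contC p z) ->
  seg p a b = (P b - P a)%C.
Proof.
  intros HP Hp.
  assert (HL : forall t, DR (fun s => a + RtoC s * (b - a))%C t (b - a)%C)
    by (intros; apply DR_affine).
  unfold seg. rewrite <- J_scal.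
  - rewrite (J_derive (fun t => P (a + RtoC t * (b - a))%C)).
    + f_equal; f_equal; try apply f_equal; ring.
    + intros t _. rewrite Cmult_comm. apply (DR_comp P); auto.
    + intros t _ e He.
      assert (Hm := Cmod_ge_0 (b - a)).
      destruct (Hp (a + RtoC t * (b - a))%C (e / (Cmod (b - a) + 1))) as [d1 [Hd1 P1]].
      { apply Rdiv_lt_0_compat; lra. }
      destruct (DR_continuous _ _ _ (HL t) d1 Hd1) as [d [Hd P2]].
      exists d; split; [exact Hd|]. intros s Hs. specialize (P1 _ (P2 s Hs)).
      set (x := p (a + RtoC s * (b - a))%C) in *. set (y := p (a + RtoC t * (b - a))%C) in *.
      change (Cmod ((b - a) * x - (b - a) * y) < e).
      replace ((b - a) * x - (b - a) * y)%C with ((b - a) * (x - y))%C by ring.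
      rewrite Cmod_mult.
      apply Rle_lt_trans with (Cmod (b - a) * (e / (Cmod (b - a) + 1))).
      * apply Rmult_le_compat_l; lra.
      * apply Rlt_le_trans with ((Cmod (b - a) + 1) * (e / (Cmod (b - a) + 1))).
        -- apply Rmult_lt_compat_r; [apply Rdiv_lt_0_compat; lra|lra].
        -- right; field; lra.
  - apply (cont01_comp p); [|apply cont01_line]. auto.
Qed.

Lemma seg_minus h k a b : cont01 (fun t => h (a + RtoC t * (b - a))%C) ->
  cont01 (fun t => k (a + RtoC t * (b - a))%C) ->
  seg (fun z => h z - k z)%C a b = (seg h a b - seg k a b)%C.
Proof. intros Hh Hk. unfold seg. rewrite J_minus; auto. ring. Qed.

(** The intervals from [lo n] to [hi n] are nested, since their half-width is the sum of all
    remaining increments; the supremum of the left ends lies in each of them, which gives the rate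
    as well as the limit. *)
Lemma Rseq_geometric_limit (u : nat -> R) K :
  (forall n, Rabs (u (S n) - u n) <= K * (/ 2) ^ n) ->
  exists l, forall n, Rabs (u n - l) <= 2 * K * (/ 2) ^ n.
Proof.
  intros H. pose (lo n := u n - 2 * K * (/ 2) ^ n). pose (hi n := u n + 2 * K * (/ 2) ^ n).
  assert (HK : forall n, 0 <= K * (/ 2) ^ n).
  { intros n. apply Rle_trans with (2 := H n). apply Rabs_pos. }
  assert (Hstep : forall n, lo n <= lo (S n) /\ hi (S n) <= hi n).
  { intros n. unfold lo, hi. specialize (H n). apply Rabs_le_between in H. simpl. lra. }
  assert (Hlo : forall n k, lo n <= lo (n + k)%nat).
  { intros n k. induction k as [|k IH].
    - rewrite Nat.add_0_r. lra.
    - rewrite Nat.add_succ_r. destruct (Hstep (n + k)%nat). lra. }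
  assert (Hhi : forall n k, hi (n + k)%nat <= hi n).
  { intros n k. induction k as [|k IH].
    - rewrite Nat.add_0_r. lra.
    - rewrite Nat.add_succ_r. destruct (Hstep (n + k)%nat). lra. }
  assert (Hlh : forall m n, lo m <= hi n).
  { intros m n. apply Rle_trans with (1 := Hlo m n).
    rewrite Nat.add_comm. apply Rle_trans with (2 := Hhi n m).
    unfold lo, hi. specialize (HK (n + m)%nat). lra. }
  destruct (completeness (fun x => exists n, x = lo n)) as [l [Hub Hlub]].
  - exists (hi 0%nat). intros x [n ->]. apply Hlh.
  - exists (lo 0%nat). now exists 0%nat.
  - exists l. intros n. apply Rabs_le_between.
    assert (A1 : lo n <= l) by (apply Hub; now exists n).
    assert (A2 : l <= hi n) by (apply Hlub; intros x [m ->]; apply Hlh).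
    unfold lo, hi in A1, A2. lra.
Qed.

Lemma Cseq_geometric_limit (u : nat -> C) K :
  (forall n, Cmod (u (S n) - u n) <= K * (/ 2) ^ n) ->
  exists l, forall n, Cmod (u n - l) <= 4 * K * (/ 2) ^ n.
Proof.
  intros H.
  destruct (Rseq_geometric_limit (fun n => Re (u n)) K) as [a Ha].
  { intros n. apply Rle_trans with (1 := Re_le_Cmod_minus _ _). apply H. }
  destruct (Rseq_geometric_limit (fun n => Im (u n)) K) as [b Hb].
  { intros n. apply Rle_trans with (1 := Im_le_Cmod_minus _ _). apply H. }
  exists (a, b). intros n. specialize (Ha n). specialize (Hb n).
  replace (u n - (a, b))%C with (RtoC (Re (u n) - a) + Ci * RtoC (Im (u n) - b))%C.
  - apply Rle_trans with (1 := Cmod_triangle _ _).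
    rewrite Cmod_mult, Cmod_Ci, !Cmod_R. lra.
  - apply injective_projections; simpl; unfold Re, Im; ring.
Qed.

Definition midpoint (a b : C) : C := (a + RtoC (/ 2) * (b - a))%C.

Definition perimeter (a b c : C) : R := Cmod (b - a) + Cmod (c - b) + Cmod (a - c).

(** Each inner side is traversed once in each direction and cancels. *)
Lemma triangle_subdivide (U : C -> Prop) h a b c : convexC U -> (forall z, U z -> contC h z) ->
  U a -> U b -> U c ->
  triangle h a b c =
  (triangle h a (midpoint a b) (midpoint c a) + triangle h (midpoint a b) b (midpoint b c)
   + triangle h (midpoint c a) (midpoint b c) c
   + triangle h (midpoint b c) (midpoint c a) (midpoint a b))%C.
Proof.
  intros HU Hh Ha Hb Hc. unfold triangle.
  assert (Hs : 0 <= / 2 <= 1) by lra.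
  assert (M1 : U (midpoint a b)) by now apply HU.
  assert (M2 : U (midpoint b c)) by now apply HU.
  assert (M3 : U (midpoint c a)) by now apply HU.
  rewrite (seg_split U h a b (/ 2)), (seg_split U h b c (/ 2)), (seg_split U h c a (/ 2)) by auto.
  fold (midpoint a b) (midpoint b c) (midpoint c a).
  rewrite (seg_rev U h (midpoint a b) (midpoint c a)) by auto.
  rewrite (seg_rev U h (midpoint a b) (midpoint b c)) by auto.
  rewrite (seg_rev U h (midpoint b c) (midpoint c a)) by auto. ring.
Qed.

Lemma Cmod_half (x : C) : Cmod (RtoC (/ 2) * x) = Cmod x / 2.
Proof. rewrite Cmod_mult, Cmod_RtoC by lra. field. Qed.

Lemma RtoC_half_double (x : C) : (RtoC (/ 2) * x + RtoC (/ 2) * x)%C = x.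
Proof.
  rewrite <- Cmult_plus_distr_r, <- RtoC_plus. replace (/ 2 + / 2) with 1 by field. ring.
Qed.

(** The square of the perimeter is the right scale: bisection divides it by 4, just as it splits the
    integral into four. *)
Definition bad_triangle (U : C -> Prop) h eps (T : C * C * C) : Prop :=
  let '(a, b, c) := T in
  U a /\ U b /\ U c /\ eps * (perimeter a b c * perimeter a b c) < Cmod (triangle h a b c).

(** One of the four half-size triangles must inherit the excess. The bound on the displacement of
    the first vertex makes the sequence of these vertices converge geometrically. *)
Lemma bad_triangle_step (U : C -> Prop) h eps a b c : convexC U ->
  (forall z, U z -> contC h z) -> bad_triangle U h eps (a, b, c) ->
  exists a' b' c', bad_triangle U h eps (a', b', c') /\
    perimeter a' b' c' = perimeter a b c / 2 /\ Cmod (a' - a) <= perimeter a b c.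
Proof.
  intros HU Hh [Ha [Hb [Hc HB]]].
  assert (Hs : 0 <= / 2 <= 1) by lra.
  assert (M1 : U (midpoint a b)) by now apply HU.
  assert (M2 : U (midpoint b c)) by now apply HU.
  assert (M3 : U (midpoint c a)) by now apply HU.
  set (s := perimeter a b c) in *.
  assert (E1 : forall x y, (midpoint x y - x = RtoC (/ 2) * (y - x))%C)
    by (intros; unfold midpoint; ring).
  assert (E2 : forall x y, (y - midpoint x y = RtoC (/ 2) * (y - x))%C).
  { intros x y. unfold midpoint.
    transitivity ((RtoC (/ 2) * (y - x) + RtoC (/ 2) * (y - x)) - RtoC (/ 2) * (y - x))%C; [|ring].
    rewrite RtoC_half_double. ring. }
  assert (E3 : forall x y z, (midpoint y z - midpoint x y = RtoC (/ 2) * (z - x))%C).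
  { intros x y z. replace (midpoint y z - midpoint x y)%C
      with ((midpoint y z - y) + (y - midpoint x y))%C by ring.
    rewrite E1, E2. ring. }
  assert (Ms : forall x y, midpoint x y = midpoint y x).
  { intros x y. replace (midpoint x y) with ((midpoint x y - x) + x)%C by ring.
    rewrite E1. replace (midpoint y x) with (x - (x - midpoint y x))%C by ring.
    rewrite E2. ring. }
  assert (P1 : perimeter a (midpoint a b) (midpoint c a) = s / 2).
  { unfold perimeter. rewrite E1, E2, (Cmod_minus_sym (midpoint c a)), E3, !Cmod_half.
    unfold s, perimeter. rewrite (Cmod_minus_sym b c). lra. }
  assert (P2 : perimeter (midpoint a b) b (midpoint b c) = s / 2).
  { unfold perimeter. rewrite E1, E2, (Cmod_minus_sym (midpoint a b)), E3, !Cmod_half.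
    unfold s, perimeter. rewrite (Cmod_minus_sym c a). lra. }
  assert (P3 : perimeter (midpoint c a) (midpoint b c) c = s / 2).
  { unfold perimeter. rewrite E1, E2, (Cmod_minus_sym (midpoint b c)), E3, !Cmod_half.
    unfold s, perimeter. rewrite (Cmod_minus_sym a b). lra. }
  assert (P4 : perimeter (midpoint b c) (midpoint c a) (midpoint a b) = s / 2).
  { unfold perimeter. rewrite !E3, !Cmod_half.
    unfold s, perimeter. rewrite (Cmod_minus_sym a b), (Cmod_minus_sym b c), (Cmod_minus_sym c a). lra. }
  assert (N1 := Cmod_ge_0 (b - a)). assert (N2 := Cmod_ge_0 (c - b)).
  assert (N3 := Cmod_ge_0 (a - c)).
  destruct (Rlt_le_dec (eps * (s / 2 * (s / 2))) (Cmod (triangle h a (midpoint a b) (midpoint c a)))) as [B1|B1].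
  { exists a, (midpoint a b), (midpoint c a). repeat split; auto.
    - now rewrite P1.
    - rewrite Cmod_diag. unfold s, perimeter; lra. }
  destruct (Rlt_le_dec (eps * (s / 2 * (s / 2))) (Cmod (triangle h (midpoint a b) b (midpoint b c)))) as [B2|B2].
  { exists (midpoint a b), b, (midpoint b c). repeat split; auto.
    - now rewrite P2.
    - rewrite E1, Cmod_half. unfold s, perimeter; lra. }
  destruct (Rlt_le_dec (eps * (s / 2 * (s / 2))) (Cmod (triangle h (midpoint c a) (midpoint b c) c))) as [B3|B3].
  { exists (midpoint c a), (midpoint b c), c. repeat split; auto.
    - now rewrite P3.
    - rewrite Cmod_minus_sym, E2, Cmod_half. unfold s, perimeter; lra. }
  destruct (Rlt_le_dec (eps * (s / 2 * (s / 2))) (Cmod (triangle h (midpoint b c) (midpoint c a) (midpoint a b)))) as [B4|B4].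
  { exists (midpoint b c), (midpoint c a), (midpoint a b). repeat split; auto.
    - now rewrite P4.
    - apply Rle_trans with (1 := Cmod_minus_triangle _ b _). rewrite E1, Cmod_half.
      unfold s, perimeter; lra. }
  (* If none of the four pieces were bad, their bounds would add up to [eps * (s * s)]. *)
  exfalso. rewrite (triangle_subdivide U h a b c) in HB by auto.
  assert (Q : forall x y z w : C, Cmod (x + y + z + w) <= Cmod x + Cmod y + Cmod z + Cmod w).
  { intros x y z w. apply Rle_trans with (1 := Cmod_triangle _ _).
    apply Rplus_le_compat_r, Cmod_triangle3. }
  apply Rlt_le_trans with (2 := Q _ _ _ _) in HB.
  assert (eps * (s / 2 * (s / 2)) * 4 = eps * (s * s)) by field. lra.
Qed.

Lemma Cmod_convex (x y z : C) t r : 0 <= t <= 1 -> Cmod (x - z) <= r -> Cmod (y - z) <= r ->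
  Cmod (x + RtoC t * (y - x) - z) <= r.
Proof.
  intros Ht Hx Hy.
  replace (x + RtoC t * (y - x) - z)%C with (RtoC (1 - t) * (x - z) + RtoC t * (y - z))%C
    by (rewrite RtoC_minus; ring).
  apply Rle_trans with (1 := Cmod_triangle _ _). rewrite !Cmod_mult, !Cmod_RtoC by lra.
  assert ((1 - t) * Cmod (x - z) <= (1 - t) * r) by (apply Rmult_le_compat_l; lra).
  assert (t * Cmod (y - z) <= t * r) by (apply Rmult_le_compat_l; lra). lra.
Qed.

Lemma goursat (U : C -> Prop) h a b c : convexC U -> closedC U ->
  (forall z, U z -> exists l, D1 h z l) -> U a -> U b -> U c -> triangle h a b c = RtoC 0.
Proof.
  intros HU HC HD Ha Hb Hc.
  assert (Hh : forall z, U z -> contC h z).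
  { intros z Hz. destruct (HD z Hz) as [l Hl]. exact (D1_contC _ _ _ Hl). }
  apply NNPP. intros HT. apply Cmod_gt_0 in HT.
  set (s0 := perimeter a b c).
  assert (Hs0 : 0 <= s0).
  { unfold s0, perimeter. generalize (Cmod_ge_0 (b - a)) (Cmod_ge_0 (c - b)) (Cmod_ge_0 (a - c)). lra. }
  set (tau := Cmod (triangle h a b c)) in *.
  (* With this choice [eps * (s0 * s0)] is strictly below [tau]; the summand 1 also covers a
     degenerate triangle with [s0 = 0]. *)
  set (eps := tau / (s0 * s0 + 1)).
  assert (Heps : 0 < eps) by (apply Rdiv_lt_0_compat; nra).
  assert (B0 : bad_triangle U h eps (a, b, c)).
  { repeat split; auto. fold s0 tau.
    assert (E : eps * (s0 * s0 + 1) = tau) by (unfold eps; field; nra). lra. }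
  pose (per (T : C * C * C) := perimeter (fst (fst T)) (snd (fst T)) (snd T)).
  (* Badness is placed under the existential so that a successor can be chosen for every triangle,
     and the sequence defined by plain recursion. *)
  assert (Hstep : forall T, exists T', bad_triangle U h eps T ->
    bad_triangle U h eps T' /\ per T' = per T / 2 /\
    Cmod (fst (fst T') - fst (fst T)) <= per T).
  { intros [[x y] z]. destruct (classic (bad_triangle U h eps (x, y, z))) as [B|B].
    - destruct (bad_triangle_step U h eps x y z HU Hh B) as [x' [y' [z' H]]].
      exists (x', y', z'). intros _. exact H.
    - exists (x, y, z). intros B'. contradiction. }
  pose (step T := proj1_sig (constructive_indefinite_description _ (Hstep T))).
  assert (Hs : forall T, bad_triangle U h eps T -> bad_triangle U h eps (step T) /\
    per (step T) = per T / 2 /\ Cmod (fst (fst (step T)) - fst (fst T)) <= per T).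
  { intros T. unfold step. destruct (constructive_indefinite_description _ (Hstep T)) as [T' HT'].
    exact HT'. }
  pose (Tn := fix Tn n := match n with O => (a, b, c) | S n => step (Tn n) end).
  assert (HB : forall n, bad_triangle U h eps (Tn n)).
  { induction n as [|n IH]; [exact B0|]. simpl. now apply Hs. }
  assert (Hper : forall n, per (Tn n) = s0 * (/ 2) ^ n).
  { induction n as [|n IH]; [simpl; unfold per; simpl; fold s0; ring|].
    simpl. destruct (Hs _ (HB n)) as [_ [E _]]. rewrite E, IH. field. }
  destruct (Cseq_geometric_limit (fun n => fst (fst (Tn n))) s0) as [z Hz].
  { intros n. destruct (Hs _ (HB n)) as [_ [_ E]]. now rewrite <- Hper. }
  assert (Hsmall : forall d, 0 < d -> exists n, 5 * s0 * (/ 2) ^ n < d).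
  { intros d Hd.
    destruct (pow_lt_1_zero (/ 2)) with (y := d / (5 * s0 + 1)) as [n Hn].
    - rewrite Rabs_pos_eq; lra.
    - apply Rdiv_lt_0_compat; lra.
    - exists n. specialize (Hn n (Nat.le_refl n)).
      assert (Hp : 0 < (/ 2) ^ n) by (apply pow_lt; lra).
      rewrite Rabs_pos_eq in Hn by lra.
      assert ((5 * s0 + 1) * (/ 2) ^ n < d).
      { replace d with ((5 * s0 + 1) * (d / (5 * s0 + 1))) by (field; lra).
        apply Rmult_lt_compat_l; lra. }
      lra. }
  assert (Uz : U z).
  { apply HC. intros e He. destruct (Hsmall e He) as [n Hn]. exists (fst (fst (Tn n))).
    split.
    - generalize (HB n). destruct (Tn n) as [[x y] w]. now intros [H _].
    - apply Rle_lt_trans with (1 := Hz n).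
      assert (Hp : 0 < (/ 2) ^ n) by (apply pow_lt; lra). nra. }
  destruct (HD z Uz) as [l [_ Hl]].
  (* The triangle will lie within [5 * s] of [z], and [seg_bound] doubles the bound on the
     integrand: [2 * (eps / 10) * (5 * s)] is [eps * s]. *)
  destruct (Hl (eps / 10)) as [d [Hd HDz]]; [lra|].
  destruct (Hsmall d Hd) as [n Hn].
  specialize (HB n). specialize (Hper n). specialize (Hz n).
  destruct (Tn n) as [[x y] w]. unfold per in Hper; simpl in Hper, Hz.
  destruct HB as [Ux [Uy [Uw HB]]]. set (s := perimeter x y w) in *.
  assert (N1 := Cmod_ge_0 (y - x)). assert (N2 := Cmod_ge_0 (w - y)).
  assert (N3 := Cmod_ge_0 (x - w)).
  assert (Zx : Cmod (x - z) <= 5 * s).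
  { assert (0 <= s) by (unfold s, perimeter; lra). nra. }
  assert (Zx' : Cmod (x - z) <= 4 * s) by lra.
  assert (Zy : Cmod (y - z) <= 5 * s).
  { apply Rle_trans with (1 := Cmod_minus_triangle _ x _). unfold s, perimeter in *; lra. }
  assert (Zw : Cmod (w - z) <= 5 * s).
  { apply Rle_trans with (1 := Cmod_minus_triangle _ x _).
    rewrite (Cmod_minus_sym w x). unfold s, perimeter in *; lra. }
  (* The first-order approximation of [h] at [z] has the primitive [P], so its integrals telescope
     around the triangle and only the remainder of [h] contributes. *)
  pose (c0 := (h z - l * z)%C). pose (aff := fun v : C => (c0 + l * v)%C).
  pose (P := fun v : C => (c0 * v + RtoC (/ 2) * l * (v * v))%C).
  assert (HP : forall v, D1 P v (aff v)).
  { intros v. unfold P, aff.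
    eapply D1_eq; [|apply D1_plus; [apply D1_scal, D1_id|apply D1_scal, D1_mult; apply D1_id]].
    replace (l * v)%C with (RtoC (/ 2) * (l * v) + RtoC (/ 2) * (l * v))%C
      by apply RtoC_half_double. ring. }
  assert (Haff : forall v, contC aff v).
  { intros v. apply (D1_contC aff v l). apply D1_affine. }
  assert (Hcu : forall u v, cont01 (fun t => aff (u + RtoC t * (v - u))%C)).
  { intros u v. apply (cont01_comp aff); [auto|apply cont01_line]. }
  assert (Hseg : forall u v, U u -> U v -> Cmod (u - z) <= 5 * s -> Cmod (v - z) <= 5 * s ->
    Cmod (seg h u v - (P v - P u)) <= eps * s * Cmod (v - u)).
  { intros u v Uu Uv Bu Bv. rewrite <- (seg_derive P aff u v HP Haff).
    rewrite <- seg_minus; eauto using seg_cont01.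
    replace (eps * s * Cmod (v - u)) with (2 * (eps / 10 * (5 * s)) * Cmod (v - u)) by field.
    apply seg_bound.
    - apply cont01_minus; eauto using seg_cont01.
    - intros t Ht. assert (Q := Cmod_convex u v z t (5 * s) Ht Bu Bv).
      set (q := (u + RtoC t * (v - u))%C) in *.
      replace (h q - aff q)%C with (h q - h z - l * (q - z))%C by (unfold aff, c0; ring).
      apply Rle_trans with (eps / 10 * dist1 z q).
      + apply HDz. unfold dist1. lra.
      + apply Rmult_le_compat_l; [lra|exact Q]. }
  assert (R1 := Hseg x y Ux Uy Zx Zy). assert (R2 := Hseg y w Uy Uw Zy Zw).
  assert (R3 := Hseg w x Uw Ux Zw Zx).
  assert (Cmod (triangle h x y w) <= eps * (s * s)).
  { replace (triangle h x y w) with ((seg h x y - (P y - P x)) + (seg h y w - (P w - P y))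
      + (seg h w x - (P x - P w)))%C by (unfold triangle; ring).
    apply Rle_trans with (1 := Cmod_triangle3 _ _ _).
    replace (eps * (s * s)) with (eps * s * Cmod (y - x) + eps * s * Cmod (w - y)
      + eps * s * Cmod (x - w)) by (unfold s at 4, perimeter; ring). lra. }
  lra.
Qed.

(** * Convex closed sets and primitives on them *)

Lemma convexC_disc z r : convexC (fun w => Cmod (w - z) <= r).
Proof. intros a b t Ha Hb Ht. now apply Cmod_convex. Qed.

Lemma closedC_disc z r : closedC (fun w => Cmod (w - z) <= r).
Proof.
  intros w Hw. apply Rnot_lt_le. intros Hlt.
  destruct (Hw (Cmod (w - z) - r)) as [v [Hv Hvw]]; [lra|].
  assert (T := Cmod_minus_triangle w v z). rewrite (Cmod_minus_sym w v) in T. lra.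
Qed.

Lemma convexC_and U V : convexC U -> convexC V -> convexC (fun z => U z /\ V z).
Proof. intros HU HV a b t [Ha Ha'] [Hb Hb'] Ht. split; auto. Qed.

Lemma closedC_and U V : closedC U -> closedC V -> closedC (fun z => U z /\ V z).
Proof.
  intros HU HV z Hz. split; [apply HU|apply HV]; intros e He;
    destruct (Hz e He) as [w [[Hw1 Hw2] Hw]]; eauto.
Qed.

Lemma convexC_halfplane z c r : convexC (fun w => r <= Re ((w - z) * c)).
Proof.
  intros a b t Ha Hb Ht.
  replace ((a + RtoC t * (b - a) - z) * c)%C
    with (RtoC (1 - t) * ((a - z) * c) + RtoC t * ((b - z) * c))%C by (rewrite RtoC_minus; ring).
  set (x := ((a - z) * c)%C) in *. set (y := ((b - z) * c)%C) in *.
  replace (Re (RtoC (1 - t) * x + RtoC t * y)) with ((1 - t) * Re x + t * Re y)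
    by (unfold Re; simpl; ring).
  assert ((1 - t) * r <= (1 - t) * Re x) by (apply Rmult_le_compat_l; lra).
  assert (t * r <= t * Re y) by (apply Rmult_le_compat_l; lra). lra.
Qed.

Lemma closedC_halfplane z c r : closedC (fun w => r <= Re ((w - z) * c)).
Proof.
  intros w Hw. apply Rnot_lt_le. intros Hlt.
  set (d := r - Re ((w - z) * c)). assert (Hd : 0 < d) by (unfold d; lra).
  assert (Hc := Cmod_ge_0 c).
  destruct (Hw (d / (Cmod c + 1))) as [v [Hv Hvw]]; [apply Rdiv_lt_0_compat; lra|].
  assert (E : Re ((v - z) * c) - Re ((w - z) * c) <= Cmod ((v - w) * c)).
  { apply Rle_trans with (1 := Rle_abs _). apply Rle_trans with (1 := Re_le_Cmod_minus _ _).
    right. f_equal. ring. }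
  rewrite Cmod_mult in E.
  assert (Cmod (v - w) * Cmod c <= d / (Cmod c + 1) * Cmod c) by (apply Rmult_le_compat_r; lra).
  assert (d / (Cmod c + 1) * Cmod c < d).
  { apply Rlt_le_trans with (d / (Cmod c + 1) * (Cmod c + 1)).
    - apply Rmult_lt_compat_l; [apply Rdiv_lt_0_compat; lra|lra].
    - right; field; lra. }
  unfold d in *. lra.
Qed.

Lemma Re_mult_Cconj (x : C) : Re (x * Cconj x) = Cmod x * Cmod x.
Proof. rewrite <- Cmod2_conj. simpl. ring. Qed.

(* Away from the base point [z0], where [h] is only continuous, Goursat's theorem is
   applied to the triangles cut off by a half-plane that avoids [z0]. *)
Lemma seg_base_increment (U : C -> Prop) h z0 w v : convexC U -> closedC U -> U z0 ->
  (forall z, U z -> contC h z) -> (forall z, U z -> z <> z0 -> exists l, D1 h z l) ->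
  w <> z0 -> U w -> U v -> Cmod (v - w) <= Cmod (w - z0) / 2 ->
  (seg h z0 v - seg h z0 w)%C = seg h w v.
Proof.
  intros HU HC Hz0 Hh HD Hw Uw Uv Hv.
  set (D := Cmod (w - z0)) in *.
  assert (HD0 : 0 < D).
  { apply Cmod_gt_0. intros E. apply Hw. replace w with ((w - z0) + z0)%C by ring.
    rewrite E. ring. }
  destruct (Hh z0 Hz0 1) as [eta [Heta Bh]]; [lra|].
  set (B := Cmod (h z0) + 1). assert (HB : 0 < B) by (generalize (Cmod_ge_0 (h z0)); unfold B; lra).
  assert (Hbd : forall z, Cmod (z - z0) < eta -> Cmod (h z) <= B).
  { intros z Hz. specialize (Bh z Hz).
    replace (h z) with ((h z - h z0) + h z0)%C by ring.
    apply Rle_trans with (1 := Cmod_triangle _ _). unfold B. lra. }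
  (* Since [kap < 1] and [kap * (2 * D) < eta], contraction towards [z0] by [e = e0 * kap] brings
     [w] and [v] into the disc where [h] is bounded by [B], whatever [e0 < 1]. *)
  set (kap := eta / (2 * D + eta)).
  assert (Hk0 : 0 < kap) by (apply Rdiv_lt_0_compat; lra).
  assert (Ek : kap * (2 * D + eta) = eta) by (unfold kap; field; lra).
  assert (Hk1 : kap < 1) by nra.
  assert (Hk2 : kap * (2 * D) < eta) by nra.
  apply Cmod_arbitrarily_small with (2 * B * (4 * D)). intros e0 He0.
  set (e := e0 * kap). assert (He : 0 < e < 1) by (unfold e; split; nra).
  assert (He2 : e * (2 * D) < eta).
  { unfold e. assert (0 < kap * (2 * D)) by (apply Rmult_lt_0_compat; lra). nra. }
  assert (Hee0 : e <= e0) by (unfold e; nra).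
  assert (Hvz : Cmod (v - z0) <= 2 * D).
  { apply Rle_trans with (1 := Cmod_minus_triangle _ w _). fold D. lra. }
  set (m := (z0 + RtoC e * (w - z0))%C). set (n := (z0 + RtoC e * (v - z0))%C).
  assert (Um : U m) by (apply HU; auto; lra). assert (Un : U n) by (apply HU; auto; lra).
  set (cc := Cconj (w - z0)).
  (* This half-plane omits [z0]. It contains [n], and with it [m], [w] and [v], because [v] is
     within [D / 2] of [w] and so has at least half the projection of [w] on the direction
     [w - z0]. *)
  set (V := fun z => U z /\ e / 2 * (D * D) <= Re ((z - z0) * cc)).
  assert (HVconv : convexC V) by (apply convexC_and; [exact HU|apply convexC_halfplane]).
  assert (HVclosed : closedC V) by (apply closedC_and; [exact HC|apply closedC_halfplane]).
  assert (HVD : forall z, V z -> exists l, D1 h z l).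
  { intros z [Uz Rz]. apply HD; [exact Uz|]. intros ->.
    replace ((z0 - z0) * cc)%C with (RtoC 0) in Rz by ring. rewrite re_RtoC in Rz.
    assert (0 < D * D) by nra. assert (0 < e / 2 * (D * D)) by (apply Rmult_lt_0_compat; lra).
    lra. }
  assert (Rw : Re ((w - z0) * cc) = D * D) by (unfold cc; apply Re_mult_Cconj).
  assert (Ecc : Cmod cc = D) by apply Cmod_conj.
  assert (Rv : D * D / 2 <= Re ((v - z0) * cc)).
  { replace ((v - z0) * cc)%C with ((v - w) * cc + (w - z0) * cc)%C by ring.
    change (D * D / 2 <= Re ((v - w) * cc) + Re ((w - z0) * cc)). rewrite Rw.
    assert (Q := re_le_Cmod ((v - w) * cc)%C). apply Rabs_le_between in Q.
    rewrite Cmod_mult, Ecc in Q. nra. }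
  assert (Rs : forall x, Re ((z0 + RtoC e * (x - z0) - z0) * cc) = e * Re ((x - z0) * cc)).
  { intros x. replace ((z0 + RtoC e * (x - z0) - z0) * cc)%C
      with (RtoC e * ((x - z0) * cc))%C by ring. apply re_scal_l. }
  assert (Vw : V w) by (split; [exact Uw|rewrite Rw; nra]).
  assert (Vv : V v) by (split; [exact Uv|]; apply Rle_trans with (2 := Rv); nra).
  assert (Vm : V m) by (split; [exact Um|unfold m; rewrite Rs, Rw; nra]).
  assert (Vn : V n) by (split; [exact Un|unfold n; rewrite Rs; nra]).
  (* These two triangles make up the quadrilateral [m], [w], [v], [n] left after cutting off the
     corner at [z0]. *)
  assert (G1 := goursat V h m w v HVconv HVclosed HVD Vm Vw Vv).
  assert (G2 := goursat V h m v n HVconv HVclosed HVD Vm Vv Vn).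
  unfold triangle in G1, G2.
  rewrite (seg_split U h z0 w e), (seg_split U h z0 v e) by (auto; lra).
  fold m n.
  assert (R1 := seg_rev U h v m HU Hh Uv Um). assert (R2 := seg_rev U h v n HU Hh Uv Un).
  assert (Nm : Cmod (m - z0) <= e * (2 * D)).
  { unfold m. replace (z0 + RtoC e * (w - z0) - z0)%C with (RtoC e * (w - z0))%C by ring.
    rewrite Cmod_mult, Cmod_RtoC by lra. fold D. nra. }
  assert (Nn : Cmod (n - z0) <= e * (2 * D)).
  { unfold n. replace (z0 + RtoC e * (v - z0) - z0)%C with (RtoC e * (v - z0))%C by ring.
    rewrite Cmod_mult, Cmod_RtoC by lra. apply Rmult_le_compat_l; lra. }
  assert (Nz : Cmod (z0 - z0) <= e * (2 * D)) by (rewrite Cmod_diag; nra).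
  assert (Hseg : forall a b, U a -> U b -> Cmod (a - z0) <= e * (2 * D) ->
    Cmod (b - z0) <= e * (2 * D) -> Cmod (seg h a b) <= 2 * B * Cmod (b - a)).
  { intros a b Ua Ub Na Nb. apply seg_bound.
    - eauto using seg_cont01.
    - intros t Ht. apply Hbd. apply Rle_lt_trans with (2 := He2). now apply Cmod_convex. }
  assert (S1 := Hseg z0 n Hz0 Un Nz Nn). assert (S2 := Hseg z0 m Hz0 Um Nz Nm).
  assert (S3 := Hseg n m Un Um Nn Nm).
  assert (L1 : Cmod (n - z0) <= 3 / 2 * D * e).
  { unfold n. replace (z0 + RtoC e * (v - z0) - z0)%C with (RtoC e * (v - z0))%C by ring.
    rewrite Cmod_mult, Cmod_RtoC by lra.
    assert (Cmod (v - z0) <= 3 / 2 * D).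
    { apply Rle_trans with (1 := Cmod_minus_triangle _ w _). fold D. lra. }
    nra. }
  assert (L2 : Cmod (m - z0) <= D * e).
  { unfold m. replace (z0 + RtoC e * (w - z0) - z0)%C with (RtoC e * (w - z0))%C by ring.
    rewrite Cmod_mult, Cmod_RtoC by lra. fold D. lra. }
  assert (L3 : Cmod (m - n) <= 1 / 2 * D * e).
  { unfold m, n. replace (z0 + RtoC e * (w - z0) - (z0 + RtoC e * (v - z0)))%C
      with (RtoC e * (w - v))%C by ring.
    rewrite Cmod_mult, Cmod_RtoC, Cmod_minus_sym by lra. nra. }
  (* What remains is the integral around the corner [z0], [n], [m], whose perimeter is at most
     [3 * D * e]. *)
  replace (seg h z0 n + seg h n v - (seg h z0 m + seg h m w) - seg h w v)%C
    with (seg h z0 n + - (1) * seg h z0 m + seg h n m)%C.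
  - apply Rle_trans with (1 := Cmod_triangle3 _ _ _).
    replace (- (1) * seg h z0 m)%C with (- seg h z0 m)%C by ring. rewrite Cmod_opp.
    assert (2 * B * Cmod (n - z0) <= 2 * B * (3 / 2 * D * e)) by (apply Rmult_le_compat_l; lra).
    assert (2 * B * Cmod (m - z0) <= 2 * B * (D * e)) by (apply Rmult_le_compat_l; lra).
    assert (2 * B * Cmod (m - n) <= 2 * B * (1 / 2 * D * e)) by (apply Rmult_le_compat_l; lra).
    assert (2 * B * (4 * D) * e <= 2 * B * (4 * D) * e0)
      by (apply Rmult_le_compat_l; [apply Rmult_le_pos; lra|lra]).
    assert (0 <= B * (D * e)) by (apply Rmult_le_pos; [lra|apply Rmult_le_pos; lra]).
    lra.
  - assert (X1 : seg h m w = (- seg h w v - seg h v m)%C).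
    { replace (seg h m w) with ((seg h m w + seg h w v + seg h v m) - seg h w v - seg h v m)%C by ring.
      rewrite G1. ring. }
    assert (X2 : seg h n m = (- seg h m v - seg h v n)%C).
    { replace (seg h n m) with ((seg h m v + seg h v n + seg h n m) - seg h m v - seg h v n)%C by ring.
      rewrite G2. ring. }
    rewrite X1, X2, R1, R2. ring.
Qed.

(** Differentiability may fail at the base point, as for the difference quotient in Cauchy's
    formula. At [w = z0] itself the required increment identity is trivial; elsewhere it is
    [seg_base_increment], and continuity of [h] at [w] finishes. *)
Lemma D1_primitive (U : C -> Prop) h z0 w r : convexC U -> closedC U -> U z0 ->
  (forall z, U z -> contC h z) -> (forall z, U z -> z <> z0 -> exists l, D1 h z l) ->
  0 < r -> (forall v, Cmod (v - w) < r -> U v) -> D1 (fun v => seg h z0 v) w (h w).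
Proof.
  intros HU HC Hz0 Hh HD Hr Hball.
  assert (Uw : U w) by (apply Hball; now rewrite Cmod_diag).
  assert (Key : exists d, 0 < d /\ d <= r /\ forall v, Cmod (v - w) < d ->
    (seg h z0 v - seg h z0 w)%C = seg h w v).
  { destruct (classic (w = z0)) as [->|Hw].
    - exists r. repeat split; [lra|lra|]. intros v _. unfold seg at 2.
      replace (z0 - z0)%C with (RtoC 0) by ring. ring.
    - assert (HD0 : 0 < Cmod (w - z0)).
      { apply Cmod_gt_0. intros E. apply Hw. replace w with ((w - z0) + z0)%C by ring.
        rewrite E. ring. }
      exists (Rmin r (Cmod (w - z0) / 2)). split; [apply Rmin_glb_lt; lra|].
      split; [apply Rmin_l|]. intros v Hv. apply (seg_base_increment U); auto.
      + apply Hball. apply Rlt_le_trans with (1 := Hv), Rmin_l.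
      + left. apply Rlt_le_trans with (1 := Hv), Rmin_r. }
  destruct Key as [d [Hd [Hdr Key]]]. split.
  - exists (Cmod (h w) + 1). split; [generalize (Cmod_ge_0 (h w)); lra|].
    intros v. rewrite Cmod_mult. unfold dist1. generalize (Cmod_ge_0 (v - w)). nra.
  - intros e He. destruct (Hh w Uw (e / 2)) as [d1 [Hd1 P1]]; [lra|].
    exists (Rmin d d1); split; [now apply Rmin_glb_lt|]. intros v Hv. unfold dist1 in *.
    assert (V1 := Rlt_le_trans _ _ _ Hv (Rmin_l _ _)).
    assert (V2 := Rlt_le_trans _ _ _ Hv (Rmin_r _ _)).
    rewrite Key by exact V1.
    assert (Uv : U v) by (apply Hball; lra).
    assert (E : (seg h w v - h w * (v - w))%C = seg (fun z => h z - h w)%C w v).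
    { rewrite (seg_minus h (fun _ => h w)); eauto using seg_cont01, cont01_const.
      unfold seg at 3. rewrite J_const. ring. }
    rewrite E. replace (e * Cmod (v - w)) with (2 * (e / 2) * Cmod (v - w)) by field.
    apply seg_bound.
    + apply cont01_minus; eauto using seg_cont01, cont01_const.
    + intros t Ht. left. apply P1. apply Rle_lt_trans with (2 := V2).
      apply Cmod_convex; [exact Ht| |lra]. rewrite Cmod_diag. apply Cmod_ge_0.
Qed.

(** * Cauchy's formula *)

(** With a primitive [Q] the integral is the difference of its values at the two coinciding ends;
    differentiability of [v] and [q] provides the continuity of the integrand. *)
Lemma J_loop (gamma v : R -> C) (v' : R -> C) Q q :
  (forall t, 0 <= t <= 1 -> DR gamma t (v t)) -> (forall t, 0 <= t <= 1 -> DR v t (v' t)) ->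
  (forall t, 0 <= t <= 1 -> D1 Q (gamma t) (q (gamma t))) ->
  (forall t, 0 <= t <= 1 -> exists l, D1 q (gamma t) l) ->
  gamma 1 = gamma 0 -> J (fun t => q (gamma t) * v t)%C = RtoC 0.
Proof.
  intros Hg Hv HQ Hq Hloop.
  rewrite (J_derive (fun t => Q (gamma t))).
  - rewrite Hloop. ring.
  - intros t Ht. apply (DR_comp Q); auto.
  - intros t Ht. destruct (Hq t Ht) as [l Hl].
    assert (A := DR_comp q gamma t l (v t) Hl (Hg t Ht)).
    exact (isD_continuous _ distR_ge_0 _ _ _ (isD_mult _ distR_ge_0 _ _ _ _ _ A (Hv t Ht))).
Qed.

Lemma is_derive_increment (u : R -> R) t a : is_derive u t a -> forall eps, 0 < eps ->
  exists delta, 0 < delta /\ forall s, Rabs (s - t) < delta ->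
    Rabs (u s - u t - (s - t) * a) <= eps * Rabs (s - t).
Proof.
  intros [_ H] e He.
  assert (Hlim : is_filter_lim (locally t) t) by (intros P HP; exact HP).
  destruct (H t Hlim (mkposreal e He)) as [[d Hd] P].
  exists d; split; [exact Hd|]. exact P.
Qed.

Lemma DR_pair (u v : R -> R) t a b : is_derive u t a -> is_derive v t b ->
  DR (fun s => (u s, v s)) t (a, b).
Proof.
  intros Hu Hv. split.
  - exists (Cmod (a, b) + 1); split; [generalize (Cmod_ge_0 (a, b)); lra|]. intros s.
    rewrite Cmod_mult, Cmod_R. unfold distR. generalize (Rabs_pos (s - t)). nra.
  - intros e He.
    destruct (is_derive_increment _ _ _ Hu (e / 2)) as [d1 [Hd1 P1]]; [lra|].
    destruct (is_derive_increment _ _ _ Hv (e / 2)) as [d2 [Hd2 P2]]; [lra|].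
    exists (Rmin d1 d2); split; [now apply Rmin_glb_lt|]. intros s Hs.
    specialize (P1 s (Rlt_le_trans _ _ _ Hs (Rmin_l _ _))).
    specialize (P2 s (Rlt_le_trans _ _ _ Hs (Rmin_r _ _))).
    unfold distR.
    replace ((u s, v s) - (u t, v t) - (a, b) * RtoC (s - t))%C
      with (RtoC (u s - u t - (s - t) * a) + Ci * RtoC (v s - v t - (s - t) * b))%C
      by (apply injective_projections; simpl; ring).
    apply Rle_trans with (1 := Cmod_triangle _ _).
    rewrite Cmod_mult, Cmod_Ci, !Cmod_R. lra.
Qed.

(** * The unit circle and Cauchy's integral *)

Definition circle (t : R) : C := (cos (2 * PI * t), sin (2 * PI * t)).

Definition two_pi_i : C := (0, 2 * PI).

Lemma two_pi_i_neq_0 : two_pi_i <> RtoC 0.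
Proof. intros E. apply (f_equal snd) in E. simpl in E. generalize PI_RGT_0. lra. Qed.

Lemma DR_circle t : DR circle t (two_pi_i * circle t)%C.
Proof.
  replace (two_pi_i * circle t)%C
    with (2 * PI * - sin (2 * PI * t), 2 * PI * cos (2 * PI * t))
    by (apply injective_projections; simpl; ring).
  apply DR_pair; auto_derive; auto; ring.
Qed.

Lemma Cmod_circle t : Cmod (circle t) = 1.
Proof.
  transitivity (sqrt 1); [|apply sqrt_1]. unfold Cmod, circle; simpl. f_equal.
  assert (H := sin2_cos2 (2 * PI * t)). unfold Rsqr in H. lra.
Qed.

Lemma circle_neq_0 t : circle t <> RtoC 0.
Proof. apply Cmod_gt_0. rewrite Cmod_circle. lra. Qed.

Lemma circle_loop : circle 1 = circle 0.
Proof.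
  unfold circle. rewrite Rmult_1_r, Rmult_0_r. now rewrite cos_2PI, sin_2PI, cos_0, sin_0.
Qed.

Lemma DR_scal c f t v : DR f t v -> DR (fun s => c * f s)%C t (c * v)%C.
Proof.
  intros H. apply (DR_comp (fun z => c * z)%C f t c v); [|exact H].
  eapply D1_eq; [|apply D1_scal, D1_id]. ring.
Qed.

Lemma DR_eq f t v v' : v = v' -> DR f t v -> DR f t v'.
Proof. now intros ->. Qed.

Lemma DR_plus_const c f t v : DR f t v -> DR (fun s => c + f s)%C t v.
Proof.
  intros H. eapply DR_eq; [|apply (DR_comp (fun z => c + z)%C f t 1 v); [|exact H]].
  - ring.
  - eapply D1_eq; [|apply D1_plus; [apply D1_const|apply D1_id]]. ring.
Qed.

Lemma cont01_DR f v : (forall t, DR f t (v t)) -> cont01 f.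
Proof. intros H. apply contR_cont01. intros t _. exact (DR_continuous _ _ _ (H t)). Qed.

Lemma cont01_circle : cont01 circle.
Proof. exact (cont01_DR _ _ DR_circle). Qed.

Lemma cont01_inv f : cont01 f -> (forall t, 0 <= t <= 1 -> f t <> RtoC 0) ->
  cont01 (fun t => / f t)%C.
Proof.
  intros Hf Hn. apply (cont01_comp Cinv); [|exact Hf].
  intros t Ht. exact (D1_contC _ _ _ (D1_inv _ (Hn t Ht))).
Qed.

Lemma circle_minus_neq_0 rho k t : 0 < rho -> Cmod k < rho ->
  (RtoC rho * circle t - k)%C <> RtoC 0.
Proof.
  intros Hr Hk E.
  assert (X : (RtoC rho * circle t)%C = k).
  { replace (RtoC rho * circle t)%C with ((RtoC rho * circle t - k) + k)%C by ring.
    rewrite E. ring. }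
  rewrite <- X, Cmod_mult, Cmod_circle, Cmod_RtoC in Hk; lra.
Qed.

Lemma D1_div phi psi z l m : psi z <> RtoC 0 -> D1 phi z l -> D1 psi z m ->
  exists d, D1 (fun w => phi w / psi w)%C z d.
Proof.
  intros Hz H K. eexists. unfold Cdiv. apply D1_mult; [exact H|].
  apply (D1_comp Cinv psi); [|exact K]. now apply D1_inv.
Qed.

(* In the variable [1 / circle t] the integrand becomes [psi (w) dw] with
   [psi] holomorphic near the closed unit disc. *)
Lemma winding_number rho k : 0 < rho -> Cmod k < rho / 2 ->
  J (fun t => RtoC rho * circle t / (RtoC rho * circle t - k))%C = RtoC 1.
Proof.
  intros Hr Hk.
  assert (Hne : forall t, (RtoC rho * circle t - k)%C <> RtoC 0)
    by (intros; apply circle_minus_neq_0; lra).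
  assert (Hrho : RtoC rho <> RtoC 0) by (intros E; apply RtoC_inj in E; lra).
  set (kr := (k / RtoC rho)%C).
  assert (Hkr : Cmod kr < / 2).
  { unfold kr. rewrite Cmod_div, Cmod_RtoC by (assumption || lra).
    apply Rmult_lt_reg_r with rho; [exact Hr|]. unfold Rdiv.
    rewrite Rmult_assoc, Rinv_l; lra. }
  pose (psi := fun w : C => (1 / (1 - kr * w))%C).
  pose (ebar := fun t => (/ circle t)%C).
  assert (Hebar : forall t, Cmod (ebar t) = 1).
  { intros t. unfold ebar. rewrite Cmod_inv, Cmod_circle by apply circle_neq_0. apply Rinv_1. }
  (* Here [kr * w] has modulus below 3/4, and the radius 3/2 leaves a margin of 1/2 around the unit
     circle, as [D1_primitive] requires. *)
  assert (Hpsi_ne : forall w, Cmod w <= 3 / 2 -> (1 - kr * w)%C <> RtoC 0).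
  { intros w Hw E.
    assert (X : (kr * w)%C = RtoC 1).
    { replace (kr * w)%C with (1 - (1 - kr * w))%C by ring. rewrite E. ring. }
    apply (f_equal Cmod) in X. rewrite Cmod_mult, Cmod_1 in X.
    generalize (Cmod_ge_0 w) (Cmod_ge_0 kr). nra. }
  assert (Hpsi : forall w, Cmod w <= 3 / 2 -> exists l, D1 psi w l).
  { intros w Hw. unfold psi. eapply D1_div.
    - now apply Hpsi_ne.
    - apply D1_const.
    - apply D1_minus; [apply D1_const|apply D1_scal, D1_id]. }
  assert (E0 : forall w, (w - 0)%C = w) by (intros; ring).
  assert (HP : forall t, D1 (fun v => seg psi 0 v) (ebar t) (psi (ebar t))).
  { intros t. apply (D1_primitive (fun w => Cmod (w - 0) <= 3 / 2)) with (/ 2).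
    - apply convexC_disc.
    - apply closedC_disc.
    - rewrite Cmod_diag. lra.
    - intros z Hz. rewrite E0 in Hz. destruct (Hpsi z Hz) as [l Hl]. exact (D1_contC _ _ _ Hl).
    - intros z Hz _. rewrite E0 in Hz. auto.
    - lra.
    - intros v Hv. apply Rle_trans with (1 := Cmod_minus_triangle _ (ebar t) _).
      rewrite E0, Hebar. lra. }
  assert (HDe : forall t, DR ebar t (- two_pi_i * ebar t)%C).
  { intros t. eapply DR_eq; [|apply (DR_comp Cinv circle); [apply D1_inv, circle_neq_0|apply DR_circle]].
    unfold ebar. field. apply circle_neq_0. }
  assert (L : J (fun t => psi (ebar t) * (- two_pi_i * ebar t))%C = RtoC 0).
  { apply (J_loop ebar (fun t => - two_pi_i * ebar t)%C
      (fun t => - two_pi_i * (- two_pi_i * ebar t))%C (fun v => seg psi 0 v) psi).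
    - intros t _. apply HDe.
    - intros t _. apply DR_scal, HDe.
    - intros t _. apply HP.
    - intros t _. apply Hpsi. rewrite Hebar. lra.
    - unfold ebar. now rewrite circle_loop. }
  assert (Cd : cont01 (fun t => / (RtoC rho * circle t - k))%C).
  { apply cont01_inv; [|intros; apply Hne].
    auto using cont01_minus, cont01_mult, cont01_const, cont01_circle. }
  (* The second summand is a constant multiple of the loop integral [L], hence integrates to 0. *)
  rewrite (J_ext _ (fun t => 1 + k * / (RtoC rho * circle t - k))%C).
  - rewrite J_plus, J_const, J_scal; auto using cont01_mult, cont01_const.
    assert (X : J (fun t => psi (ebar t) * (- two_pi_i * ebar t))%C
       = (- two_pi_i * RtoC rho * J (fun t => / (RtoC rho * circle t - k)))%C).
    { rewrite <- J_scal by exact Cd. apply J_ext. intros t _. unfold psi, ebar, kr.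
      assert (N1 := Hne t). assert (N2 := circle_neq_0 t). field.
      repeat split; auto. }
    rewrite L in X.
    assert (Y : J (fun t => / (RtoC rho * circle t - k))%C = RtoC 0).
    { apply NNPP. intros HN. revert X. apply not_eq_sym.
      apply Cmult_neq_0; [|exact HN]. apply Cmult_neq_0; [|exact Hrho].
      intros E. apply two_pi_i_neq_0. replace two_pi_i with (- (- two_pi_i))%C by ring.
      rewrite E. ring. }
    rewrite Y. ring.
  - intros t _. field. apply Hne.
Qed.

Lemma neq_minus_neq_0 (x y : C) : x <> y -> (x - y)%C <> RtoC 0.
Proof.
  intros H E. apply H. replace x with ((x - y) + y)%C by ring. rewrite E. ring.
Qed.

(** On the circle dzeta is [two_pi_i] times zeta dt, which explains the kernel zeta / (zeta - k) and
    the absence of a prefactor. The bounds on the radii keep the disc of radius [2 * rho] about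
    [z0 + k] in the domain and the circle well inside that disc. *)
Lemma cauchy_formula phi z0 rho k : 0 < rho ->
  (forall z, Cmod (z - z0) < 3 * rho -> exists l, D1 phi z l) -> Cmod k < rho / 2 ->
  J (fun t => phi (z0 + RtoC rho * circle t)
       * (RtoC rho * circle t / (RtoC rho * circle t - k)))%C = phi (z0 + k)%C.
Proof.
  intros Hr HD Hk.
  set (z := (z0 + k)%C).
  assert (Hz : (z - z0)%C = k) by (unfold z; ring).
  destruct (HD z) as [l Hl]; [rewrite Hz; lra|].
  (* The value [l] fills the removable singularity: [q] is continuous at [z] and differentiable
     elsewhere, which is what a primitive based at [z] needs. *)
  pose (q := fun w => if excluded_middle_informative (w = z) then l
    else ((phi w - phi z) / (w - z))%C).
  assert (Hq : forall w, w <> z -> q w = ((phi w - phi z) / (w - z))%C).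
  { intros w Hw. unfold q. now destruct (excluded_middle_informative (w = z)). }
  assert (HU : forall w, Cmod (w - z) <= 2 * rho -> Cmod (w - z0) < 3 * rho).
  { intros w Hw. apply Rle_lt_trans with (1 := Cmod_minus_triangle _ z _). rewrite Hz. lra. }
  assert (Hgt : forall w, w <> z -> 0 < Cmod (w - z)).
  { intros w Hw. now apply Cmod_gt_0, neq_minus_neq_0. }
  assert (HqD : forall w, Cmod (w - z) <= 2 * rho -> w <> z -> exists m, D1 q w m).
  { intros w Hw Hne. destruct (HD w (HU w Hw)) as [m Hm].
    destruct (D1_div (fun w => phi w - phi z)%C (fun w => w - z)%C w (m - 0)%C (1 - 0)%C)
      as [d Hd].
    - now apply neq_minus_neq_0.
    - apply D1_minus; [exact Hm|apply D1_const].
    - apply D1_minus; [apply D1_id|apply D1_const].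
    - exists d. revert Hd. apply D1_ext with (Cmod (w - z)); [now apply Hgt|].
      intros v Hv. symmetry. apply Hq. intros ->. rewrite Cmod_minus_sym in Hv. lra. }
  assert (Hqz : contC q z).
  { intros e He. destruct Hl as [_ Hl]. destruct (Hl (e / 2)) as [d [Hd P]]; [lra|].
    exists d; split; [exact Hd|]. intros w Hw.
    destruct (classic (w = z)) as [->|Hne]; [now rewrite Cmod_diag|].
    rewrite (Hq w Hne). unfold q. destruct (excluded_middle_informative (z = z)) as [_|N]; [|tauto].
    assert (Hn := neq_minus_neq_0 _ _ Hne).
    replace ((phi w - phi z) / (w - z) - l)%C with ((phi w - phi z - l * (w - z)) / (w - z))%C
      by (field; exact Hn).
    rewrite Cmod_div by exact Hn. specialize (P w Hw). unfold dist1 in P.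
    assert (G := Hgt w Hne).
    apply Rle_lt_trans with (e / 2); [|lra].
    apply Rmult_le_reg_r with (Cmod (w - z)); [exact G|].
    unfold Rdiv at 1. rewrite Rmult_assoc, Rinv_l, Rmult_1_r; lra. }
  assert (Hqc : forall w, Cmod (w - z) <= 2 * rho -> contC q w).
  { intros w Hw. destruct (classic (w = z)) as [->|Hne]; [exact Hqz|].
    destruct (HqD w Hw Hne) as [m Hm]. exact (D1_contC _ _ _ Hm). }
  pose (ga := fun t => (z0 + RtoC rho * circle t)%C).
  assert (Hga : forall t, (ga t - z)%C = (RtoC rho * circle t - k)%C)
    by (intros; unfold ga, z; ring).
  assert (Hgab : forall t, Cmod (ga t - z) <= 3 / 2 * rho).
  { intros t. rewrite Hga. unfold Cminus. apply Rle_trans with (1 := Cmod_triangle _ _).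
    rewrite Cmod_mult, Cmod_circle, Cmod_opp, Cmod_RtoC; lra. }
  assert (Hne : forall t, (RtoC rho * circle t - k)%C <> RtoC 0)
    by (intros; apply circle_minus_neq_0; lra).
  assert (Hgz : forall t, ga t <> z).
  { intros t E. apply (Hne t). rewrite <- Hga, E. ring. }
  assert (L : J (fun t => q (ga t) * (RtoC rho * (two_pi_i * circle t)))%C = RtoC 0).
  { apply (J_loop ga (fun t => RtoC rho * (two_pi_i * circle t))%C
      (fun t => RtoC rho * (two_pi_i * (two_pi_i * circle t)))%C (fun v => seg q z v) q).
    - intros t _. apply DR_plus_const, DR_scal, DR_circle.
    - intros t _. apply DR_scal, DR_scal, DR_circle.
    - intros t _. apply (D1_primitive (fun w => Cmod (w - z) <= 2 * rho)) with (rho / 2).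
      + apply convexC_disc.
      + apply closedC_disc.
      + rewrite Cmod_diag. lra.
      + exact Hqc.
      + exact HqD.
      + lra.
      + intros v Hv. apply Rle_trans with (1 := Cmod_minus_triangle _ (ga t) _).
        specialize (Hgab t). lra.
    - intros t _. apply HqD; [|apply Hgz]. specialize (Hgab t). lra.
    - unfold ga. now rewrite circle_loop. }
  assert (Cd : cont01 (fun t => RtoC rho * circle t / (RtoC rho * circle t - k))%C).
  { unfold Cdiv. apply cont01_mult.
    - auto using cont01_mult, cont01_const, cont01_circle.
    - apply cont01_inv; [|intros; apply Hne].
      auto using cont01_minus, cont01_mult, cont01_const, cont01_circle. }
  assert (Cp : cont01 (fun t => phi (ga t))).
  { apply (cont01_comp phi ga).
    - intros t _. destruct (HD (ga t)) as [m Hm].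
      + apply HU. specialize (Hgab t). lra.
      + exact (D1_contC _ _ _ Hm).
    - unfold ga. auto using cont01_plus, cont01_mult, cont01_const, cont01_circle. }
  (* Splitting [phi (ga t) - phi z] expresses the vanishing loop integral of [q] through the Cauchy
     integral and the winding number. *)
  assert (X : J (fun t => q (ga t) * (RtoC rho * (two_pi_i * circle t)))%C
    = (two_pi_i * (J (fun t => phi (ga t) * (RtoC rho * circle t / (RtoC rho * circle t - k)))
        - phi z * J (fun t => RtoC rho * circle t / (RtoC rho * circle t - k))))%C).
  { rewrite <- (J_scal (phi z)) by exact Cd.
    rewrite <- J_minus by auto using cont01_mult, cont01_const.
    rewrite <- J_scal by auto using cont01_minus, cont01_mult, cont01_const.
    apply J_ext. intros t _. rewrite (Hq _ (Hgz t)), Hga. field. apply Hne. }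
  rewrite L, winding_number in X by assumption.
  apply NNPP. intros HN. revert X. apply not_eq_sym. apply Cmult_neq_0; [apply two_pi_i_neq_0|].
  intros E. apply HN.
  assert (Z : forall x y : C, (x - y * 1)%C = RtoC 0 -> x = y).
  { intros x y H. replace x with ((x - y * 1) + y)%C by ring. rewrite H. ring. }
  exact (Z _ _ E).
Qed.

(** The kernel expands as zeta / (zeta - k) = 1 + k / zeta + k^2 / (zeta (zeta - k)), and the last
    term is bounded through |zeta - k| >= rho / 2. The constant depends only on [K] and [rho], so it
    is uniform over families with a common bound. *)
Lemma cauchy_taylor1 phi z0 rho l K k : 0 < rho ->
  (forall z, Cmod (z - z0) < 3 * rho -> exists l, D1 phi z l) -> D1 phi z0 l ->
  (forall z, Cmod (z - z0) < 3 * rho -> Cmod (phi z) <= K) -> Cmod k < rho / 2 ->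
  Cmod (phi (z0 + k)%C - phi z0 - l * k) <= 4 * K / (rho * rho) * (Cmod k * Cmod k) /\
  l = J (fun t => phi (z0 + RtoC rho * circle t) / (RtoC rho * circle t))%C.
Proof.
  intros Hr HD Hl HK Hk.
  set (ka := fun t => (RtoC rho * circle t)%C).
  assert (Hka0 : forall t, ka t <> RtoC 0).
  { intros t. apply Cmult_neq_0; [|apply circle_neq_0]. intros E. apply RtoC_inj in E. lra. }
  assert (Nka : forall t, Cmod (ka t) = rho).
  { intros t. unfold ka. rewrite Cmod_mult, Cmod_circle, Cmod_RtoC; lra. }
  assert (Hin : forall t, Cmod (z0 + ka t - z0) < 3 * rho).
  { intros t. replace (z0 + ka t - z0)%C with (ka t) by ring. rewrite Nka. lra. }
  assert (Cka : cont01 ka) by (unfold ka; auto using cont01_mult, cont01_const, cont01_circle).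
  assert (Cp : cont01 (fun t => phi (z0 + ka t)%C)).
  { apply (cont01_comp phi).
    - intros t _. destruct (HD _ (Hin t)) as [m Hm]. exact (D1_contC _ _ _ Hm).
    - auto using cont01_plus, cont01_const. }
  assert (Ci1 : cont01 (fun t => / ka t)%C) by (apply cont01_inv; auto).
  set (A0 := J (fun t => phi (z0 + ka t)%C)).
  set (A1 := J (fun t => phi (z0 + ka t) / ka t)%C).
  assert (Exp : forall k, Cmod k < rho / 2 ->
    Cmod (phi (z0 + k)%C - A0 - k * A1) <= 4 * K / (rho * rho) * (Cmod k * Cmod k)).
  { clear k Hk. intros k Hk.
    assert (Hne : forall t, (ka t - k)%C <> RtoC 0)
      by (intros; apply circle_minus_neq_0; lra).
    assert (Nne : forall t, rho / 2 <= Cmod (ka t - k)).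
    { intros t. assert (T := Cmod_triangle (ka t - k) k).
      replace (ka t - k + k)%C with (ka t) in T by ring. rewrite Nka in T. lra. }
    assert (Ci2 : cont01 (fun t => / (ka t - k))%C)
      by (apply cont01_inv; auto using cont01_minus, cont01_const).
    rewrite <- (cauchy_formula phi z0 rho k Hr HD Hk).
    unfold A0, A1. rewrite <- J_scal by (unfold Cdiv; auto using cont01_mult).
    fold ka.
    change (fun t => phi (z0 + RtoC rho * circle t)
       * (RtoC rho * circle t / (RtoC rho * circle t - k)))%C
      with (fun t => phi (z0 + ka t) * (ka t / (ka t - k)))%C.
    rewrite <- J_minus; [|unfold Cdiv; auto using cont01_mult|exact Cp].
    rewrite <- J_minus; [|apply cont01_minus; unfold Cdiv; auto using cont01_mult
                         |unfold Cdiv; auto using cont01_mult, cont01_const].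
    rewrite (J_ext _ (fun t => (k * k) * (phi (z0 + ka t) * (/ ka t * / (ka t - k))))%C).
    - rewrite J_scal by auto using cont01_mult.
      rewrite !Cmod_mult, (Rmult_comm _ (Cmod k * Cmod k)).
      apply Rmult_le_compat_l; [apply Rmult_le_pos; apply Cmod_ge_0|].
      replace (4 * K / (rho * rho)) with (2 * (K * (/ rho * / (rho / 2)))) by (field; lra).
      apply J_bound; [auto using cont01_mult|].
      intros t _. rewrite !Cmod_mult, !Cmod_inv, Nka by auto.
      apply Rmult_le_compat; [apply Cmod_ge_0| |now apply HK|].
      + apply Rmult_le_pos; left; apply Rinv_0_lt_compat; [lra|]. specialize (Nne t). lra.
      + apply Rmult_le_compat_l; [left; apply Rinv_0_lt_compat; lra|].
        apply Rinv_le_contravar; [lra|apply Nne].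
    - intros t _. field. split; auto. }
  assert (HK0 : 0 <= K).
  { apply Rle_trans with (2 := HK z0 ltac:(rewrite Cmod_diag; lra)). apply Cmod_ge_0. }
  set (M := 4 * K / (rho * rho)) in *.
  assert (HM : 0 <= M).
  { unfold M. apply Rmult_le_pos; [lra|]. left. apply Rinv_0_lt_compat. nra. }
  assert (E0 : phi z0 = A0).
  { apply Cmod_le_0_eq. specialize (Exp (RtoC 0)). rewrite Cmod_0 in Exp.
    replace (z0 + 0)%C with z0 in Exp by ring.
    replace (phi z0 - A0 - 0 * A1)%C with (phi z0 - A0)%C in Exp by ring.
    rewrite Rmult_0_l, Rmult_0_r in Exp. apply Exp. lra. }
  (* The expansion itself shows that the contour integral [A1] is a derivative at [z0]; uniqueness
     identifies it with [l]. *)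
  assert (HA1 : D1 phi z0 A1).
  { split.
    - exists (Cmod A1 + 1). split; [generalize (Cmod_ge_0 A1); lra|].
      intros v. rewrite Cmod_mult. unfold dist1. generalize (Cmod_ge_0 (v - z0)). nra.
    - intros e He. exists (Rmin (rho / 2) (e / (M + 1))). split.
      + apply Rmin_glb_lt; [lra|]. apply Rdiv_lt_0_compat; lra.
      + intros w Hw. unfold dist1 in *.
        assert (W1 := Rlt_le_trans _ _ _ Hw (Rmin_l _ _)).
        assert (W2 := Rlt_le_trans _ _ _ Hw (Rmin_r _ _)).
        specialize (Exp (w - z0)%C W1). rewrite <- E0 in Exp.
        replace (z0 + (w - z0))%C with w in Exp by ring.
        rewrite (Cmult_comm A1). apply Rle_trans with (1 := Exp).
        rewrite <- Rmult_assoc. apply Rmult_le_compat_r; [apply Cmod_ge_0|].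
        apply Rle_trans with ((M + 1) * (e / (M + 1))).
        * apply Rmult_le_compat; [exact HM|apply Cmod_ge_0|lra|lra].
        * right; field; lra. }
  assert (E1 : l = A1) by exact (D1_unique _ _ _ _ Hl HA1).
  split; [|exact E1]. rewrite E1, (Cmult_comm A1), E0. now apply Exp.
Qed.

(** * Holomorphic functions of two variables *)

Lemma D2_taylor1 h z rho lx ly K w : 0 < rho ->
  (forall v, dist2 z v < 3 * rho -> exists lx ly, D2 h v lx ly) -> D2 h z lx ly ->
  (forall v, dist2 z v < 3 * rho -> Cmod (h v) <= K) -> dist2 z w < rho / 2 ->
  Cmod (h w - h z - (lx * (fst w - fst z) + ly * (snd w - snd z)))
    <= 4 * K / (rho * rho) * (dist2 z w * dist2 z w).
Proof.
  intros Hr HD Hl HK Hw. set (d := dist2 z w) in *.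
  assert (Hd := dist2_ge_0 z w). fold d in Hd.
  destruct (Req_dec d 0) as [Hd0|Hd0].
  - assert (E : w = z).
    { unfold d, dist2 in Hd0.
      generalize (Cmod_ge_0 (fst w - fst z)) (Cmod_ge_0 (snd w - snd z)). intros A B.
      destruct w, z. f_equal; apply Cmod_le_0_eq; simpl in *; lra. }
    rewrite E, Hd0.
    replace (h z - h z - (lx * (fst z - fst z) + ly * (snd z - snd z)))%C with (RtoC 0) by ring.
    rewrite Cmod_0, !Rmult_0_r. lra.
  - assert (Hdc : RtoC d <> RtoC 0) by (intros E; apply RtoC_inj in E; lra).
    (* The direction from [z] to [w] is normalised for [dist2], so [t] is exactly the distance
       scale: discs about 0 correspond to balls of the same radius, and [w] to [t = d]. *)
    set (v := ((fst w - fst z) / RtoC d, (snd w - snd z) / RtoC d)%C).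
    pose (line := fun t : C => (fst z + t * fst v, snd z + t * snd v)%C).
    assert (Hline : forall t, dist2 z (line t) = Cmod t).
    { intros t. unfold dist2, line, v; simpl.
      replace (fst z + t * ((fst w - fst z) / d) - fst z)%C with (t * ((fst w - fst z) / d))%C by ring.
      replace (snd z + t * ((snd w - snd z) / d) - snd z)%C with (t * ((snd w - snd z) / d))%C by ring.
      rewrite !Cmod_mult, !Cmod_div, Cmod_RtoC by (auto; lra).
      replace (Cmod t * (Cmod (fst w - fst z) / d) + Cmod t * (Cmod (snd w - snd z) / d))
        with (Cmod t * ((Cmod (fst w - fst z) + Cmod (snd w - snd z)) / d)) by (field; lra).
      change (Cmod (fst w - fst z) + Cmod (snd w - snd z)) with d. field. lra. }
    assert (Hline0 : line 0 = z).
    { unfold line. destruct z; simpl. f_equal; ring. }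
    assert (Hlined : line (RtoC d) = w).
    { unfold line, v. destruct w, z; simpl. f_equal; field; exact Hdc. }
    destruct (cauchy_taylor1 (fun t => h (line t)) 0 rho (lx * fst v + ly * snd v)%C K (RtoC d))
      as [T _].
    + exact Hr.
    + intros t Ht. destruct (HD (line t)) as [mx [my Hm]].
      * rewrite Hline. replace t with (t - 0)%C by ring. exact Ht.
      * exists (mx * fst v + my * snd v)%C. now apply D2_line.
    + apply D2_line. fold (line 0). now rewrite Hline0.
    + intros t Ht. apply HK. rewrite Hline. replace t with (t - 0)%C by ring. exact Ht.
    + rewrite Cmod_RtoC; lra.
    + replace (0 + d)%C with (RtoC d) in T by ring.
      rewrite Hline0, Hlined, Cmod_RtoC in T by lra.
      replace (lx * (fst w - fst z) + ly * (snd w - snd z))%C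
        with ((lx * fst v + ly * snd v) * d)%C; [exact T|].
      unfold v; simpl. field. exact Hdc.
Qed.

Lemma D2_of_quadratic h z lx ly M r : 0 < r ->
  (forall w, dist2 z w < r ->
    Cmod (h w - h z - (lx * (fst w - fst z) + ly * (snd w - snd z)))
      <= M * (dist2 z w * dist2 z w)) -> D2 h z lx ly.
Proof.
  intros Hr HM. split.
  - exists (Cmod lx + Cmod ly + 1).
    assert (A := Cmod_ge_0 lx). assert (B := Cmod_ge_0 ly).
    split; [lra|]. intros w. apply Rle_trans with (1 := Cmod_triangle _ _).
    rewrite !Cmod_mult. unfold dist2.
    assert (A' := Cmod_ge_0 (fst w - fst z)). assert (B' := Cmod_ge_0 (snd w - snd z)). nra.
  - intros e He. set (N := Rabs M + 1).
    assert (HN : 0 < N) by (unfold N; generalize (Rabs_pos M); lra).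
    exists (Rmin r (e / N)). split; [apply Rmin_glb_lt; [exact Hr|now apply Rdiv_lt_0_compat]|].
    intros w Hw.
    apply Rle_trans with (1 := HM w (Rlt_le_trans _ _ _ Hw (Rmin_l _ _))).
    assert (W := Rlt_le_trans _ _ _ Hw (Rmin_r _ _)).
    assert (P := dist2_ge_0 z w). rewrite <- Rmult_assoc.
    apply Rmult_le_compat_r; [exact P|].
    apply Rle_trans with (N * dist2 z w).
    + apply Rmult_le_compat_r; [exact P|]. unfold N. generalize (Rle_abs M). lra.
    + replace e with (N * (e / N)) by (field; lra). apply Rmult_le_compat_l; lra.
Qed.

(** Used for derivatives of an integrand as functions of the parameter: they are uniform limits of
    difference quotients. *)
Lemma cont01_uniform_limit f :
  (forall eps, 0 < eps -> exists g, cont01 g /\ forall t, 0 <= t <= 1 -> Cmod (g t - f t) <= eps) ->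
  cont01 f.
Proof.
  intros H t Ht e He. destruct (H (e / 4)) as [g [Hg Hgf]]; [lra|].
  destruct (Hg t Ht (e / 2)) as [d [Hd P]]; [lra|].
  exists d; split; [exact Hd|]. intros s Hs Hst.
  specialize (P s Hs Hst). assert (A := Hgf s Hs). assert (B := Hgf t Ht).
  rewrite Cmod_minus_sym in A.
  replace (f s - f t)%C with ((f s - g s) + (g s - g t) + (g t - f t))%C by ring.
  apply Rle_lt_trans with (1 := Cmod_triangle3 _ _ _). lra.
Qed.

(** A common bound [K] gives one Taylor constant for all [t]. It makes the derivatives continuous in
    [t], hence integrable, and integrating the Taylor estimate then shows that their integrals are
    the derivatives. *)
Lemma D2_param_integral (H : R -> C * C -> C) z rho K : 0 < rho ->
  (forall t w, 0 <= t <= 1 -> dist2 z w < 3 * rho -> exists lx ly, D2 (H t) w lx ly) ->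
  (forall t w, 0 <= t <= 1 -> dist2 z w < 3 * rho -> Cmod (H t w) <= K) ->
  (forall w, dist2 z w < 3 * rho -> cont01 (fun t => H t w)) ->
  exists lx ly, D2 (fun w => J (fun t => H t w)) z lx ly.
Proof.
  intros Hr HD HK Hc.
  pose (Lx := fun t => partial_x (H t) z). pose (Ly := fun t => partial_y (H t) z).
  assert (Hz : dist2 z z < 3 * rho) by (rewrite dist2_diag; lra).
  assert (HL : forall t, 0 <= t <= 1 -> D2 (H t) z (Lx t) (Ly t)).
  { intros t Ht. destruct (HD t z Ht Hz) as [lx [ly Hl]]. unfold Lx, Ly.
    now rewrite (D2_partial_x _ _ _ _ Hl), (D2_partial_y _ _ _ _ Hl). }
  set (M := 4 * K / (rho * rho)).
  assert (HT : forall t w, 0 <= t <= 1 -> dist2 z w < rho / 2 ->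
    Cmod (H t w - H t z - (Lx t * (fst w - fst z) + Ly t * (snd w - snd z)))
      <= M * (dist2 z w * dist2 z w)).
  { intros t w Ht Hw. apply D2_taylor1; auto. }
  assert (HM : 0 <= M).
  { assert (0 <= K).
    { apply Rle_trans with (2 := HK 0 z ltac:(lra) Hz). apply Cmod_ge_0. }
    unfold M. apply Rmult_le_pos; [lra|]. left. apply Rinv_0_lt_compat. nra. }
  (* Both partial derivatives at once: [step eta] is the point at distance [eta] from [z] in the
     coordinate direction to which [L] belongs. *)
  assert (Hlim : forall (L : R -> C) (step : R -> C * C),
    (forall eta, 0 < eta -> dist2 z (step eta) = eta) ->
    (forall t eta, (Lx t * (fst (step eta) - fst z) + Ly t * (snd (step eta) - snd z)
       = L t * RtoC eta)%C) -> cont01 L).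
  { intros L step Hs HLs. apply cont01_uniform_limit. intros e He.
    (* The first bound stays within the range of the Taylor estimate, the second makes the error
       [M * eta] of the difference quotient at most [e]. *)
    set (eta := Rmin (rho / 4) (e / (M + 1))).
    assert (He0 : 0 < eta) by (apply Rmin_glb_lt; [lra|apply Rdiv_lt_0_compat; lra]).
    assert (He1 : eta <= rho / 4) by apply Rmin_l.
    assert (He2 : eta <= e / (M + 1)) by apply Rmin_r.
    assert (Hn : RtoC eta <> RtoC 0) by (intros E; apply RtoC_inj in E; lra).
    exists (fun t => / RtoC eta * (H t (step eta) - H t z))%C. split.
    - apply cont01_mult; [apply cont01_const|].
      apply cont01_minus; apply Hc; [rewrite Hs; lra|exact Hz].
    - intros t Ht. specialize (HT t (step eta) Ht). rewrite Hs, HLs in HT by exact He0.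
      replace (/ eta * (H t (step eta) - H t z) - L t)%C
        with (/ eta * (H t (step eta) - H t z - L t * eta))%C by (field; exact Hn).
      rewrite Cmod_mult, Cmod_inv, Cmod_RtoC by (auto; lra).
      apply Rle_trans with (/ eta * (M * (eta * eta))).
      + apply Rmult_le_compat_l; [left; now apply Rinv_0_lt_compat|]. apply HT. lra.
      + replace (/ eta * (M * (eta * eta))) with (M * eta) by (field; lra).
        apply Rle_trans with ((M + 1) * (e / (M + 1))).
        * apply Rmult_le_compat; lra.
        * right; field; lra. }
  assert (CLx : cont01 Lx).
  { apply (Hlim Lx (fun eta => (fst z + RtoC eta, snd z)%C)).
    - intros eta He. unfold dist2; simpl. rewrite Cmod_diag.
      replace (fst z + eta - fst z)%C with (RtoC eta) by ring. rewrite Cmod_RtoC; lra.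
    - intros t eta. simpl. ring. }
  assert (CLy : cont01 Ly).
  { apply (Hlim Ly (fun eta => (fst z, snd z + RtoC eta)%C)).
    - intros eta He. unfold dist2; simpl. rewrite Cmod_diag.
      replace (snd z + eta - snd z)%C with (RtoC eta) by ring. rewrite Cmod_RtoC; lra.
    - intros t eta. simpl. ring. }
  exists (J Lx), (J Ly). apply D2_of_quadratic with (2 * M) (rho / 2); [lra|].
  intros w Hw.
  assert (C1 : cont01 (fun t => H t w)) by (apply Hc; lra).
  assert (C2 := Hc z Hz).
  rewrite (Cmult_comm (J Lx)), (Cmult_comm (J Ly)).
  rewrite <- (J_scal (fst w - fst z)%C) by exact CLx.
  rewrite <- (J_scal (snd w - snd z)%C) by exact CLy.
  rewrite <- J_plus by auto using cont01_mult, cont01_const.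
  rewrite <- J_minus by assumption.
  rewrite <- J_minus by auto using cont01_minus, cont01_plus, cont01_mult, cont01_const.
  rewrite Rmult_assoc. apply J_bound.
  - auto using cont01_minus, cont01_plus, cont01_mult, cont01_const.
  - intros t Ht. rewrite (Cmult_comm (fst w - fst z)), (Cmult_comm (snd w - snd z)).
    now apply HT.
Qed.

Lemma dist2_triangle x y z : dist2 x z <= dist2 x y + dist2 y z.
Proof.
  unfold dist2. assert (A := Cmod_minus_triangle (fst z) (fst y) (fst x)).
  assert (B := Cmod_minus_triangle (snd z) (snd y) (snd x)). lra.
Qed.

Lemma D2_translate h z v lx ly : D2 h (fst z + fst v, snd z + snd v)%C lx ly ->
  D2 (fun w => h (fst w + fst v, snd w + snd v)%C) z lx ly.
Proof.
  apply (D2_precomp h (fun w => (fst w + fst v, snd w + snd v)%C) 1); [lra| |].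
  - intros w. right. unfold dist2; simpl.
    replace (fst w + fst v - (fst z + fst v))%C with (fst w - fst z)%C by ring.
    replace (snd w + snd v - (snd z + snd v))%C with (snd w - snd z)%C by ring. ring.
  - intros w. simpl. ring.
Qed.

(** * Holomorphy on sets and stability under partial derivatives *)

Definition hol (U : C * C -> Prop) (h : C * C -> C) : Prop :=
  forall z, U z -> exists lx ly, D2 h z lx ly.

Definition open2 (U : C * C -> Prop) : Prop :=
  forall z, U z -> exists r, 0 < r /\ forall w, dist2 z w < r -> U w.

Lemma hol_D2 U h z : hol U h -> U z -> D2 h z (partial_x h z) (partial_y h z).
Proof.
  intros Hh Hz. destruct (Hh z Hz) as [lx [ly Hl]].
  now rewrite (D2_partial_x _ _ _ _ Hl), (D2_partial_y _ _ _ _ Hl).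
Qed.

(** Cauchy's integral for the derivative expresses [partial_x h] near [z] as an integral of
    translates of [h], to which differentiation under the integral applies. *)
Lemma hol_partial_x U h : open2 U -> hol U h -> hol U (partial_x h).
Proof.
  intros HU Hh z Hz. destruct (HU z Hz) as [r0 [Hr0 HB]].
  destruct (Hh z Hz) as [lz [mz Hhz]].
  destruct (D2_continuous _ _ _ _ Hhz 1) as [r1 [Hr1 H1]]; [lra|].
  (* Both the parametric integral and Cauchy's formula ask for a margin of [3 * rho]; together they
     stay inside [8 * rho]. *)
  set (K := Cmod (h z) + 1). set (rho := Rmin r0 r1 / 8).
  assert (Hrho : 0 < rho) by (unfold rho; apply Rdiv_lt_0_compat; [now apply Rmin_glb_lt|lra]).
  assert (HhD : forall w, dist2 z w < 8 * rho -> exists lx ly, D2 h w lx ly).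
  { intros w Hw. apply Hh, HB. unfold rho in Hw. generalize (Rmin_l r0 r1). lra. }
  assert (HhK : forall w, dist2 z w < 8 * rho -> Cmod (h w) <= K).
  { intros w Hw. assert (Q : dist2 z w < r1) by (unfold rho in Hw; generalize (Rmin_r r0 r1); lra).
    specialize (H1 w Q). replace (h w) with ((h w - h z) + h z)%C by ring.
    apply Rle_trans with (1 := Cmod_triangle _ _). unfold K. lra. }
  pose (ka := fun t => (RtoC rho * circle t)%C).
  assert (Nka : forall t, Cmod (ka t) = rho).
  { intros t. unfold ka. rewrite Cmod_mult, Cmod_circle, Cmod_RtoC; lra. }
  assert (Hka0 : forall t, ka t <> RtoC 0).
  { intros t. apply Cmod_gt_0. rewrite Nka. exact Hrho. }
  assert (Cka : cont01 ka) by (unfold ka; auto using cont01_mult, cont01_const, cont01_circle).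
  assert (Hin : forall u w, Cmod u < 3 * rho -> dist2 z w < 3 * rho ->
    dist2 z (fst w + u, snd w)%C < 8 * rho).
  { intros u w Hu Hw. apply Rle_lt_trans with (1 := dist2_triangle _ w _).
    unfold dist2 at 2; simpl. rewrite Cmod_diag.
    replace (fst w + u - fst w)%C with u by ring. lra. }
  pose (H := fun t (w : C * C) => (/ ka t * h (fst w + ka t, snd w))%C).
  destruct (D2_param_integral H z rho (/ rho * K)) as [lx [ly HD]].
  - exact Hrho.
  - intros t w Ht Hw. destruct (HhD (fst w + ka t, snd w)%C) as [lx [ly Hl]].
    + apply Hin; [rewrite Nka; lra|exact Hw].
    + do 2 eexists. unfold H. apply D2_mult; [apply D2_const|].
      apply D2_ext with (fun w => h (fst w + fst (ka t, RtoC 0), snd w + snd (ka t, RtoC 0))%C) 1.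
      * lra.
      * intros v _. simpl. f_equal. f_equal. ring.
      * apply D2_translate. simpl. replace (snd w + 0)%C with (snd w) by ring. exact Hl.
  - intros t w Ht Hw. unfold H. rewrite Cmod_mult, Cmod_inv, Nka by auto.
    apply Rmult_le_compat_l; [left; now apply Rinv_0_lt_compat|].
    apply HhK, Hin; [rewrite Nka; lra|exact Hw].
  - intros w Hw. unfold H. apply cont01_mult; [now apply cont01_inv|].
    apply (cont01_comp2 h (fun t => fst w + ka t)%C (fun _ => snd w));
      auto using cont01_plus, cont01_const.
    intros t Ht. apply HhD, Hin; [rewrite Nka; lra|exact Hw].
  - exists lx, ly. revert HD. apply D2_ext with (3 * rho); [lra|].
    intros w Hw. destruct (HhD w) as [mx [my Hm]]; [lra|].
    rewrite (D2_partial_x _ _ _ _ Hm).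
    (* The displacement is 0 because only the integral formula for the derivative is wanted. *)
    destruct (cauchy_taylor1 (fun x => h (x, snd w)) (fst w) rho mx K 0) as [_ E].
    + exact Hrho.
    + intros x Hx. destruct (HhD (x, snd w)) as [nx [ny Hn]].
      * replace x with (fst w + (x - fst w))%C by ring. now apply Hin.
      * exists nx. exact (D2_D1_x _ _ _ _ _ Hn).
    + apply (D2_D1_x h (fst w) (snd w) mx my). now destruct w.
    + intros x Hx. apply HhK. replace x with (fst w + (x - fst w))%C by ring. now apply Hin.
    + rewrite Cmod_0. lra.
    + rewrite E. apply J_ext. intros t _. unfold H. fold (ka t). unfold Cdiv. ring.
Qed.

Lemma swap_swap z : swap (swap z) = z.
Proof. now destruct z. Qed.

Lemma hol_swap U h : hol U h -> hol (fun z => U (swap z)) (fun z => h (swap z)).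
Proof.
  intros H z Hz. destruct (H _ Hz) as [lx [ly Hl]]. exists ly, lx. now apply D2_swap.
Qed.

Lemma open2_swap U : open2 U -> open2 (fun z => U (swap z)).
Proof.
  intros H z Hz. destruct (H _ Hz) as [r [Hr P]]. exists r; split; [exact Hr|].
  intros w Hw. apply P. now rewrite dist2_swap.
Qed.

Lemma partial_x_swap h z : partial_x (fun w => h (swap w)) z = partial_y h (swap z).
Proof. reflexivity. Qed.

Lemma hol_partial_y U h : open2 U -> hol U h -> hol U (partial_y h).
Proof.
  intros HU Hh.
  assert (X := hol_partial_x _ _ (open2_swap U HU) (hol_swap U h Hh)).
  apply hol_swap in X. intros z Hz.
  destruct (X z) as [lx [ly Hl]]; [now rewrite swap_swap|].
  exists lx, ly. revert Hl. apply D2_ext with 1; [lra|]. intros w _.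
  now rewrite partial_x_swap, swap_swap.
Qed.

Lemma hol_const U c : hol U (fun _ => c).
Proof. intros z _. do 2 eexists. apply D2_const. Qed.

Lemma hol_plus U h k : hol U h -> hol U k -> hol U (fun z => h z + k z)%C.
Proof.
  intros Hh Hk z Hz. do 2 eexists. exact (D2_plus _ _ _ _ _ _ _ (hol_D2 _ _ _ Hh Hz) (hol_D2 _ _ _ Hk Hz)).
Qed.

Lemma hol_mult U h k : hol U h -> hol U k -> hol U (fun z => h z * k z)%C.
Proof.
  intros Hh Hk z Hz. do 2 eexists. exact (D2_mult _ _ _ _ _ _ _ (hol_D2 _ _ _ Hh Hz) (hol_D2 _ _ _ Hk Hz)).
Qed.

Lemma hol_minus U h k : hol U h -> hol U k -> hol U (fun z => h z - k z)%C.
Proof.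
  intros Hh Hk z Hz.
  destruct (hol_plus U h (fun z => - (1) * k z)%C Hh (hol_mult _ _ _ (hol_const _ _) Hk) z Hz)
    as [lx [ly Hl]].
  exists lx, ly. revert Hl. apply D2_ext with 1; [lra|]. intros w _. ring.
Qed.

Lemma hol_freeze_x (U : C * C -> Prop) x0 h : (forall z, U z -> U (x0, snd z)) -> hol U h ->
  hol U (fun z => h (x0, snd z)).
Proof.
  intros HU Hh z Hz. destruct (Hh _ (HU z Hz)) as [lx [ly Hl]].
  exists (RtoC 0), ly. exact (D2_freeze_x _ _ _ _ _ Hl).
Qed.

Lemma hol_subset (U V : C * C -> Prop) h : (forall z, V z -> U z) -> hol U h -> hol V h.
Proof. intros H Hh z Hz. auto. Qed.

(** * Primitives and linear equations on a polydisc *)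

Lemma open2_polydisc a b r s : open2 (polydisc a b r s).
Proof.
  intros z [H1 H2].
  exists (Rmin (r - Cmod (fst z - a)) (s - Cmod (snd z - b))).
  split; [apply Rmin_glb_lt; lra|]. intros w Hw.
  assert (W1 := Rlt_le_trans _ _ _ Hw (Rmin_l _ _)).
  assert (W2 := Rlt_le_trans _ _ _ Hw (Rmin_r _ _)).
  unfold dist2 in W1, W2.
  assert (A := Cmod_ge_0 (fst w - fst z)). assert (B := Cmod_ge_0 (snd w - snd z)).
  split.
  - apply Rle_lt_trans with (1 := Cmod_minus_triangle _ (fst z) _). lra.
  - apply Rle_lt_trans with (1 := Cmod_minus_triangle _ (snd z) _). lra.
Qed.

Lemma polydisc_convex_x a b r s x0 x y t : 0 <= t <= 1 -> Cmod (x0 - a) < r ->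
  polydisc a b r s (x, y) -> polydisc a b r s (x0 + RtoC t * (x - x0), y)%C.
Proof.
  intros Ht Hx0 [H1 H2]. simpl in H1, H2. split; simpl; [|exact H2].
  apply Rle_lt_trans with (Rmax (Cmod (x0 - a)) (Cmod (x - a))).
  - apply Cmod_convex; [exact Ht|apply Rmax_l|apply Rmax_r].
  - now apply Rmax_lub_lt.
Qed.

(* The gauge at [u] is taken below the inverse of a bound of [h] near [u], so that the
   uniform lower bound [d] of the gauges used yields the uniform bound [/ d] of [h]. *)
Lemma hol_bounded_near_segment a b r s h x0 z : hol (polydisc a b r s) h ->
  Cmod (x0 - a) < r -> polydisc a b r s z ->
  exists d K, 0 < d /\ forall t w, 0 <= t <= 1 -> dist2 z w < d ->
    polydisc a b r s w /\ Cmod (h (x0 + RtoC t * (fst w - x0), snd w)%C) <= K.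
Proof.
  intros Hh Hx0 Hz. destruct (open2_polydisc _ _ _ _ z Hz) as [r0 [Hr0 HB]].
  pose (pt := fun u => (x0 + RtoC u * (fst z - x0), snd z)%C).
  assert (Hpt : forall u, 0 <= u <= 1 -> polydisc a b r s (pt u)).
  { intros u Hu. destruct z. now apply polydisc_convex_x. }
  set (D := Cmod (fst z - x0)). assert (HD : 0 <= D) by apply Cmod_ge_0.
  (* The factor [D + 1] accounts for two moves: changing the parameter by less than the gauge costs
     at most [D] times the gauge, and replacing [z] by [w] costs less than the gauge. *)
  assert (Hgauge : forall u, exists del : posreal, 0 <= u <= 1 ->
    forall w, dist2 (pt u) w < del * (D + 1) -> Cmod (h w) <= / del).
  { intros u. destruct (classic (0 <= u <= 1)) as [Hu|Hu].
    - destruct (Hh _ (Hpt u Hu)) as [lx [ly Hl]].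
      destruct (D2_continuous _ _ _ _ Hl 1) as [d1 [Hd1 P]]; [lra|].
      set (B := Cmod (h (pt u)) + 1).
      assert (HB0 : 0 < B) by (unfold B; generalize (Cmod_ge_0 (h (pt u))); lra).
      assert (Hdel : 0 < Rmin (d1 / (D + 1)) (/ B)).
      { apply Rmin_glb_lt; [apply Rdiv_lt_0_compat; lra|now apply Rinv_0_lt_compat]. }
      exists (mkposreal _ Hdel). intros _ w Hw. simpl in *.
      assert (Q : dist2 (pt u) w < d1).
      { apply Rlt_le_trans with (1 := Hw).
        replace d1 with (d1 / (D + 1) * (D + 1)) at 2 by (field; lra).
        apply Rmult_le_compat_r; [lra|apply Rmin_l]. }
      apply Rle_trans with B.
      + specialize (P w Q). replace (h w) with ((h w - h (pt u)) + h (pt u))%C by ring.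
        apply Rle_trans with (1 := Cmod_triangle _ _). unfold B. lra.
      + rewrite <- (Rinv_inv B) at 1. apply Rinv_le_contravar; [exact Hdel|apply Rmin_r].
    - exists (mkposreal 1 Rlt_0_1). intros Hu'. contradiction. }
  pose (gauge := fun u => proj1_sig (constructive_indefinite_description _ (Hgauge u))).
  assert (Hg : forall u, 0 <= u <= 1 ->
    forall w, dist2 (pt u) w < gauge u * (D + 1) -> Cmod (h w) <= / gauge u).
  { intros u. unfold gauge.
    destruct (constructive_indefinite_description _ (Hgauge u)) as [del Hdel]. exact Hdel. }
  destruct (compactness_value_1d 0 1 gauge) as [[d Hd] P]. simpl in P.
  exists (Rmin r0 d), (/ d). split; [now apply Rmin_glb_lt|].
  intros t w Ht Hw.
  assert (W1 := Rlt_le_trans _ _ _ Hw (Rmin_l _ _)).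
  assert (W2 := Rlt_le_trans _ _ _ Hw (Rmin_r _ _)).
  split; [now apply HB|].
  (* The compactness theorem yields its tag point only under a double negation. *)
  destruct (NNPP _ (P t Ht)) as [u [Hu [Htu Hdu]]].
  apply Rle_trans with (/ gauge u).
  - apply (Hg u Hu). unfold dist2, pt in *; simpl.
    replace (x0 + t * (fst w - x0) - (x0 + u * (fst z - x0)))%C
      with (RtoC t * (fst w - fst z) + RtoC (t - u) * (fst z - x0))%C by (rewrite RtoC_minus; ring).
    assert (T := Cmod_triangle (RtoC t * (fst w - fst z)) (RtoC (t - u) * (fst z - x0))).
    rewrite !Cmod_mult, Cmod_RtoC, Cmod_R in T by lra. fold D in T.
    assert (A := Cmod_ge_0 (fst w - fst z)).
    assert (t * Cmod (fst w - fst z) <= 1 * Cmod (fst w - fst z)) by (apply Rmult_le_compat_r; lra).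
    assert (Rabs (t - u) * D <= gauge u * D) by (apply Rmult_le_compat_r; lra).
    lra.
  - apply Rinv_le_contravar; [exact Hd|exact Hdu].
Qed.

(** The primitive integrates along the horizontal segment from (x0, y) to (x, y). Differentiation
    under the integral gives joint differentiability with an unidentified x-derivative, which the
    one-variable primitive on the slice then shows to be [h]. *)
Lemma primitive_x a b r s h x0 : hol (polydisc a b r s) h -> Cmod (x0 - a) < r ->
  exists I, (forall z, polydisc a b r s z -> exists ly, D2 I z (h z) ly) /\
    forall y, I (x0, y) = RtoC 0.
Proof.
  intros Hh Hx0.
  exists (fun z => seg (fun x => h (x, snd z)) x0 (fst z)). split.
  - intros z Hz.
    assert (Hex : exists lx ly, D2 (fun z => seg (fun x => h (x, snd z)) x0 (fst z)) z lx ly).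
    { destruct (hol_bounded_near_segment a b r s h x0 z Hh Hx0 Hz) as [d [K [Hd P]]].
      destruct (D2_param_integral
        (fun t w => h (x0 + RtoC t * (fst w - x0), snd w)%C) z (d / 3) K) as [lx [ly Hl]].
      - lra.
      - intros t w Ht Hw. destruct (P t w Ht) as [Hw' _]; [lra|].
        destruct (Hh (x0 + RtoC t * (fst w - x0), snd w)%C) as [lx [ly Hl]].
        + destruct w. now apply polydisc_convex_x.
        + exists (RtoC t * lx)%C, ly.
          apply (D2_precomp h (fun w => (x0 + RtoC t * (fst w - x0), snd w)%C) 1 w lx ly);
            [lra| | |exact Hl].
          * intros v. unfold dist2; simpl.
            replace (x0 + t * (fst v - x0) - (x0 + t * (fst w - x0)))%C
              with (RtoC t * (fst v - fst w))%C by ring.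
            rewrite Cmod_mult, Cmod_RtoC by lra. generalize (Cmod_ge_0 (fst v - fst w)). nra.
          * intros v. simpl. ring.
      - intros t w Ht Hw. apply P; [exact Ht|lra].
      - intros w Hw.
        apply (cont01_comp2 h (fun t => x0 + RtoC t * (fst w - x0))%C (fun _ => snd w)).
        + intros t Ht. apply Hh. destruct (P t w Ht) as [Hw' _]; [lra|].
          destruct w. now apply polydisc_convex_x.
        + apply cont01_line.
        + apply cont01_const.
      - do 2 eexists. unfold seg. apply D2_mult; [|exact Hl].
        apply D2_ext with (fun w => fst w + - x0)%C 1; [lra| |].
        + intros w _. ring.
        + apply D2_plus; [|apply D2_const].
          split.
          * exists 1. split; [lra|]. intros w.
            instantiate (1 := RtoC 0). instantiate (1 := RtoC 1).
            replace (1 * (fst w - fst z) + 0 * (snd w - snd z))%C with (fst w - fst z)%C by ring.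
            unfold dist2. generalize (Cmod_ge_0 (snd w - snd z)). lra.
          * intros e He. exists 1. split; [lra|]. intros w _.
            replace (fst w - fst z - (1 * (fst w - fst z) + 0 * (snd w - snd z)))%C
              with (RtoC 0) by ring.
            rewrite Cmod_0. apply Rmult_le_pos; [lra|apply dist2_ge_0]. }
    destruct Hex as [lx [ly Hl]]. exists ly.
    replace (h z) with lx; [exact Hl|].
    destruct z as [x y]. destruct Hz as [Hx Hy]. simpl in Hx, Hy.
    apply D2_D1_x in Hl. simpl in Hl. apply (D1_unique _ _ _ _ Hl).
    (* [D1_primitive] works on closed sets: this radius gives a closed disc inside the open one that
       contains [x0] and a neighbourhood of [x]. *)
    set (r' := (Rmax (Cmod (x - a)) (Cmod (x0 - a)) + r) / 2).
    assert (Hm : Rmax (Cmod (x - a)) (Cmod (x0 - a)) < r) by now apply Rmax_lub_lt.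
    assert (M1 := Rmax_l (Cmod (x - a)) (Cmod (x0 - a))).
    assert (M2 := Rmax_r (Cmod (x - a)) (Cmod (x0 - a))).
    assert (HD : forall v, Cmod (v - a) <= r' -> exists l, D1 (fun x => h (x, y)) v l).
    { intros v Hv. destruct (Hh (v, y)) as [mx [my Hm']].
      - split; simpl; [|exact Hy]. unfold r' in Hv. lra.
      - exists mx. exact (D2_D1_x _ _ _ _ _ Hm'). }
    apply (D1_primitive (fun v => Cmod (v - a) <= r') (fun x => h (x, y))) with (r' - Cmod (x - a)).
    + apply convexC_disc.
    + apply closedC_disc.
    + unfold r'. lra.
    + intros v Hv. destruct (HD v Hv) as [l Hl']. exact (D1_contC _ _ _ Hl').
    + intros v Hv _. auto.
    + unfold r'. lra.
    + intros v Hv. apply Rle_trans with (1 := Cmod_minus_triangle _ x _). lra.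
  - intros y. unfold seg. simpl. replace (x0 - x0)%C with (RtoC 0) by ring. ring.
Qed.

Lemma polydisc_swap a b r s z : polydisc b a s r (swap z) <-> polydisc a b r s z.
Proof. unfold polydisc, swap; simpl. tauto. Qed.

Lemma primitive_y a b r s h y0 : hol (polydisc a b r s) h -> Cmod (y0 - b) < s ->
  exists I, (forall z, polydisc a b r s z -> exists lx, D2 I z lx (h z)) /\
    forall x, I (x, y0) = RtoC 0.
Proof.
  intros Hh Hy0.
  destruct (primitive_x b a s r (fun z => h (swap z)) y0) as [I [HI HI0]]; [|exact Hy0|].
  - intros z Hz. apply (hol_swap _ _ Hh). now apply polydisc_swap.
  - exists (fun z => I (swap z)). split.
    + intros z Hz. destruct (HI (swap z)) as [ly Hl]; [now apply polydisc_swap|].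
      rewrite swap_swap in Hl. exists ly. now apply D2_swap.
    + intros x. apply HI0.
Qed.

(** * The complex exponential and linear equations *)

Definition cexp (z : C) : C := (exp (Re z) * cos (Im z), exp (Re z) * sin (Im z)).

Lemma cexp_plus z w : cexp (z + w) = (cexp z * cexp w)%C.
Proof.
  unfold cexp. destruct z as [a b], w as [c d]. simpl.
  rewrite exp_plus, cos_plus, sin_plus.
  apply injective_projections; simpl; ring.
Qed.

Lemma cexp_0 : cexp 0 = RtoC 1.
Proof.
  unfold cexp; simpl. rewrite exp_0, cos_0, sin_0. apply injective_projections; simpl; ring.
Qed.

Lemma Cmod_cexp z : Cmod (cexp z) = exp (Re z).
Proof.
  unfold cexp.
  replace (exp (Re z) * cos (Im z), exp (Re z) * sin (Im z))
    with (RtoC (exp (Re z)) * (cos (Im z), sin (Im z)))%C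
    by (apply injective_projections; simpl; ring).
  rewrite Cmod_mult, Cmod_RtoC by (left; apply exp_pos).
  replace (Cmod (cos (Im z), sin (Im z))) with 1; [ring|].
  transitivity (sqrt 1); [symmetry; apply sqrt_1|]. unfold Cmod; simpl. f_equal.
  assert (H := sin2_cos2 (Im z)). unfold Rsqr in H. lra.
Qed.

Lemma cexp_neq_0 z : cexp z <> RtoC 0.
Proof. apply Cmod_gt_0. rewrite Cmod_cexp. apply exp_pos. Qed.

Lemma DR_cexp w t : DR (fun t => cexp (RtoC t * w)) t (w * cexp (RtoC t * w))%C.
Proof.
  destruct w as [a b].
  apply isD_ext with (h := fun t => (exp (t * a) * cos (t * b), exp (t * a) * sin (t * b)))
    (r := 1); [lra|unfold distR; rewrite Rminus_diag, Rabs_R0; lra| |].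
  - intros s _. unfold cexp; simpl.
    replace (s * a - 0 * b) with (s * a) by ring. now replace (s * b + 0 * a) with (s * b) by ring.
  - eapply DR_eq; [|apply (DR_pair (fun t => exp (t * a) * cos (t * b))
      (fun t => exp (t * a) * sin (t * b))); auto_derive; auto].
    unfold cexp; simpl.
    replace (t * a - 0 * b) with (t * a) by ring. replace (t * b + 0 * a) with (t * b) by ring.
    apply injective_projections; simpl; ring.
Qed.

Lemma cexp_increment w : (cexp w - 1)%C = J (fun t => w * cexp (RtoC t * w))%C.
Proof.
  rewrite (J_derive (fun t => cexp (RtoC t * w))).
  - replace (1 * w)%C with w by ring. replace (0 * w)%C with (RtoC 0) by ring.
    now rewrite cexp_0.
  - intros t _. apply DR_cexp.
  - intros t _. exact (DR_continuous _ _ _ (DR_scal w _ _ _ (DR_cexp w t))).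
Qed.

(** By the functional equation it suffices to bound e^w - 1 - w quadratically near 0. Writing
    increments as integrals along the ray to [w] gives first a linear bound on e^w - 1, then,
    inserted in the same formula, the quadratic one. *)
Lemma D1_cexp z : D1 cexp z (cexp z).
Proof.
  assert (Hc : forall w, cont01 (fun t => cexp (RtoC t * w))).
  { intros w. exact (cont01_DR _ _ (DR_cexp w)). }
  assert (H1 : forall w, Cmod w < 1 -> Cmod (cexp w - 1) <= 2 * exp 1 * Cmod w).
  { intros w Hw. rewrite cexp_increment.
    replace (2 * exp 1 * Cmod w) with (2 * (Cmod w * exp 1)) by ring.
    apply J_bound; [auto using cont01_mult, cont01_const|].
    intros t Ht. rewrite Cmod_mult, Cmod_cexp. apply Rmult_le_compat_l; [apply Cmod_ge_0|].
    rewrite re_scal_l. assert (Q := re_le_Cmod w). apply Rabs_le_between in Q.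
    assert (L : t * Re w <= 1) by nra.
    destruct L as [L| ->]; [left; now apply exp_increasing|lra]. }
  assert (H2 : forall w, Cmod w < 1 -> Cmod (cexp w - 1 - w) <= 4 * exp 1 * (Cmod w * Cmod w)).
  { intros w Hw. rewrite cexp_increment.
    replace (J (fun t => w * cexp (RtoC t * w)) - w)%C
      with (J (fun t => w * cexp (RtoC t * w) - w)%C)
      by (rewrite J_minus, J_const; auto using cont01_mult, cont01_const).
    replace (4 * exp 1 * (Cmod w * Cmod w)) with (2 * (Cmod w * (2 * exp 1 * Cmod w))) by ring.
    apply J_bound; [auto using cont01_minus, cont01_mult, cont01_const|].
    intros t Ht. replace (w * cexp (t * w) - w)%C with (w * (cexp (t * w) - 1))%C by ring.
    rewrite Cmod_mult. apply Rmult_le_compat_l; [apply Cmod_ge_0|].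
    assert (Htw : Cmod (t * w) <= Cmod w).
    { rewrite Cmod_mult, Cmod_RtoC by lra. generalize (Cmod_ge_0 w). nra. }
    apply Rle_trans with (1 := H1 (t * w)%C ltac:(lra)).
    apply Rmult_le_compat_l; [generalize (exp_pos 1); lra|exact Htw]. }
  assert (He1 := exp_pos 1).
  set (N := Cmod (cexp z)). assert (HN : 0 < N) by (unfold N; rewrite Cmod_cexp; apply exp_pos).
  set (A := N * (4 * exp 1)). assert (HA : 0 < A) by (apply Rmult_lt_0_compat; lra).
  split.
  - exists N. split; [exact HN|]. intros w. rewrite Cmod_mult. unfold dist1, N. lra.
  - intros e He. exists (Rmin 1 (e / A)). split; [apply Rmin_glb_lt; [lra|now apply Rdiv_lt_0_compat]|].
    intros w Hw. unfold dist1 in *.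
    assert (W1 := Rlt_le_trans _ _ _ Hw (Rmin_l _ _)).
    assert (W2 := Rlt_le_trans _ _ _ Hw (Rmin_r _ _)).
    replace (cexp w) with (cexp z * cexp (w - z))%C
      by (rewrite <- cexp_plus; f_equal; ring).
    replace (cexp z * cexp (w - z) - cexp z - cexp z * (w - z))%C
      with (cexp z * (cexp (w - z) - 1 - (w - z)))%C by ring.
    rewrite Cmod_mult. fold N.
    apply Rle_trans with (N * (4 * exp 1 * (Cmod (w - z) * Cmod (w - z)))).
    + apply Rmult_le_compat_l; [lra|]. now apply H2.
    + replace (N * (4 * exp 1 * (Cmod (w - z) * Cmod (w - z))))
        with (A * Cmod (w - z) * Cmod (w - z)) by (unfold A; ring).
      apply Rmult_le_compat_r; [apply Cmod_ge_0|].
      replace e with (A * (e / A)) by (field; lra). apply Rmult_le_compat_l; lra.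
Qed.

Lemma derivative_zero_constant phi x0 r x :
  (forall v, Cmod (v - x0) < r -> D1 phi v 0) -> Cmod (x - x0) < r -> phi x = phi x0.
Proof.
  intros HD Hx.
  assert (E : J (fun _ => RtoC 0) = (phi x - phi x0)%C).
  { replace x with (x0 + RtoC 1 * (x - x0))%C at 1 by ring.
    replace x0 with (x0 + RtoC 0 * (x - x0))%C at 3 by ring.
    apply (J_derive (fun t => phi (x0 + RtoC t * (x - x0))%C)).
    - intros t Ht. eapply DR_eq; [|apply (DR_comp phi); [|apply DR_affine]].
      + instantiate (1 := RtoC 0). ring.
      + apply HD. apply Rle_lt_trans with (2 := Hx).
        apply Cmod_convex; [exact Ht| |lra]. rewrite Cmod_diag. apply Cmod_ge_0.
    - intros t _ e He. exists 1. split; [lra|]. intros s _. now rewrite Cmod_diag. }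
  rewrite J_const in E. replace (phi x) with ((phi x - phi x0) + phi x0)%C by ring.
  rewrite <- E. ring.
Qed.

(** With [Q] a primitive of [q], the product of [N] and e^(-Q) has derivative 0 and vanishes at
    [x0]; the exponential never vanishes. *)
Lemma linear_ode_zero q N x0 r x :
  (forall v, Cmod (v - x0) < r -> exists l, D1 q v l) ->
  (forall v, Cmod (v - x0) < r -> D1 N v (q v * N v)%C) -> N x0 = RtoC 0 ->
  Cmod (x - x0) < r -> N x = RtoC 0.
Proof.
  intros Hq HN HN0 Hx.
  set (r' := (Cmod (x - x0) + r) / 2).
  assert (Hx' : Cmod (x - x0) < r') by (unfold r'; lra).
  assert (Hr' : r' < r) by (unfold r'; lra).
  pose (Q := fun v => seg q x0 v).
  assert (HQ : forall v, Cmod (v - x0) < r' -> D1 Q v (q v)).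
  { intros v Hv.
    apply (D1_primitive (fun v => Cmod (v - x0) <= r') q x0 v (r' - Cmod (v - x0))).
    - apply convexC_disc.
    - apply closedC_disc.
    - rewrite Cmod_diag. generalize (Cmod_ge_0 (x - x0)). lra.
    - intros w Hw. destruct (Hq w) as [l Hl]; [lra|]. exact (D1_contC _ _ _ Hl).
    - intros w Hw _. apply Hq. lra.
    - lra.
    - intros w Hw. apply Rle_trans with (1 := Cmod_minus_triangle _ v _). lra. }
  assert (E := derivative_zero_constant (fun v => N v * cexp (0 - Q v))%C x0 r' x).
  assert (E' : (N x * cexp (0 - Q x))%C = RtoC 0).
  { rewrite E; [rewrite HN0; ring| |exact Hx'].
    intros v Hv. eapply D1_eq; [|apply D1_mult; [apply HN; lra|]].
    2: apply (D1_comp cexp (fun v => 0 - Q v)%C); [apply D1_cexp|];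
       apply D1_minus; [apply D1_const|now apply HQ].
    simpl. ring. }
  apply NNPP. intros HNx. revert E'. apply Cmult_neq_0; [exact HNx|apply cexp_neq_0].
Qed.

(** * Extension of the solutions *)

(** The difference N of the two sides satisfies N' = (u + beta) N and vanishes at [x0]. This avoids
    the usual substitution 1 / u, which would need [u] to have no zeros. *)
Lemma riccati_linearize u beta E F x0 r x :
  (forall v, Cmod (v - x0) < r -> D1 u v (u v * u v + beta v * u v)%C) ->
  (forall v, Cmod (v - x0) < r -> exists l, D1 beta v l) ->
  (forall v, Cmod (v - x0) < r -> D1 E v (beta v * E v)%C) ->
  (forall v, Cmod (v - x0) < r -> D1 F v (E v)) ->
  E x0 = RtoC 1 -> F x0 = RtoC 0 -> Cmod (x - x0) < r ->
  (u x * (1 - u x0 * F x))%C = (u x0 * E x)%C.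
Proof.
  intros Hu Hb HE HF E0 F0 Hx.
  assert (Z : (u x * (1 - u x0 * F x) - u x0 * E x)%C = RtoC 0).
  { apply (linear_ode_zero (fun v => u v + beta v)%C
      (fun v => u v * (1 - u x0 * F v) - u x0 * E v)%C x0 r x); [| | |exact Hx].
    - intros v Hv. destruct (Hb v Hv) as [l Hl]. eexists. apply D1_plus; [now apply Hu|exact Hl].
    - intros v Hv. eapply D1_eq; [|apply D1_minus;
        [apply D1_mult; [now apply Hu|apply D1_minus; [apply D1_const|apply D1_scal; now apply HF]]
        |apply D1_scal; now apply HE]].
      cbv beta. ring.
    - rewrite E0, F0. ring. }
  replace (u x * (1 - u x0 * F x))%C
    with ((u x * (1 - u x0 * F x) - u x0 * E x) + u x0 * E x)%C by ring.
  rewrite Z. ring.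
Qed.

Lemma D2_zero_on_ball h z r lx ly : 0 < r -> (forall w, dist2 z w < r -> h w = RtoC 0) ->
  D2 h z lx ly -> lx = RtoC 0 /\ ly = RtoC 0.
Proof.
  intros Hr H0 HD.
  assert (H : D2 h z 0 0).
  { apply D2_ext with (fun _ => RtoC 0) r; [exact Hr| |apply D2_const].
    intros w Hw. now rewrite H0. }
  rewrite <- (D2_partial_x _ _ _ _ HD), <- (D2_partial_y _ _ _ _ HD).
  now rewrite (D2_partial_x _ _ _ _ H), (D2_partial_y _ _ _ _ H).
Qed.

Lemma D2_opp h z lx ly : D2 h z lx ly -> D2 (fun w => - (1) * h w)%C z (- lx)%C (- ly)%C.
Proof.
  intros H. eapply D2_eq; [| |apply D2_mult; [apply D2_const|exact H]]; cbv beta; ring.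
Qed.

Lemma D2_minus h k z lx ly mx my : D2 h z lx ly -> D2 k z mx my ->
  D2 (fun w => h w - k w)%C z (lx - mx)%C (ly - my)%C.
Proof.
  intros H K. apply D2_ext with (fun w => h w + - (1) * k w)%C 1; [lra| |].
  - intros w _. ring.
  - eapply D2_eq; [| |exact (D2_plus _ _ _ _ _ _ _ H (D2_opp _ _ _ _ K))]; cbv beta; ring.
Qed.

Lemma D2_cexp h z lx ly : D2 h z lx ly ->
  D2 (fun w => cexp (h w)) z (lx * cexp (h z))%C (ly * cexp (h z))%C.
Proof.
  intros H. eapply D2_eq; [| |exact (D2_comp cexp h z _ lx ly (D1_cexp _) H)]; cbv beta; ring.
Qed.

(** Stated for [f] only, since [g] follows by symmetry. The quotient is global on the polydisc, and
    its denominator takes the value 1 at [p]. *)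
Lemma riccati_solution_quotient a b r s B C0 f g p rho0 :
  let Om := polydisc a b r s in
  Om p -> hol Om B -> hol Om C0 -> 0 < rho0 ->
  hol (fun w => dist2 p w < rho0) f -> hol (fun w => dist2 p w < rho0) g ->
  (forall w, dist2 p w < rho0 -> Om w /\
    partial_x f w = (f w * f w - B w * f w + partial_x B w)%C /\
    (partial_x g w - partial_y f w
      = RtoC 2 * (f w * g w - B w * g w - C0 w * f w + B w * C0 w))%C /\
    partial_y g w = (- (g w * g w) + C0 w * g w + partial_y C0 w)%C) ->
  exists h k, hol Om h /\ hol Om k /\
    (forall z e, Om z -> 0 < e -> ~ forall w, dist2 z w < e -> k w = RtoC 0) /\
    exists e, 0 < e /\ forall w, dist2 p w < e -> k w <> RtoC 0 /\ f w = (h w / k w)%C.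
Proof.
  destruct p as [x0 y0]. intros Om Hp HB HC Hr0 Hf Hg Hsys.
  assert (Hx0 : Cmod (x0 - a) < r) by apply Hp.
  assert (Hy0 : Cmod (y0 - b) < s) by apply Hp.
  assert (Oopen : open2 Om) by apply open2_polydisc.
  assert (Ofr : forall z, Om z -> Om (x0, snd z)) by (intros z [_ Hz]; split; [exact Hx0|exact Hz]).
  destruct (primitive_x a b r s B x0 HB Hx0) as [IB [HIB IB0]].
  pose (E := fun z => cexp (IB z)).
  assert (HE : forall z, Om z -> exists ly, D2 E z (B z * E z)%C ly).
  { intros z Hz. destruct (HIB z Hz) as [ly Hl]. eexists. exact (D2_cexp _ _ _ _ Hl). }
  assert (holE : hol Om E) by (intros z Hz; destruct (HE z Hz); eauto).
  assert (E0 : forall y, E (x0, y) = RtoC 1) by (intros y; unfold E; rewrite IB0; apply cexp_0).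
  destruct (primitive_x a b r s E x0 holE Hx0) as [F [HF F0]].
  assert (holF : hol Om F) by (intros z Hz; destruct (HF z Hz); eauto).
  destruct (primitive_y a b r s C0 y0 HC Hy0) as [IC [HIC IC0]].
  pose (G := fun z => cexp (- (1) * IC z)%C).
  assert (HG : forall z, Om z -> exists lx, D2 G z lx (- C0 z * G z)%C).
  { intros z Hz. destruct (HIC z Hz) as [lx Hl]. eexists.
    exact (D2_cexp _ _ _ _ (D2_opp _ _ _ _ Hl)). }
  assert (holG : hol Om G) by (intros z Hz; destruct (HG z Hz); eauto).
  assert (G0 : forall x, G (x, y0) = RtoC 1).
  { intros x; unfold G; rewrite IC0. replace (- (1) * 0)%C with (RtoC 0) by ring. apply cexp_0. }
  destruct (primitive_y a b r s G y0 holG Hy0) as [H [HH H0]].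
  assert (holH : hol Om H) by (intros z Hz; destruct (HH z Hz); eauto).
  (* The bidisc of radius [rho] about [p] fits in the [dist2] ball and, being a product, contains
     the slices through [p] along which the equations are solved. *)
  set (rho := rho0 / 2). assert (Hrho : 0 < rho) by (unfold rho; lra).
  assert (HN : forall x y, Cmod (x - x0) < rho -> Cmod (y - y0) < rho ->
    dist2 (x0, y0) (x, y) < rho0) by (intros; unfold dist2, rho in *; simpl; lra).
  assert (Hxx : Cmod (x0 - x0) < rho) by (rewrite Cmod_diag; exact Hrho).
  assert (Hyy : Cmod (y0 - y0) < rho) by (rewrite Cmod_diag; exact Hrho).
  pose (u := fun z => (f z - B z)%C). pose (v := fun z => (g z - C0 z)%C).
  assert (Hu : forall x y, Cmod (x - x0) < rho -> Cmod (y - y0) < rho ->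
    D2 u (x, y) (u (x, y) * u (x, y) + B (x, y) * u (x, y))%C
      (partial_y f (x, y) - partial_y B (x, y))%C).
  { intros x y Hx Hy. assert (W := HN x y Hx Hy). destruct (Hsys _ W) as [Ow [Sx _]].
    eapply D2_eq; [| |exact (D2_minus _ _ _ _ _ _ _ (hol_D2 _ _ _ Hf W) (hol_D2 _ _ _ HB Ow))].
    - rewrite Sx. unfold u. ring.
    - reflexivity. }
  assert (Hv : forall x y, Cmod (x - x0) < rho -> Cmod (y - y0) < rho ->
    D2 v (x, y) (partial_x g (x, y) - partial_x C0 (x, y))%C
      (- (v (x, y) * v (x, y) + C0 (x, y) * v (x, y)))%C).
  { intros x y Hx Hy. assert (W := HN x y Hx Hy). destruct (Hsys _ W) as [Ow [_ [_ Sy]]].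
    eapply D2_eq; [| |exact (D2_minus _ _ _ _ _ _ _ (hol_D2 _ _ _ Hg W) (hol_D2 _ _ _ HC Ow))].
    - reflexivity.
    - rewrite Sy. unfold v. ring. }
  assert (HO : forall x y, Cmod (x - x0) < rho -> Cmod (y - y0) < rho -> Om (x, y)).
  { intros x y Hx Hy. now apply Hsys, HN. }
  assert (Lu : forall x y, Cmod (x - x0) < rho -> Cmod (y - y0) < rho ->
    (u (x, y) * (1 - u (x0, y) * F (x, y)) = u (x0, y) * E (x, y))%C).
  { intros x y Hx Hy.
    apply (riccati_linearize (fun x => u (x, y)) (fun x => B (x, y)) (fun x => E (x, y))
      (fun x => F (x, y)) x0 rho x); auto.
    - intros t Ht. exact (D2_D1_x _ _ _ _ _ (Hu t y Ht Hy)).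
    - intros t Ht. eexists. exact (D2_D1_x _ _ _ _ _ (hol_D2 _ _ _ HB (HO t y Ht Hy))).
    - intros t Ht. destruct (HE _ (HO t y Ht Hy)) as [ly Hl]. exact (D2_D1_x _ _ _ _ _ Hl).
    - intros t Ht. destruct (HF _ (HO t y Ht Hy)) as [ly Hl]. exact (D2_D1_x _ _ _ _ _ Hl). }
  assert (Lv : forall x y, Cmod (x - x0) < rho -> Cmod (y - y0) < rho ->
    (v (x, y) * (1 + v (x, y0) * H (x, y)) = v (x, y0) * G (x, y))%C).
  { intros x y Hx Hy.
    (* The third equation becomes the Bernoulli equation of [riccati_linearize] for [- v], with
       coefficient [- C0]. *)
    assert (X := riccati_linearize (fun y => - (1) * v (x, y))%C (fun y => - (1) * C0 (x, y))%C
      (fun y => G (x, y)) (fun y => H (x, y)) y0 rho y).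
    cbv beta in X.
    transitivity (- (- (1) * v (x, y) * (1 - - (1) * v (x, y0) * H (x, y))))%C; [ring|].
    rewrite X; auto.
    - cbv beta; ring.
    - intros t Ht. eapply D1_eq; [|apply D1_scal; exact (D2_D1_y _ _ _ _ _ (Hv x t Hx Ht))]. ring.
    - intros t Ht. eexists. apply D1_scal.
      exact (D2_D1_y _ _ _ _ _ (hol_D2 _ _ _ HC (HO x t Hx Ht))).
    - intros t Ht. destruct (HG _ (HO x t Hx Ht)) as [lx Hl].
      apply D1_eq with (2 := D2_D1_y _ _ _ _ _ Hl). ring.
    - intros t Ht. destruct (HH _ (HO x t Hx Ht)) as [lx Hl]. exact (D2_D1_y _ _ _ _ _ Hl). }
  pose (c := v (x0, y0)). pose (c' := (partial_x g (x0, y0) - partial_x C0 (x0, y0))%C).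
  (* The [x]-derivative of the identity [Lv] along [x = x0]. *)
  assert (Lv' : forall y, Cmod (y - y0) < rho ->
    (v (x0, y) * (c * partial_x H (x0, y) + H (x0, y) * c')
      + (1 + c * H (x0, y)) * (partial_x g (x0, y) - partial_x C0 (x0, y))
     = c * partial_x G (x0, y) + G (x0, y) * c')%C).
  { intros y Hy. assert (O := HO x0 y Hxx Hy).
    assert (T0 := D2_D1_x _ _ _ _ _ (Hv x0 y0 Hxx Hyy)).
    assert (TH := D2_D1_x _ _ _ _ _ (hol_D2 _ _ _ holH O)).
    assert (TG := D2_D1_x _ _ _ _ _ (hol_D2 _ _ _ holG O)).
    assert (Tv := D2_D1_x _ _ _ _ _ (Hv x0 y Hxx Hy)).
    assert (A := D1_mult _ _ _ _ _ Tv
      (D1_plus _ _ _ _ _ (D1_const (RtoC 1) x0) (D1_mult _ _ _ _ _ T0 TH))).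
    assert (D := D1_mult _ _ _ _ _ T0 TG).
    assert (X := D1_ext _ _ _ _ rho Hrho (fun x Hx => Lv x y Hx Hy) A).
    assert (Y := D1_unique _ _ _ _ X D). cbv beta in Y.
    fold c c' in Y. rewrite <- Y. ring. }
  (* Functions on the line x = x0 are carried as functions on the polydisc that do not depend on x,
     so that the primitives above apply to them. *)
  pose (Hf0 := fun z : C * C => H (x0, snd z)).
  pose (Gf0 := fun z : C * C => G (x0, snd z)).
  pose (k1 := fun z => (1 + c * Hf0 z)%C).
  (* This is [k1 * k1] times v_x - B_y + C_x on x = x0, with v and v_x eliminated by [Lv] and [Lv'].
     The square clears every denominator, so [S] is holomorphic on the whole polydisc. *)
  pose (S := fun z : C * C => (k1 z * (c * partial_x G (x0, snd z) + c' * Gf0 z)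
     - c * Gf0 z * (c' * Hf0 z + c * partial_x H (x0, snd z))
     - k1 z * k1 z * (partial_y B (x0, snd z) - partial_x C0 (x0, snd z)))%C).
  assert (holHf : hol Om Hf0) by now apply (hol_freeze_x Om x0 H).
  assert (holGf : hol Om Gf0) by now apply (hol_freeze_x Om x0 G).
  assert (holk1 : hol Om k1) by (unfold k1; auto using hol_plus, hol_mult, hol_const).
  assert (holS : hol Om S).
  { assert (A1 := hol_freeze_x Om x0 _ Ofr (hol_partial_x _ _ Oopen holG)).
    assert (A2 := hol_freeze_x Om x0 _ Ofr (hol_partial_x _ _ Oopen holH)).
    assert (A3 := hol_freeze_x Om x0 _ Ofr (hol_partial_y _ _ Oopen HB)).
    assert (A4 := hol_freeze_x Om x0 _ Ofr (hol_partial_x _ _ Oopen HC)).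
    unfold S. auto 10 using hol_minus, hol_plus, hol_mult, hol_const. }
  destruct (primitive_y a b r s S y0 holS Hy0) as [IS [HIS IS0]].
  assert (holIS : hol Om IS) by (intros z Hz; destruct (HIS z Hz); eauto).
  pose (m := fun z : C * C => (u (x0, y0) + IS (x0, snd z))%C).
  pose (M := fun z => (k1 z * k1 z)%C).
  assert (Hk1 : forall z, Om z -> D2 k1 z 0 (c * Gf0 z)%C).
  { intros z Hz. destruct (HH _ (Ofr z Hz)) as [lx Hl].
    eapply D2_eq; [| |apply D2_plus; [apply D2_const|apply D2_mult;
      [apply D2_const|exact (D2_freeze_x _ _ _ _ _ Hl)]]]; unfold Gf0; cbv beta; ring. }
  assert (Hm : forall z, Om z -> D2 m z 0 (S z)).
  { intros z Hz. destruct (HIS _ (Ofr z Hz)) as [lx Hl].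
    eapply D2_eq; [| |apply D2_plus; [apply D2_const|exact (D2_freeze_x _ _ _ _ _ Hl)]].
    - cbv beta; ring.
    - unfold S, k1, Hf0, Gf0. simpl. ring. }
  assert (HMm : forall z, Om z -> D2 M z 0 (2 * k1 z * (c * Gf0 z))%C).
  { intros z Hz. eapply D2_eq; [| |exact (D2_mult _ _ _ _ _ _ _ (Hk1 z Hz) (Hk1 z Hz))].
    - cbv beta; ring.
    - ring. }
  assert (k10 : forall x, k1 (x, y0) = RtoC 1).
  { intros x. unfold k1, Hf0. simpl. rewrite H0. ring. }
  assert (LM : forall y, Cmod (y - y0) < rho -> (M (x0, y) * u (x0, y))%C = m (x0, y)).
  { intros y Hy.
    assert (X := derivative_zero_constant (fun y => M (x0, y) * u (x0, y) - m (x0, y))%C y0 rho y).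
    assert (Z : (M (x0, y) * u (x0, y) - m (x0, y))%C = RtoC 0).
    { rewrite X; [| |exact Hy].
      - unfold M, m. rewrite k10. simpl. rewrite IS0. ring.
      - intros t Ht. assert (O := HO x0 t Hxx Ht).
        assert (TM := D2_D1_y _ _ _ _ _ (HMm _ O)). assert (Tm := D2_D1_y _ _ _ _ _ (Hm _ O)).
        assert (Tu := D2_D1_y _ _ _ _ _ (Hu x0 t Hxx Ht)).
        eapply D1_eq; [|exact (D1_minus _ _ _ _ _ (D1_mult _ _ _ _ _ TM Tu) Tm)].
        (* The mixed equation eliminates f_y. By [Lv] the term from the derivative of [M] is 2 M v
           u, which cancels the contribution -2 M u v; [Lv'] identifies the rest with [S]. *)
        destruct (Hsys _ (HN x0 t Hxx Ht)) as [_ [_ [Sxy _]]].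
        assert (V1 := Lv x0 t Hxx Ht). assert (V2 := Lv' t Ht). fold c in V1.
        unfold S, M, k1, Hf0, Gf0 in *. simpl.
        set (fy := partial_y f (x0, t)) in *. set (gx := partial_x g (x0, t)) in *.
        replace fy with (gx - RtoC 2 * (u (x0, t) * v (x0, t)))%C.
        + set (gv := (gx - partial_x C0 (x0, t))%C) in *.
          replace gx with (gv + partial_x C0 (x0, t))%C by (unfold gv; ring).
          replace (c * partial_x G (x0, t) + c' * G (x0, t))%C
            with (c * partial_x G (x0, t) + G (x0, t) * c')%C by ring.
          rewrite <- V2, <- V1.
          replace (c' * H (x0, t) + c * partial_x H (x0, t))%C
            with (c * partial_x H (x0, t) + H (x0, t) * c')%C by ring.
          clear X. ring.
        + replace fy with (gx - (gx - fy))%C by ring. rewrite Sxy. unfold u, v. ring. }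
    replace (m (x0, y)) with (M (x0, y) * u (x0, y) - (M (x0, y) * u (x0, y) - m (x0, y)))%C by ring.
    rewrite Z. ring. }
  (* Substituting u(x0, y) = m / M into [Lu] and clearing [M] gives u k = m E; adding [B] turns u
     into [f]. *)
  pose (k := fun z => (M z - m z * F z)%C). pose (h := fun z => (B z * k z + m z * E z)%C).
  assert (holm : hol Om m) by (intros z Hz; eauto).
  assert (holM : hol Om M) by (intros z Hz; eauto).
  assert (holk : hol Om k) by (unfold k; auto using hol_minus, hol_mult).
  exists h, k. split; [|split; [exact holk|split]].
  - unfold h. auto using hol_plus, hol_mult.
  - intros z e Hz He Hk0.
    destruct (Oopen z Hz) as [e1 [He1 Oe]].
    assert (Hm0 : forall w, dist2 z w < Rmin e e1 -> m w = RtoC 0).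
    { intros w Hw.
      assert (W1 := Rlt_le_trans _ _ _ Hw (Rmin_l _ _)).
      assert (W2 := Rlt_le_trans _ _ _ Hw (Rmin_r _ _)).
      destruct (HF w (Oe w W2)) as [ly Hl].
      (* Neither [M] nor [m] depends on x, so the x-derivative of [k] is [- m * E]. *)
      assert (Dk := D2_minus _ _ _ _ _ _ _ (HMm w (Oe w W2))
        (D2_mult _ _ _ _ _ _ _ (Hm w (Oe w W2)) Hl)).
      assert (Hr : 0 < e - dist2 z w) by lra.
      assert (Hkw : forall t, dist2 w t < e - dist2 z w -> k t = RtoC 0).
      { intros t Ht. apply Hk0. generalize (dist2_triangle z w t). lra. }
      destruct (D2_zero_on_ball k w _ _ _ Hr Hkw Dk) as [X _].
      apply NNPP. intros Hmw.
      assert (Y : (m w * E w)%C = RtoC 0).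
      { replace (m w * E w)%C with (- (0 - (m w * E w + F w * 0)))%C by ring. rewrite X. ring. }
      revert Y. apply Cmult_neq_0; [exact Hmw|apply cexp_neq_0]. }
    assert (Hk10 : forall w, dist2 z w < Rmin e e1 -> k1 w = RtoC 0).
    { intros w Hw. specialize (Hm0 w Hw).
      specialize (Hk0 w (Rlt_le_trans _ _ _ Hw (Rmin_l _ _))).
      apply NNPP. intros Hk1w.
      assert (Y : (k1 w * k1 w)%C = RtoC 0).
      { rewrite <- Hk0. unfold k, M. rewrite Hm0. ring. }
      revert Y. now apply Cmult_neq_0. }
    assert (Hmin : 0 < Rmin e e1) by now apply Rmin_glb_lt.
    destruct (D2_zero_on_ball _ _ _ _ _ Hmin Hk10 (Hk1 z Hz)) as [_ X].
    assert (Hc : c = RtoC 0).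
    { apply NNPP. intros Hc. revert X. apply Cmult_neq_0; [exact Hc|apply cexp_neq_0]. }
    specialize (Hk10 z). rewrite dist2_diag in Hk10. specialize (Hk10 Hmin).
    unfold k1 in Hk10. rewrite Hc in Hk10. replace (1 + 0 * Hf0 z)%C with (RtoC 1) in Hk10 by ring.
    apply RtoC_inj in Hk10. lra.
  (* By continuity [k] stays nonzero near [p], where the identity u k = m E can therefore be divided
     by [k]. *)
  - assert (kp : k (x0, y0) = RtoC 1).
    { unfold k, M. rewrite k10, F0. ring. }
    destruct (holk _ Hp) as [lx [ly Dk]].
    destruct (D2_continuous _ _ _ _ Dk 1) as [e [He P]]; [lra|].
    exists (Rmin e rho). split; [now apply Rmin_glb_lt|]. intros [x y] Hw.
    assert (W1 := Rlt_le_trans _ _ _ Hw (Rmin_l _ _)).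
    assert (W2 := Rlt_le_trans _ _ _ Hw (Rmin_r _ _)).
    assert (Hkw : k (x, y) <> RtoC 0).
    { intros K0. specialize (P _ W1). rewrite K0, kp in P.
      replace (0 - 1)%C with (- (1))%C in P by ring. rewrite Cmod_m1 in P. lra. }
    split; [exact Hkw|].
    unfold dist2 in W2; simpl in W2.
    assert (A1 := Cmod_ge_0 (x - x0)). assert (A2 := Cmod_ge_0 (y - y0)).
    assert (Hx : Cmod (x - x0) < rho) by lra. assert (Hy : Cmod (y - y0) < rho) by lra.
    assert (U1 := Lu x y Hx Hy). assert (U2 := LM y Hy).
    assert (Em : m (x, y) = m (x0, y)) by reflexivity.
    assert (EM : M (x, y) = M (x0, y)) by reflexivity.
    assert (X : (u (x, y) * k (x, y))%C = (m (x, y) * E (x, y))%C).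
    { unfold k. rewrite Em, EM, <- U2.
      transitivity (M (x0, y) * (u (x, y) * (1 - u (x0, y) * F (x, y))))%C; [ring|].
      rewrite U1. ring. }
    unfold h. rewrite <- X. unfold u. field. exact Hkw.
Qed.

(** * Return to the notions of the statement *)

Lemma holomorphic_on_hol U h : holomorphic_on U h <-> hol U h.
Proof.
  split; intros H z Hz.
  - apply ex_filterdiff_D2. now apply H.
  - destruct (H z Hz) as [lx [ly Hl]]. exact (D2_ex_filterdiff _ _ _ _ Hl).
Qed.

Lemma open_open2 (U : C * C -> Prop) : open U <-> open2 U.
Proof.
  split; intros H z Hz.
  - apply (locally_C2 z U). now apply H.
  - apply (locally_C2 z U). now apply H.
Qed.

(** The same global pair [h], [k] serves as the local quotient at every point. *)
Lemma extends_of_quotient a b r s p f h k :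
  hol (polydisc a b r s) h -> hol (polydisc a b r s) k ->
  (forall z e, polydisc a b r s z -> 0 < e -> ~ forall w, dist2 z w < e -> k w = RtoC 0) ->
  (exists e, 0 < e /\ forall w, dist2 p w < e -> k w <> RtoC 0 /\ f w = (h w / k w)%C) ->
  extends_meromorphically p (polydisc a b r s) f.
Proof.
  intros Hh Hk Hnz [e [He Hf]]. exists (fun z => h z / k z)%C. split.
  - intros z Hz. exists (polydisc a b r s), h, k.
    split; [apply open_open2, open2_polydisc|]. split; [exact Hz|]. split; [auto|].
    split; [|split; [|split; [|auto]]].
    + now apply holomorphic_on_hol.
    + now apply holomorphic_on_hol.
    + intros w Hw Hl. apply locally_C2 in Hl. destruct Hl as [d [Hd Hl]]. exact (Hnz w d Hw Hd Hl).
  - apply locally_C2. exists e. split; [exact He|]. intros w Hw. symmetry. now apply Hf.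
Qed.

Theorem lemma3p10 (a b : C) (r s : R) (hr : Rlt 0 r) (hs : Rlt 0 s)
  (Pi : projective_structure (polydisc a b r s))
  (hA : forall z, polydisc a b r s z -> coefA Pi z = RtoC 0)
  (hD : forall z, polydisc a b r s z -> coefD Pi z = RtoC 0)
  (p : C * C) (hp : polydisc a b r s p)
  (f g : C * C -> C)
  (hf : holomorphic_germ p f) (hg : holomorphic_germ p g)
  (hsys : locally p (riccati_system_at Pi f g)) :
  extends_meromorphically p (polydisc a b r s) f /\
  extends_meromorphically p (polydisc a b r s) g.
Proof.
  set (Om := polydisc a b r s) in *.
  pose (B := coefB Pi). pose (C0 := coefC Pi).
  assert (HB : hol Om B) by apply holomorphic_on_hol, (coefB_holo _ Pi).
  assert (HC : hol Om C0) by apply holomorphic_on_hol, (coefC_holo _ Pi).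
  assert (Oopen : open2 Om) by apply open2_polydisc.
  assert (Hloc : exists e, 0 < e /\ hol (fun w => dist2 p w < e) f /\
    hol (fun w => dist2 p w < e) g /\ (forall w, dist2 p w < e -> Om w /\
    partial_x f w = (f w * f w - B w * f w + partial_x B w)%C /\
    (partial_x g w - partial_y f w
      = RtoC 2 * (f w * g w - B w * g w - C0 w * f w + B w * C0 w))%C /\
    partial_y g w = (- (g w * g w) + C0 w * g w + partial_y C0 w)%C)).
  { destruct hf as [Uf [Of [Pf Hf]]]. destruct hg as [Ug [Og [Pg Hg]]].
    destruct (proj1 (open_open2 Uf) Of p Pf) as [e1 [He1 B1]].
    destruct (proj1 (open_open2 Ug) Og p Pg) as [e2 [He2 B2]].
    destruct (Oopen p hp) as [e3 [He3 B3]].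
    apply locally_C2 in hsys. destruct hsys as [e4 [He4 B4]].
    set (e := Rmin (Rmin e1 e2) (Rmin e3 e4)).
    assert (Hmin : e <= e1 /\ e <= e2 /\ e <= e3 /\ e <= e4).
    { unfold e. generalize (Rmin_l (Rmin e1 e2) (Rmin e3 e4)) (Rmin_r (Rmin e1 e2) (Rmin e3 e4))
        (Rmin_l e1 e2) (Rmin_r e1 e2) (Rmin_l e3 e4) (Rmin_r e3 e4). lra. }
    exists e. split; [repeat apply Rmin_glb_lt; assumption|].
    split; [|split].
    - intros w Hw. apply (proj1 (holomorphic_on_hol Uf f) Hf), B1. lra.
    - intros w Hw. apply (proj1 (holomorphic_on_hol Ug g) Hg), B2. lra.
    - intros w Hw. assert (Ow : Om w) by (apply B3; lra). split; [exact Ow|].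
      destruct (B4 w) as [S1 [S2 S3]]; [lra|]. fold B C0 in S1, S2, S3.
      (* The coefficients A and D vanish only on the polydisc; as it is open, their partial
         derivatives vanish there too. *)
      assert (Z : forall h, (forall z, Om z -> h z = RtoC 0) ->
        partial_x h w = RtoC 0 /\ partial_y h w = RtoC 0).
      { intros h Hh. destruct (Oopen w Ow) as [d [Hd Bd]].
        assert (H : D2 h w 0 0).
        { apply D2_ext with (fun _ => RtoC 0) d; [exact Hd| |apply D2_const].
          intros v Hv. symmetry. now apply Hh, Bd. }
        split; [exact (D2_partial_x _ _ _ _ H)|exact (D2_partial_y _ _ _ _ H)]. }
      destruct (Z _ hA) as [_ ZA]. destruct (Z _ hD) as [ZD _].
      rewrite hA, ZA in S1 by exact Ow. rewrite hA, hD in S2 by exact Ow.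
      rewrite hD, ZD in S3 by exact Ow.
      rewrite S1, S2, S3. repeat split; ring. }
  destruct Hloc as [e [He [Hf [Hg Hsys]]]].
  split.
  - destruct (riccati_solution_quotient a b r s B C0 f g p e hp HB HC He Hf Hg Hsys)
      as [h [k [Hh [Hk [Hnz Hq]]]]].
    exact (extends_of_quotient a b r s p f h k Hh Hk Hnz Hq).
  - (* Exchanging [x] and [y] turns [(B, C, f, g)] into [(-C, -B, -g, -f)]. *)
    assert (Osw : forall z, polydisc b a s r z -> Om (swap z)).
    { intros z Hz. now apply polydisc_swap. }
    pose (neg := fun (h : C * C -> C) z => (- (1) * h (swap z))%C).
    assert (Hneg : forall (U V : C * C -> Prop) h, (forall z, V z -> U (swap z)) -> hol U h ->
      hol V (neg h)).
    { intros U V h HUV Hh. apply hol_mult; [apply hol_const|].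
      apply (hol_subset (fun z => U (swap z))); [exact HUV|]. now apply hol_swap. }
    assert (Dneg : forall U h z, hol U h -> U (swap z) ->
      partial_x (neg h) z = (- partial_y h (swap z))%C /\
      partial_y (neg h) z = (- partial_x h (swap z))%C).
    { intros U h z Hh Hz. assert (X := D2_opp _ _ _ _ (D2_swap _ _ _ _ (hol_D2 _ _ _ Hh Hz))).
      split; [exact (D2_partial_x _ _ _ _ X)|exact (D2_partial_y _ _ _ _ X)]. }
    assert (Dsw : forall w, dist2 (swap p) w < e -> dist2 p (swap w) < e).
    { intros w Hw. rewrite <- dist2_swap, swap_swap. exact Hw. }
    destruct (riccati_solution_quotient b a s r (neg C0) (neg B) (neg g) (neg f) (swap p) e)
      as [h [k [Hh [Hk [Hnz [d [Hd Hq]]]]]]].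
    + now apply polydisc_swap.
    + exact (Hneg _ _ _ Osw HC).
    + exact (Hneg _ _ _ Osw HB).
    + exact He.
    + now apply (Hneg (fun w => dist2 p w < e)).
    + now apply (Hneg (fun w => dist2 p w < e)).
    + intros w Hw. specialize (Dsw w Hw). destruct (Hsys _ Dsw) as [Ow [S1 [S2 S3]]].
      destruct (Dneg _ f w Hf Dsw) as [Fx Fy]. destruct (Dneg _ g w Hg Dsw) as [Gx Gy].
      destruct (Dneg _ _ w HB Ow) as [Bx By]. destruct (Dneg _ _ w HC Ow) as [Cx Cy].
      split; [now apply polydisc_swap in Ow|].
      rewrite Fx, Fy, Gx, Gy, By, Cx. rewrite S1, S3. unfold neg. split; [ring|split; [|ring]].
      transitivity (partial_x g (swap w) - partial_y f (swap w))%C; [ring|]. rewrite S2. ring.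
    (* Undoing the exchange and the sign turns the quotient h / k found for [neg g] into a quotient
       for [g] with numerator [neg h]. *)
    + apply (extends_of_quotient a b r s p g (neg h) (fun z => k (swap z))).
      * apply (Hneg (polydisc b a s r)); [|exact Hh]. intros z Hz. now apply polydisc_swap.
      * apply (hol_subset (fun z => polydisc b a s r (swap z))); [|now apply hol_swap].
        intros z Hz. now apply polydisc_swap.
      * intros z c Hz Hc Hk0. apply (Hnz (swap z) c); [now apply polydisc_swap|exact Hc|].
        intros w Hw. rewrite <- (swap_swap w). apply Hk0.
        now rewrite <- dist2_swap, swap_swap.
      * exists d. split; [exact Hd|]. intros w Hw.
        destruct (Hq (swap w)) as [Kw Ew]; [now rewrite dist2_swap|].
        split; [exact Kw|]. unfold neg in *. rewrite swap_swap in Ew.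
        replace (g w) with (- (- (1) * g w))%C by ring. rewrite Ew. field. exact Kw.
Qed.
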